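(* Let $\Bbbk$ be an algebraically closed field with $\operatorname{char}(\Bbbk)\neq2$, let $a,b,c\in\Bbbk$ satisfy $abc\neq0$ and $(3abc)^3\neq(a^3+b^3+c^3)^3$, and let $A'$ be the $\Bbbk$-algebra on (degree-one) generators $x,y,z$ with defining relations $$a\,xy+b\,yx+c\,z^2=0,\qquad a\,yz+b\,zy+c\,x^2=0,\qquad a\,zx+b\,xz+c\,y^2=0.$$ If $a^3=b^3\neq c^3$, then $A'$ is a regular graded skew Clifford algebra and a twist of a graded Clifford algebra by an automorphism. If $b^3=c^3\neq a^3$ or if $a^3=c^3\neq b^3$, then $A'$ is a twist of a regular graded skew Clifford algebra by an automorphism.
   Context: Regular algebras. A graded $\Bbbk$-algebra $A=\bigoplus_{n\ge 0}A_n$ with $A_0=\Bbbk$, generated by the finite-dimensional space $A_1$, is regular (in the sense of Artin–Schelter) of global dimension $d$ if it has finite global dimension $d$, has polynomial growth, and is Gorenstein, i.e. $\operatorname{Ext}^i_A(\Bbbk,A)=0$ for $i\ne d$ and $\operatorname{Ext}^d_A(\Bbbk,A)\cong\Bbbk$ up to a degree shift. It is quadratic if its defining relations are spanned by a subspace of $A_1\otimes_\Bbbk A_1$. Twists. If $D$ is a graded algebra and $\phi$ is a graded degree-zero automorphism of $D$, the twist $D^\phi$ of $D$ by $\phi$ has the same underlying graded vector space and multiplication determined by $u*v=u\,\phi(v)$ for $u,v\in D_1$ (in general $u*v=u\,\phi^m(v)$ for $u\in D_m$). Graded skew Clifford algebras ($\operatorname{char}(\Bbbk)\ne2$). Let $\mu=(\mu_{ij})\in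 M(n,\Bbbk)$ with $\mu_{ij}\in\Bbbk^\times$, $\mu_{ij}\mu_{ji}=1$ for $i\neq j$, $\mu_{ii}=1$. A matrix $M$ is $\mu$-symmetric if $M_{ij}=\mu_{ij}M_{ji}$ for all $i,j$. Given $\mu$-symmetric matrices $M_1,\dots,M_n$, an associated graded skew Clifford algebra is a graded $\Bbbk$-algebra on degree-one generators $x_1,\dots,x_n$ and degree-two generators $y_1,\dots,y_n$ with defining relations given by: (a) $x_ix_j+\mu_{ij}x_jx_i=\sum_{k=1}^n (M_k)_{ij}y_k$ for all $i,j$; and (b) the existence of a normalizing sequence $\{r_1,\dots,r_n\}$ of homogeneous degree-two elements spanning $\Bbbk y_1+\cdots+\Bbbk y_n$ (normalizing: the image of $r_{k+1}$ is a normal element in the quotient by $\langle r_1,\dots,r_k\rangle$ for each $k\geq 0$). If $\mu_{ij}=1$ for all $i,j$ and all the $y_k$ are central, the algebra is called a graded Clifford algebra. A regular graded skew Clifford algebra is a graded skew Clifford algebra that is quadratic and regular. *)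

(* Defs.v *)
From HB Require Import structures.
From mathcomp Require Import all_boot all_order all_algebra.
From mathcomp Require Import monalg.

Set Implicit Arguments.
Unset Strict Implicit.
Unset Printing Implicit Defensive.

Import GRing.Theory.
Local Open Scope ring_scope.

Section Span.
Variables (k : fieldType) (V : lmodType k).

Definition in_span n (v : 'I_n -> V) (u : V) : Prop :=
  exists c : 'I_n -> k, u = \sum_i c i *: v i.

Definition dim_le (W : V -> Prop) (n : nat) : Prop :=
  exists v : 'I_n -> V, forall u, W u -> in_span v u.

End Span.

(* The two-sided ideal generated by S. *)
Inductive ideal (T : nzRingType) (S : T -> Prop) : T -> Prop :=
| ideal_gen p of S p : ideal S p
| ideal_0 : ideal S 0
| ideal_add p q of ideal S p & ideal S q : ideal S (p + q)
| ideal_mul u v p of ideal S p : ideal S (u * p * v).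

(* k<I>: the monoid algebra of the free (noncommutative) monoid on I. *)
Notation free_alg k I := {malg k[fmonom I]}.

Section Presentations.
Variables (k : fieldType) (I : choiceType).

Notation FI := (free_alg k I).

Definition gen (i : I) : FI := << fmu i >>.

Definition weight (wt : I -> nat) (m : fmonom I) : nat :=
  (\sum_(i <- fmonom_val m) wt i)%N.

Definition homogeneous (wt : I -> nat) (d : nat) (p : FI) : Prop :=
  forall m, p@_m != 0 -> weight wt m = d.

Variables (A : algType k) (g : I -> A).

Definition evaluates_at (f : {lrmorphism FI -> A}) : Prop :=
  forall i, f (gen i) = g i.

(* A is the algebra on the generators g with defining relations rels, i.e.
   evaluation at g induces k<I> / <rels> ~= A. *)
Definition presented_by (rels : FI -> Prop) : Prop :=
  exists f : {lrmorphism FI -> A},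
    [/\ evaluates_at f,
        forall a, exists p, f p = a
      & forall p, f p = 0 <-> ideal rels p].

(* The grading of A for which g i has degree wt i. *)
Definition gen_grading (wt : I -> nat) (d : nat) (a : A) : Prop :=
  exists f : {lrmorphism FI -> A},
    evaluates_at f /\ exists2 p, homogeneous wt d p & f p = a.

End Presentations.

Section GradedAlgebras.
Variables (k : fieldType) (A : algType k).
(* gr n is the homogeneous component A_n. *)
Variable gr : nat -> A -> Prop.

Record is_graded : Prop := IsGraded {
  graded_0 : forall n, gr n 0;
  graded_lin : forall n (c : k) u v, gr n u -> gr n v -> gr n (c *: u + v);
  graded_1 : gr 0%N 1;
  graded_mul : forall m n u v, gr m u -> gr n v -> gr (m + n)%N (u * v);
  graded_dec : forall a, exists n (u : nat -> A),
    (forall i, gr i (u i)) /\ a = \sum_(i < n) u i;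
  graded_indep : forall n (u : nat -> A), (forall i, gr i (u i)) ->
    \sum_(i < n) u i = 0 -> forall i, (i < n)%N -> u i = 0 }.

Definition connected : Prop := forall a, gr 0%N a <-> exists c : k, a = c%:A.

Definition generated_in_degree_1 : Prop :=
  forall S : A -> Prop,
    S 1 -> (forall u, gr 1%N u -> S u) ->
    (forall (c : k) u v, S u -> S v -> S (c *: u + v)) ->
    (forall u v, S u -> S v -> S (u * v)) ->
    forall a, S a.

Definition polynomial_growth : Prop :=
  exists C e : nat, forall n, (0 < n)%N -> dim_le (gr n) (C * n ^ e)%N.

(* For A connected graded: a maps to c under the augmentation
   A -> A / A_{>0} = k. *)
Definition augments_to (a : A) (c : k) : Prop :=
  exists n (u : nat -> A),
    (forall i, gr i.+1 (u i)) /\ a - c%:A = \sum_(i < n) u i.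

(* For a graded algebra, v is then a basis of A_1, since it generates A and the
   relations have degree two; so they lie in the tensor square of A_1. *)
Definition quadratic : Prop :=
  exists m (v : 'I_m -> A) (rels : free_alg k 'I_m -> Prop),
    [/\ forall i, gr 1%N (v i),
        forall p, rels p -> homogeneous (fun=> 1%N) 2 p
      & presented_by v rels].

End GradedAlgebras.

(* All modules are left modules. *)
Section Homological.
Variable A : nzRingType.

Definition projective (P : lmodType A) : Prop :=
  forall (M N : lmodType A) (s : {linear M -> N}) (f : {linear P -> N}),
    (forall y, exists x, s x = y) ->
    exists h : {linear P -> M}, forall p, s (h p) = f p.

Record projective_resolution (M : lmodType A) := ProjectiveResolution {
  pr_mod : nat -> lmodType A;
  pr_d : forall i, {linear pr_mod i.+1 -> pr_mod i};
  pr_aug : {linear pr_mod 0%N -> M};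
  pr_proj : forall i, projective (pr_mod i);
  pr_aug_surj : forall x, exists p, pr_aug p = x;
  pr_exact0 : forall p, pr_aug p = 0 <-> exists q, pr_d 0%N q = p;
  pr_exactS : forall i p, pr_d i p = 0 <-> exists q, pr_d i.+1 q = p }.

Definition pdim_le (M : lmodType A) (d : nat) : Prop :=
  exists P : projective_resolution M,
    forall i, (d < i)%N -> forall p : pr_mod P i, p = 0.

Definition has_gldim (d : nat) : Prop :=
  (forall M : lmodType A, pdim_le M d) /\
  (forall e, (forall M : lmodType A, pdim_le M e) -> (d <= e)%N).

Section Ext.
Variables (M N : lmodType A) (P : projective_resolution M).

Definition cocycle i (f : {linear pr_mod P i -> N}) : Prop :=
  forall p, f (pr_d P i p) = 0.

Definition coboundary i : {linear pr_mod P i -> N} -> Prop :=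
  match i with
  | 0 => fun f => forall p, f p = 0
  | j.+1 => fun f =>
      exists h : {linear pr_mod P j -> N}, forall p, f p = h (pr_d P j p)
  end.

Definition Ext_vanishes (i : nat) : Prop :=
  forall f : {linear pr_mod P i -> N}, cocycle f -> coboundary f.

End Ext.
End Homological.

Section Regular.
Variables (k : fieldType) (A : algType k) (gr : nat -> A -> Prop).

(* th is an isomorphism from K onto the left A-module k = A / A_{>0}. *)
Definition trivial_module_iso (K : lmodType A) (th : K -> k) : Prop :=
  [/\ bijective th,
      forall u v, th (u + v) = th u + th v
    & forall a c v, augments_to gr a c -> th (a *: v) = c * th v].

(* Ext^d(M, A) ~= k as right A-modules, where a in A acts on the class of f by
   right multiplication of the values of f; th induces the isomorphism. *)
Definition Ext_isom_k (M : lmodType A) (P : projective_resolution M)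
    (d : nat) : Prop :=
  exists th : {linear pr_mod P d -> A^o} -> k,
    [/\ forall f g h : {linear pr_mod P d -> A^o},
          cocycle f -> cocycle g -> (forall p, h p = f p + g p) ->
          th h = th f + th g,
        forall (f h : {linear pr_mod P d -> A^o}) (a : A) (c : k),
          cocycle f -> augments_to gr a c ->
          (forall p, h p = (f p : A) * a) ->
          th h = th f * c,
        forall f : {linear pr_mod P d -> A^o}, cocycle f ->
          (th f = 0 <-> coboundary f)
      & forall c : k, exists2 f : {linear pr_mod P d -> A^o},
          cocycle f & th f = c].

(* Ext(k, A) is computed from a projective resolution of k. *)
Definition gorenstein (d : nat) : Prop :=
  exists (K : lmodType A) (th : K -> k) (P : projective_resolution K),
    [/\ trivial_module_iso th,
        forall i, i <> d -> Ext_vanishes A^o P i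
      & Ext_isom_k P d].

Record AS_regular (d : nat) : Prop := ASRegular {
  reg_graded : is_graded gr;
  reg_connected : connected gr;
  reg_gen : generated_in_degree_1 gr;
  reg_fin : exists n, dim_le (gr 1%N) n;
  reg_gldim : has_gldim A d;
  reg_growth : polynomial_growth gr;
  reg_gorenstein : gorenstein d }.

End Regular.

Section Twist.
Variables (k : fieldType).

(* A is isomorphic, as a graded algebra, to the twist of D by an automorphism
   phi; th is the isomorphism from D^phi (whose underlying graded space is D)
   onto A. *)
Definition is_twist_of (A : algType k) (grA : nat -> A -> Prop)
    (D : algType k) (grD : nat -> D -> Prop) : Prop :=
  exists phi : {lrmorphism D -> D},
    [/\ bijective phi,
        forall m u, grD m u <-> grD m (phi u)
      & exists th : {linear D -> A},
          [/\ bijective th,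
              forall m u, grD m u <-> grA m (th u)
            & forall m u v, grD m u ->
                th (u * iter m phi v) = th u * th v]].

End Twist.

Section Clifford.
Variables (k : fieldType) (n : nat).

Definition is_mu (mu : 'M[k]_n) : Prop :=
  [/\ forall i j, mu i j != 0,
      forall i j, i != j -> mu i j * mu j i = 1
    & forall i, mu i i = 1].

Definition mu_symmetric (mu M : 'M[k]_n) : Prop :=
  forall i j, M i j = mu i j * M j i.

Definition previous (T : Type) (r : 'I_n -> T) (i : 'I_n) : T -> Prop :=
  fun p => exists2 l : 'I_n, (l < i)%N & p = r l.

(* A r_i = r_i A modulo <r_0, ..., r_(i-1)>. *)
Definition normalizing (T : nzRingType) (r : 'I_n -> T) : Prop :=
  forall i (a : T),
    (exists b, ideal (previous r i) (r i * a - b * r i)) /\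
    (exists b, ideal (previous r i) (a * r i - r i * b)).

(* inl i is the generator x_i, inr j is the generator y_j. *)
Definition gsca_wt (i : 'I_n + 'I_n) : nat := if i is inl _ then 1%N else 2%N.

Notation F := (free_alg k ('I_n + 'I_n)%type).
Definition X (i : 'I_n) : F := gen k (inl i).
Definition Y (j : 'I_n) : F := gen k (inr j).

Definition gsca_rel (mu : 'M[k]_n) (M : 'I_n -> 'M[k]_n) (p : F) : Prop :=
  exists i j,
    p = X i * X j + mu i j *: (X j * X i) - \sum_l M l i j *: Y l.

(* p is a homogeneous relation of the form r_i g = g' r_i modulo
   <r_0, ..., r_(i-1)>.  Both one-sided conditions of normality are covered,
   since g and g' are arbitrary; 0 < m excludes the relations c r_i = c' r_i
   with scalars c and c', which would kill r_i. *)
Definition normality_rel (r : 'I_n -> F) (p : F) : Prop :=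
  exists i m g g' w,
    [/\ (0 < m)%N, homogeneous gsca_wt m g, homogeneous gsca_wt m g',
        homogeneous gsca_wt m.+2 w /\ ideal (previous r i) w
      & p = r i * g - g' * r i - w].

(* The defining relations of a graded skew Clifford algebra are gsca_rel
   together with the existence of a normalizing sequence r spanning
   k y_1 + ... + k y_n.  The latter does not determine a set of relations, so
   the relations S that accompany gsca_rel may be any set of instances of the
   normality of r, provided that r is normalizing in the resulting algebra. *)
Definition gsca_data (A : algType k) (gr : nat -> A -> Prop)
    (mu : 'M[k]_n) (M : 'I_n -> 'M[k]_n) (x y : 'I_n -> A) : Prop :=
  let g (i : 'I_n + 'I_n) := match i with inl i => x i | inr j => y j end in
  [/\ is_mu mu, forall l, mu_symmetric mu (M l), is_graded gr,
      forall d a, gr d a <-> gen_grading g gsca_wt d a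
    & exists (r : 'I_n -> F) (S : F -> Prop),
        [/\ forall p, in_span r p <-> in_span Y p,
            forall p, S p -> normality_rel r p,
            presented_by g (fun p => gsca_rel mu M p \/ S p)
          & exists f : {lrmorphism F -> A},
              evaluates_at g f /\ normalizing (fun i => f (r i))]].

End Clifford.

Section CliffordAlgebras.
Variables (k : fieldType) (A : algType k) (gr : nat -> A -> Prop).

Definition graded_skew_clifford : Prop :=
  exists n (mu : 'M[k]_n) M x y, gsca_data gr mu M x y.

Definition graded_clifford : Prop :=
  exists n (mu : 'M[k]_n) M x y,
    [/\ gsca_data gr mu M x y, forall i j, mu i j = 1
      & forall l a, y l * a = a * y l].

Definition regular_graded_skew_clifford : Prop :=
  [/\ graded_skew_clifford, quadratic gr & exists d, AS_regular gr d].

End CliffordAlgebras.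

Definition xyz_rels (k : fieldType) (a b c : k)
    (p : free_alg k 'I_3) : Prop :=
  let x := gen k (inord 0 : 'I_3) in
  let y := gen k (inord 1 : 'I_3) in
  let z := gen k (inord 2 : 'I_3) in
  [\/ p = a *: (x * y) + b *: (y * x) + c *: z ^+ 2,
      p = a *: (y * z) + b *: (z * y) + c *: x ^+ 2
    | p = a *: (z * x) + b *: (x * z) + c *: y ^+ 2].

(* Main.v *)
(** After scaling, the relations are xy + q yx + ga z^2 = 0 and its cyclic
    shifts, with q^3 = 1 and ga^3 <> 1.

    The cyclic rotations of (x, y, z) twist the algebra with parameters (a, b, c)
    into those with parameters (b, c, a) and (c, a, b), and diag(1, q, q^2) twists
    q into 1. For q = 1, operators on the polynomial ring in three variables model
    the relations, whence the PBW basis x^i y^j z^l, and x is left and right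
    regular.

    Each defect x_i^2 x_j - q^(1 or 2) x_j x_i^2 equals ga^3 times itself, hence is
    zero, so the squares x_l^2 are normal, and central if q = 1. Taking y_l = x_l^2 turns the
    relations into those of a graded skew Clifford algebra with no extra relations.

    The Koszul complex A -> A^3 -> A^3 -> A is exact at A^3 on the right because
    of the presentation (partial derivatives of noncommutative polynomials), at A
    on the left because x is regular, and in the middle by counting dimensions
    degree by degree with the PBW basis. For a module M, the same maps twisted by
    the action on M give a complex of free modules A (x) M whose symbol is the
    Koszul complex tensored with M, hence a free resolution of length three. For M
    the trivial module it cannot be shortened, and its A-dual is the Koszul
    complex of right multiplications replaced by left ones, which is exact except
    at the last place: this is the Gorenstein condition. *)

Require Import Defs.
From HB Require Import structures.
From mathcomp Require Import all_boot all_order all_algebra.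
From mathcomp Require Import ring zify.
From mathcomp Require Import finmap monalg xfinmap.
From mathcomp.classical Require Import boolp classical_sets.

Set Implicit Arguments.
Unset Strict Implicit.
Unset Printing Implicit Defensive.

Import GRing.Theory BigEnoughFSet.
Local Open Scope ring_scope.

(** * Free algebras *)


(** With q = 1 the model sees only parities: its operators are linear over k[x^2, y^2, z], so every
    identity is checked on 1, x, y and xy. For other q the basis is carried along the linear
    bijection underlying the twist, which respects degrees, ideals and the regularity of x.

    The potential w = xyz + yzx + zxy + q (xzy + yxz + zyx) + ga (x^3 + y^3 + z^3) is invariant
    under cyclic rotation of words. Removing one letter from w leaves the three relations, removing
    two leaves the 3 x 3 matrix of the middle differential. By cyclicity the same matrix serves the
    complexes of left and of right modules, and this is the self-duality behind the Gorenstein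
    condition.

    Global dimension quantifies over all left modules, which need be neither graded nor finitely
    generated. Hence a Hamel basis is chosen for each module, and exactness comes from the
    filtration by degree in A: multiplying the A-factor raises this degree, acting on the module
    does not. *)

Section LinearExtension.
Variables (K : choiceType) (R : nzRingType) (V : lmodType R) (h : K -> V).

Definition mlin (p : {malg R[K]}) : V := \sum_(m <- msupp p) p@_m *: h m.

Lemma mlinEw (d : {fset K}) p : (msupp p `<=` d)%fset ->
  mlin p = \sum_(m <- d) p@_m *: h m.
Proof.
move=> le; rewrite /mlin (big_fset_incl _ le) //= => x _ /mcoeff_outdom ->.
by rewrite scale0r.
Qed.

Fact mlin_is_linear : linear mlin.
Proof.
(* [E] is one finite set containing the three supports, so the sums can be compared term by term. *)
move=> c u v; pose_big_fset K E; rewrite 3?(mlinEw (d := E)) //; last by close.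
rewrite scaler_sumr -big_split; apply: eq_bigr => m _.
by rewrite mcoeffD mcoeffZ scalerDl scalerA.
Qed.

HB.instance Definition _ := GRing.isLinear.Build R {malg R[K]} V *:%R mlin
  mlin_is_linear.

Lemma mlinU c m : mlin << c *g m >> = c *: h m.
Proof. by rewrite (mlinEw msuppU_le) big_seq_fset1 mcoeffUU. Qed.

Lemma mlin1 m : mlin << m >> = h m.
Proof. by rewrite mlinU scale1r. Qed.

End LinearExtension.

Section MalgLinear.
Variables (K : choiceType) (R : nzRingType).

Lemma malgUZ (c : R) (m : K) : << c *g m >> = c *: << m >>.
Proof. by apply/malgP => j; rewrite mcoeffZ !mcoeffU mulrnAr mulr1. Qed.

Lemma malg_sum (p : {malg R[K]}) : p = \sum_(m <- msupp p) p@_m *: << m >>.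
Proof. by rewrite {1}[p]monalgE; apply: eq_bigr => m _; rewrite malgUZ. Qed.

Lemma malg_lin_ind (P : {malg R[K]} -> Prop) :
  P 0 -> (forall c u v, P u -> P v -> P (c *: u + v)) ->
  (forall m, P << m >>) -> forall p, P p.
Proof.
move=> P0 Pl Pm p; rewrite (malg_sum p); elim: (enum_fset _) => [|m s IH].
  by rewrite big_nil.
by rewrite big_cons; apply: Pl.
Qed.

Lemma malg_lin_eq (V : lmodType R) (f g : {linear {malg R[K]} -> V}) :
  (forall m, f << m >> = g << m >>) -> f =1 g.
Proof.
move=> fg; apply: malg_lin_ind => [|c u v fu fv|m]; rewrite ?linear0 //.
by rewrite !linearP fu fv.
Qed.

End MalgLinear.

Section Ideals.
Variables (T : nzRingType) (S : T -> Prop).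

Lemma ideal_mull u p : ideal S p -> ideal S (u * p).
Proof. by move=> /(ideal_mul u 1); rewrite mulr1. Qed.

Lemma ideal_mulr u p : ideal S p -> ideal S (p * u).
Proof. by move=> /(ideal_mul 1 u); rewrite mul1r. Qed.

Lemma ideal_opp p : ideal S p -> ideal S (- p).
Proof. by move=> /(ideal_mull (-1)); rewrite mulN1r. Qed.

End Ideals.

Lemma ideal_trans (T : nzRingType) (S1 S2 : T -> Prop) :
  (forall p, S1 p -> ideal S2 p) -> forall p, ideal S1 p -> ideal S2 p.
Proof.
move=> S12 p; elim=> [r /S12 //||u v _ Iu _ Iv|u v r _ Ir].
- exact: ideal_0.
- exact: ideal_add.
- exact: ideal_mul.
Qed.

Lemma ideal_morph (T1 T2 : nzRingType) (f : {rmorphism T1 -> T2})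
    (S1 : T1 -> Prop) (S2 : T2 -> Prop) :
  (forall p, S1 p -> ideal S2 (f p)) -> forall p, ideal S1 p -> ideal S2 (f p).
Proof.
move=> S12 p; elim=> [r /S12 //||u v _ Iu _ Iv|u v r _ Ir].
- by rewrite rmorph0; exact: ideal_0.
- by rewrite rmorphD; exact: ideal_add.
- by rewrite !rmorphM; exact: ideal_mul.
Qed.

Section FreeStructure.
Variables (k : fieldType) (I : choiceType).

(* The free algebra is only used through this interface: the structures on
   monalg's concrete type make unification prohibitively slow. *)
Record free_algebra := FreeAlgebra {
  free_sort :> algType k;
  mon : seq I -> free_sort;
  mon0 : mon [::] = 1;
  mon_cat : forall s t, mon (s ++ t) = mon s * mon t;
  lext : forall V : lmodType k, (seq I -> V) -> {linear free_sort -> V};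
  lext_mon : forall (V : lmodType k) (h : seq I -> V) s, lext h (mon s) = h s;
  free_ind : forall P : free_sort -> Prop,
    P 0 -> (forall c u v, P u -> P v -> P (c *: u + v)) ->
    (forall s, P (mon s)) -> forall p, P p }.

End FreeStructure.
Arguments lext {k I} f [V] h.

Section FreeAlgebra.
Variables (k : fieldType) (I : choiceType) (T : free_algebra k I).
Implicit Types (s t : seq I) (p q : T).

Definition var i : T := mon T [:: i].

Lemma mon_cons i s : mon T (i :: s) = var i * mon T s.
Proof. by rewrite -mon_cat. Qed.

Lemma mon_rcons i s : mon T (rcons s i) = mon T s * var i.
Proof. by rewrite -cats1 mon_cat. Qed.

Lemma free_lin_eq (V : lmodType k) (f g : {linear T -> V}) :
  (forall s, f (mon T s) = g (mon T s)) -> f =1 g.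
Proof.
move=> fg; apply: free_ind => [|c u v fu fv|m]; rewrite ?linear0 //.
by rewrite !linearP fu fv.
Qed.

Lemma linl (A : algType k) c (p q r : A) : (c *: p + q) * r = c *: (p * r) + q * r.
Proof. by rewrite mulrDl scalerAl. Qed.

Lemma linr (A : algType k) c (p q r : A) : r * (c *: p + q) = c *: (r * p) + r * q.
Proof. by rewrite mulrDr scalerAr. Qed.

Section Evaluation.
Variables (A : algType k) (g : I -> A).

Definition ev : T -> A := lext T (fun s => \prod_(i <- s) g i).

HB.instance Definition _ := GRing.Linear.on ev.

Lemma ev_mon s : ev (mon T s) = \prod_(i <- s) g i.
Proof. exact: lext_mon. Qed.

Fact ev_is_monoid_morphism : monoid_morphism ev.
Proof.
split=> [|p q]; first by rewrite -mon0 ev_mon big_nil.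
elim/free_ind: p => [|c u v IHu IHv|s]; first by rewrite !(mul0r, linear0).
  by rewrite linl !linearP /= IHu IHv linl.
elim/free_ind: q => [|c u v IHu IHv|t]; first by rewrite !(mulr0, linear0).
  by rewrite linr !linearP /= IHu IHv linr.
by rewrite -mon_cat !ev_mon big_cat.
Qed.

HB.instance Definition _ :=
  GRing.isMonoidMorphism.Build T A ev ev_is_monoid_morphism.

Lemma ev_var i : ev (var i) = g i.
Proof. by rewrite ev_mon big_seq1. Qed.

Lemma evaluates_mon (f : {lrmorphism T -> A}) s :
  (forall i, f (var i) = g i) -> f (mon T s) = \prod_(i <- s) g i.
Proof.
move=> fg; elim: s => [|i s IH]; first by rewrite mon0 rmorph1 big_nil.
by rewrite mon_cons rmorphM /= fg IH big_cons.
Qed.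

End Evaluation.

Lemma evaluates_unique (A : algType k) (f1 f2 : {lrmorphism T -> A}) :
  (forall i, f1 (var i) = f2 (var i)) -> f1 =1 f2.
Proof.
move=> f12; apply: free_lin_eq => s /=.
by rewrite (evaluates_mon s f12) (evaluates_mon (f := f2) s (fun=> erefl)).
Qed.

Section IdealInduction.
Variable S : T -> Prop.

Lemma ideal_scale (c : k) p : ideal S p -> ideal S (c *: p).
Proof. by move=> Ip; rewrite -mulr_algl; apply: ideal_mull. Qed.

Lemma ideal_lin (c : k) p q : ideal S p -> ideal S q -> ideal S (c *: p + q).
Proof. by move=> Ip Iq; apply: ideal_add => //; apply: ideal_scale. Qed.

(** Relations flanked by words span the ideal over k. The induction runs on all products [u * p * v]
    at once, because [ideal] may multiply on both sides at every stage. *)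
Lemma ideal_words_ind (P : T -> Prop) :
  P 0 -> (forall c u v, P u -> P v -> P (c *: u + v)) ->
  (forall s r t, S r -> P (mon T s * r * mon T t)) ->
  forall p, ideal S p -> P p.
Proof.
move=> P0 Pl Pw p Ip.
suff H: forall u v, P (u * p * v) by move: (H 1 1); rewrite mul1r mulr1.
elim: Ip => [r Sr||p1 p2 _ IH1 _ IH2|u0 v0 p1 _ IH] u v.
- elim/free_ind: u => [|c u1 u2 IH1 IH2|s]; first by rewrite !mul0r.
    by rewrite !linl; apply: Pl.
  elim/free_ind: v => [|c v1 v2 IH1 IH2|t]; first by rewrite mulr0.
    by rewrite linr; apply: Pl.
  exact: Pw.
- by rewrite mulr0 mul0r.
- by rewrite mulrDr mulrDl -[u * p1 * v]scale1r; apply: Pl.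
- by move: (IH (u * u0) (v0 * v)); rewrite !mulrA.
Qed.

End IdealInduction.

Section Weights.
Variable wt : I -> nat.

Definition wgt s := (\sum_(i <- s) wt i)%N.

Lemma wgt_cat s t : wgt (s ++ t) = (wgt s + wgt t)%N.
Proof. by rewrite /wgt big_cat. Qed.

Definition comp d : T -> T :=
  lext T (fun s => if wgt s == d then mon T s else 0).

HB.instance Definition _ d := GRing.Linear.on (comp d).

Lemma comp_mon d s : comp d (mon T s) = if wgt s == d then mon T s else 0.
Proof. exact: lext_mon. Qed.

(** Homogeneity as a fixed-point equation of a projection: it needs no coefficients, which the
    interface [free_algebra] does not expose. *)
Definition hom d p := comp d p = p.

Lemma hom_mon s : hom (wgt s) (mon T s).
Proof. by rewrite /hom comp_mon eqxx. Qed.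

Lemma hom_lin d (c : k) p q : hom d p -> hom d q -> hom d (c *: p + q).
Proof. by rewrite /hom => hp hq; rewrite linearP /= hp hq. Qed.

Lemma hom0 d : hom d 0.
Proof. exact: linear0. Qed.

Lemma homD d p q : hom d p -> hom d q -> hom d (p + q).
Proof. by move=> hp hq; rewrite -[p]scale1r; apply: hom_lin. Qed.

Lemma homZ d (c : k) p : hom d p -> hom d (c *: p).
Proof. by move=> hp; rewrite -[_ *: _]addr0; apply: hom_lin (hom0 _). Qed.

Lemma hom_ind d (P : T -> Prop) :
  P 0 -> (forall c u v, P u -> P v -> P (c *: u + v)) ->
  (forall s, wgt s = d -> P (mon T s)) -> forall p, hom d p -> P p.
Proof.
move=> P0 Pl Pm p <-; elim/free_ind: p => [|c u v IHu IHv|s].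
- by rewrite linear0.
- by rewrite linearP; apply: Pl.
by rewrite comp_mon; case: eqP => // sd; apply: Pm.
Qed.

Lemma homM d e p q : hom d p -> hom e q -> hom (d + e)%N (p * q).
Proof.
move=> hp hq; elim/hom_ind: hp => [|c u v IHu IHv|s <-].
- by rewrite mul0r; apply: hom0.
- by rewrite linl; apply: hom_lin.
elim/hom_ind: hq => [|c u v IHu IHv|t <-].
- by rewrite mulr0; apply: hom0.
- by rewrite linr; apply: hom_lin.
by rewrite -mon_cat -wgt_cat; apply: hom_mon.
Qed.

Lemma hom_var i : hom (wt i) (var i).
Proof. by rewrite -[wt i](big_seq1 addn); apply: hom_mon. Qed.

Lemma hom1 : hom 0 1.
Proof. by move: (hom_mon [::]); rewrite mon0 /wgt big_nil. Qed.

Lemma comp_hom d p : hom d (comp d p).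
Proof.
elim/free_ind: p => [|c u v IHu IHv|s]; first by rewrite linear0; apply: hom0.
  by rewrite linearP; apply: hom_lin.
rewrite comp_mon; case: eqP => [<-|_]; [exact: hom_mon|exact: hom0].
Qed.

Lemma comp_id d e p : hom d p -> comp e p = if d == e then p else 0.
Proof.
elim/hom_ind=> [|c u v IHu IHv|s <-].
- by rewrite linear0 if_same.
- by rewrite linearP /= IHu IHv; case: eqP; rewrite // scaler0 addr0.
- exact: comp_mon.
Qed.

(** A threshold rather than an exact degree, so that two elements can share a bound. *)
Lemma comp_sum p : exists N, forall n, (N <= n)%N -> \sum_(d < n) comp d p = p.
Proof.
elim/free_ind: p => [|c u v [N IHu] [N' IHv]|s].
- by exists 0%N => n _; rewrite big1 // => d _; rewrite linear0.
- exists (maxn N N') => n; rewrite geq_max => /andP[Nn Nn'].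
  rewrite -[in RHS](IHu n) // -[in RHS](IHv n) // scaler_sumr -big_split.
  by apply: eq_bigr => d _; rewrite linearP.
exists (wgt s).+1 => n sn; rewrite (bigD1 (Ordinal sn)) //= comp_mon eqxx big1.
  by rewrite addr0.
by move=> d; rewrite -val_eqE /= comp_mon eq_sym => /negPf->.
Qed.

(** A word times a homogeneous relation times a word is homogeneous, so the projection either keeps
    it or kills it. *)
Lemma ideal_comp (S : T -> Prop) d p :
  (forall r, S r -> exists e, hom e r) ->
  ideal S p -> ideal S (comp d p).
Proof.
move=> hS; elim/ideal_words_ind=> [|c u v IHu IHv|s r t Sr].
- by rewrite linear0; apply: ideal_0.
- by rewrite linearP; apply: ideal_lin.
have [e hr] := hS r Sr.
rewrite (comp_id _ (homM (homM (hom_mon s) hr) (hom_mon t))).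
case: eqP => _; last exact: ideal_0.
by apply: ideal_mul; apply: ideal_gen.
Qed.

End Weights.
End FreeAlgebra.

Section Multiplicativity.
Variables (k : fieldType) (I : choiceType) (T : free_algebra k I) (wt : I -> nat).

Lemma compMl d e (p q : T) :
  hom wt d p -> comp wt (d + e)%N (p * q) = p * comp wt e q.
Proof.
move=> hp; elim/free_ind: q => [|c u v IHu IHv|s].
- by rewrite mulr0 !linear0 mulr0.
- by rewrite linr !linearP /= IHu IHv linr.
rewrite (comp_id _ (homM hp (hom_mon _ _ s))) comp_mon eqn_add2l.
by case: eqP; rewrite ?mulr0.
Qed.

Lemma compMr d e (p q : T) :
  hom wt d p -> comp wt (e + d)%N (q * p) = comp wt e q * p.
Proof.
move=> hp; elim/free_ind: q => [|c u v IHu IHv|s].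
- by rewrite mul0r !linear0 mul0r.
- by rewrite linl !linearP /= IHu IHv linl.
rewrite (comp_id _ (homM (hom_mon _ _ s) hp)) comp_mon eqn_add2r.
by case: eqP; rewrite ?mul0r.
Qed.

End Multiplicativity.

(** * Presented algebras and their gradings *)

Section Presentation.
Variables (k : fieldType) (I : choiceType) (T : free_algebra k I).
Variables (A : algType k) (f : {lrmorphism T -> A}) (rels : T -> Prop).

Record presentation : Prop := Presentation {
  pres_surj : forall a, exists p, f p = a;
  pres_ker : forall p, f p = 0 <-> ideal rels p }.

Hypothesis fP : presentation.

Lemma pres_section : {s : A -> T | forall a, f (s a) = a}.
Proof.
have ex a : exists p, f p == a by have [p <-] := pres_surj fP a; exists p.
by exists (fun a => xchoose (ex a)) => a; apply/eqP: (xchooseP (ex a)).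
Qed.

(** The induced map evaluates h at a chosen preimage. It is linear because two preimages of one
    element differ by an element of the ideal, where h vanishes. *)
Lemma descend (V : lmodType k) (h : {linear T -> V}) :
  (forall p, ideal rels p -> h p = 0) ->
  {h' : {linear A -> V} | forall p, h' (f p) = h p}.
Proof.
move=> h0; have [s fs] := pres_section.
have hs p : h (s (f p)) = h p.
  apply/eqP; rewrite -subr_eq0 -linearB; apply/eqP/h0/(pres_ker fP).
  by rewrite linearB /= fs subrr.
have sl : linear (fun a => h (s a)).
  move=> c u v; rewrite -linearP -[RHS]hs; congr (h (s _)).
  by rewrite linearP /= !fs.
pose h' := GRing.isLinear.Build k A V _ (fun a => h (s a)) sl.
by exists (HB.pack_for {linear A -> V} (fun a => h (s a)) h').
Qed.

Lemma pres_ind (P : A -> Prop) :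
  P 0 -> (forall c u v, P u -> P v -> P (c *: u + v)) ->
  (forall s, P (f (mon T s))) -> forall a, P a.
Proof.
move=> P0 Pl Pm a; have [p <-] := pres_surj fP a; elim/free_ind: p => [|c u v Pu Pv|s].
- by rewrite linear0.
- by rewrite linearP; apply: Pl.
- exact: Pm.
Qed.

Section Grading.
Variable wt : I -> nat.
Hypothesis hrels : forall r, rels r -> exists e, hom wt e r.

Definition gr d (a : A) := exists2 p, hom wt d p & f p = a.

Fact gpr_subproof d p : ideal rels p -> (f \o comp wt d) p = 0.
Proof. by move=> Ip /=; apply/(pres_ker fP)/ideal_comp. Qed.

(** The projection of A onto its component of degree d, available because the ideal is homogeneous;
    [grP] then turns membership in a component into an equation. *)
Definition gpr d : {linear A -> A} := sval (descend (@gpr_subproof d)).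

Lemma gprE d p : gpr d (f p) = f (comp wt d p).
Proof. exact: (svalP (descend (@gpr_subproof d))). Qed.

Lemma gr_gpr d a : gr d (gpr d a).
Proof.
have [p <-] := pres_surj fP a; rewrite gprE; exists (comp wt d p) => //.
exact: comp_hom.
Qed.

Lemma gpr_id d e a : gr d a -> gpr e a = if d == e then a else 0.
Proof.
by case=> p hp <-; rewrite gprE (comp_id _ hp); case: eqP; rewrite ?linear0.
Qed.

Lemma grP d a : gr d a <-> gpr d a = a.
Proof.
by split=> [/gpr_id->|<-]; [rewrite eqxx|exact: gr_gpr].
Qed.

Lemma gpr_sum a : exists N, forall n, (N <= n)%N -> \sum_(d < n) gpr d a = a.
Proof.
have [p <-] := pres_surj fP a; have [N hN] := comp_sum wt p.
exists N => n /hN {2}<-; rewrite linear_sum.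
by apply: eq_bigr => d _; rewrite gprE.
Qed.

Lemma gr_lin d (c : k) u v : gr d u -> gr d v -> gr d (c *: u + v).
Proof. by rewrite !grP linearP /= => -> ->. Qed.

Lemma gr_0 d : gr d 0.
Proof. by rewrite grP linear0. Qed.

Lemma gr_Z d (c : k) u : gr d u -> gr d (c *: u).
Proof. by rewrite !grP linearZ /= => ->. Qed.

Lemma gr_1 : gr 0%N 1.
Proof. by exists 1; [exact: hom1|rewrite rmorph1]. Qed.

Lemma gr_M d e u v : gr d u -> gr e v -> gr (d + e)%N (u * v).
Proof.
by case=> p hp <- [q hq <-]; exists (p * q); [exact: homM|rewrite rmorphM].
Qed.

Lemma gr_var i : gr (wt i) (f (var T i)).
Proof. by exists (var T i) => //; exact: hom_var. Qed.

Lemma gprMl d e u v : gr d u -> gpr (d + e)%N (u * v) = u * gpr e v.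
Proof.
case=> p hp <-; have [q <-] := pres_surj fP v.
by rewrite -rmorphM !gprE (compMl _ _ hp) rmorphM.
Qed.

Lemma gprMr d e u v : gr d u -> gpr (e + d)%N (v * u) = gpr e v * u.
Proof.
case=> p hp <-; have [q <-] := pres_surj fP v.
by rewrite -rmorphM !gprE (compMr _ _ hp) rmorphM.
Qed.

Lemma gpr_inj a : (forall d, gpr d a = 0) -> a = 0.
Proof.
move=> a0; have [N /(_ N (leqnn _)) <-] := gpr_sum a.
by rewrite big1 // => d _; apply: a0.
Qed.

Lemma presentation_graded : is_graded gr.
Proof.
split=> [||| |a|n u gu u0 i ilt].
- exact: gr_0.
- exact: gr_lin.
- exact: gr_1.
- exact: gr_M.
- have [N /(_ N (leqnn _)) aN] := gpr_sum a.
  by exists N, (gpr^~ a); split=> // i; apply: gr_gpr.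
have := congr1 (gpr i) u0; rewrite linear0 linear_sum (bigD1 (Ordinal ilt)) //=.
rewrite (gpr_id _ (gu i)) eqxx big1 ?addr0 // => j.
by rewrite -val_eqE /= (gpr_id _ (gu j)) => /negPf->.
Qed.

End Grading.
End Presentation.

(** * The monoid algebra of words as a free algebra *)

Section Concrete.
Variables (k : fieldType) (I : choiceType).
Notation FI := (free_alg k I).

Definition fword (s : seq I) : FI := << FMonom s >>.

Lemma fword0 : fword [::] = 1.
Proof. by rewrite /fword -fmoneE. Qed.

Lemma fword_cat s t : fword (s ++ t) = fword s * fword t.
Proof.
rewrite malgM_def /fword fgmulUU mulr1; congr << _ *g _ >>.
by apply/eqP; rewrite fmP fmM.
Qed.

Lemma fword_ind (P : FI -> Prop) :
  P 0 -> (forall c u v, P u -> P v -> P (c *: u + v)) ->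
  (forall s, P (fword s)) -> forall p, P p.
Proof.
by move=> P0 Pl Pm; apply: malg_lin_ind => // m; rewrite -(fmK m); apply: Pm.
Qed.

(** Scalars pass through words although words do not commute with each other. *)
Lemma fword_scalerAr (c : k) (p q : FI) : c *: (p * q) = p * (c *: q).
Proof.
rewrite -[c *: q]mul_malgC mulrA scalerAl; congr (_ * q).
elim/fword_ind: p => [|d u v IHu IHv|s]; first by rewrite mul0r scaler0.
  by rewrite mulrDl -IHv -scalerAl -IHu scalerDr !scalerA mulrC.
by rewrite malgM_def fgmulUU mul1r mulm1 malgUZ.
Qed.

Definition free_alg_algType : algType k :=
  HB.pack_for (algType k) FI (GRing.Lalgebra_isAlgebra.Build k FI fword_scalerAr).

Definition flext (V : lmodType k) (h : seq I -> V) :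
    {linear free_alg_algType -> V} :=
  mlin (fun m : fmonom I => h (fmonom_val m)).

Lemma flext_fword (V : lmodType k) (h : seq I -> V) s : flext h (fword s) = h s.
Proof. exact: mlin1. Qed.

Definition malg_free_algebra : free_algebra k I :=
  @FreeAlgebra k I free_alg_algType fword fword0 fword_cat flext flext_fword
    fword_ind.

Lemma gen_var i : gen k i = var malg_free_algebra i.
Proof. by rewrite /gen fmuE. Qed.

(** Links homogeneity by coefficients, as the statement of the theorem has it, to the projections
    used in the proof. *)
Lemma homogeneousE wt d (p : FI) :
  homogeneous wt d p <-> hom (T := malg_free_algebra) wt d p.
Proof.
split=> [hp|]; last first.
  elim/hom_ind=> [m|c u v hu hv m|s sd m].
  - by case/eqP; exact: mcoeff0.
  - rewrite (mcoeffD _ (c *: (u : FI)) v) mcoeffZ.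
    case: (eqVneq (u@_m) 0) => [->|/hu //].
    case: (eqVneq (v@_m) 0) => [->|/hv //].
    by rewrite mulr0 addr0 eqxx.
  by rewrite mcoeffU; have [<-|_] := eqVneq (FMonom s) m; rewrite ?eqxx // -sd.
rewrite (malg_sum p) big_seq.
elim/big_ind: _ => [|u v hu hv|m]; first exact: hom0.
  by refine (homD hu hv).
rewrite -mcoeff_neq0 => /hp wm; rewrite -(fmK m).
refine (homZ _ _); rewrite -wm.
refine (hom_mon malg_free_algebra _ _).
Qed.

End Concrete.
Arguments malg_free_algebra : clear implicits.

(** * Linear combinations by reflection *)

Section LinearReflection.
Variables (k : fieldType) (V : zmodType) (act : k -> V -> V).

(** The action is abstract because two occur: [*:] on k-spaces, and [ks], the action of k on a
    module over A. *)
Record is_action : Prop := IsAction {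
  actDl : forall a b v, act (a + b) v = act a v + act b v;
  actDr : forall a u v, act a (u + v) = act a u + act a v;
  actA : forall a b v, act a (act b v) = act (a * b) v;
  act1 : forall v, act 1 v = v }.

Inductive lexp :=
  | LAtom of nat | LAdd of lexp & lexp | LOpp of lexp | LScale of k & lexp | LZero.

Fixpoint lcoef (i : nat) (e : lexp) : k :=
  match e with
  | LAtom j => if i == j then 1 else 0
  | LAdd e1 e2 => lcoef i e1 + lcoef i e2
  | LOpp e1 => - lcoef i e1
  | LScale c e1 => c * lcoef i e1
  | LZero => 0
  end.

Variable env : seq V.

Fixpoint leval (e : lexp) : V :=
  match e with
  | LAtom j => nth 0 env j
  | LAdd e1 e2 => leval e1 + leval e2
  | LOpp e1 => - leval e1
  | LScale c e1 => act c (leval e1)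
  | LZero => 0
  end.

Hypothesis actP : is_action.

Lemma act0l v : act 0 v = 0.
Proof. by apply: (@addrI _ (act 0 v)); rewrite -(actDl actP) !addr0. Qed.

Lemma act0r a : act a 0 = 0.
Proof. by apply: (@addrI _ (act a 0)); rewrite -(actDr actP) !addr0. Qed.

Lemma actNl a v : act (- a) v = - act a v.
Proof. by apply/eqP; rewrite -addr_eq0 -(actDl actP) addNr act0l. Qed.

Lemma leval_coef e :
  leval e = \sum_(i < size env) act (lcoef i e) (nth 0 env i).
Proof.
elim: e => [j|e1 IH1 e2 IH2|e IH|c e IH|] /=; rewrite ?IH1 ?IH2 ?IH.
- have [jl|jg] := ltnP j (size env).
    rewrite (bigD1 (Ordinal jl)) //= eqxx (act1 actP) big1 ?addr0 // => i.
    by rewrite -val_eqE /= => /negPf->; rewrite act0l.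
  rewrite nth_default // big1 // => i _; rewrite ltn_eqF ?act0l //.
- by rewrite -big_split; apply: eq_bigr => i _; rewrite (actDl actP).
- by rewrite -sumrN; apply: eq_bigr => i _; rewrite actNl.
- elim/big_rec2: _ => [|i u v _ <-]; first exact: act0r.
  by rewrite (actDr actP) (actA actP).
- by rewrite big1 // => i _; rewrite act0l.
Qed.

(** Unfolds to a conjunction with one equation in k per atom, each a goal for [ring]. *)
Fixpoint lcoefs_eq (n : nat) (e1 e2 : lexp) : Prop :=
  if n is m.+1 then lcoef m e1 = lcoef m e2 /\ lcoefs_eq m e1 e2 else True.

Lemma leval_eq e1 e2 : lcoefs_eq (size env) e1 e2 -> leval e1 = leval e2.
Proof.
move=> h; rewrite !leval_coef; apply: eq_bigr => -[i il] _ /=; congr (act _ _).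
elim: (size env) h il => // n IH [hn h]; rewrite ltnS leq_eqVlt.
by case/predU1P=> [->|] //; apply: IH.
Qed.

End LinearReflection.

Ltac lfind x l :=
  lazymatch l with
  | cons ?y ?l' =>
      let r := match goal with
               | _ => let _ := match goal with _ => unify x y end in constr:(O)
               | _ => let n := lfind x l' in constr:(S n)
               end in r
  end.

Ltac linside x l :=
  lazymatch l with
  | nil => constr:(false)
  | cons ?y ?l' =>
      let r := match goal with
               | _ => let _ := match goal with _ => unify x y end in constr:(true)
               | _ => linside x l'
               end in r
  end.

Ltac latoms k e l :=
  lazymatch e with
  | @Algebra.add _ ?a ?b => let l1 := latoms k a l in latoms k b l1
  | @Algebra.opp _ ?a => latoms k a l
  | @GRing.scale _ _ ?c ?a => latoms k a l
  | k ?c ?a => latoms k a l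
  | Algebra.zero => l
  | _ => let b := linside e l in
         lazymatch b with
         | true => l
         | false => constr:(cons e l)
         end
  end.

Ltac lreify k e l :=
  lazymatch e with
  | @Algebra.add _ ?a ?b =>
      let x := lreify k a l in let y := lreify k b l in constr:(LAdd x y)
  | @Algebra.opp _ ?a => let x := lreify k a l in constr:(LOpp x)
  | @GRing.scale _ _ ?c ?a => let x := lreify k a l in constr:(LScale c x)
  | k ?c ?a => let x := lreify k a l in constr:(LScale c x)
  | Algebra.zero => open_constr:(@LZero _)
  | _ => let n := lfind e l in open_constr:(@LAtom _ n)
  end.

(* Proves an equation between linear combinations, up to ring equations
   between the coefficients of each atom. *)
Ltac lin_act H act :=
  lazymatch goal with
  | |- @eq ?V ?a ?b =>
      let l1 := latoms act a (@nil V) in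
      let l := latoms act b l1 in
      let x := lreify act a l in
      let y := lreify act b l in
      apply: (@leval_eq _ _ _ l H x y); rewrite /=; repeat split
  end.

Lemma scale_is_action (k : fieldType) (V : lmodType k) :
  is_action (fun (c : k) (v : V) => c *: v).
Proof.
split=> *; [exact: scalerDl|exact: scalerDr|exact: scalerA|exact: scale1r].
Qed.

(** No well-typed term is an application of [False], so [*:] is the only action that is reified. *)
Ltac lin_comb A := let H := constr:(@scale_is_action _ A) in lin_act H False.

(** * Twists *)

(** The quotient of T by the kernel of F, built on the space V itself. A twist keeps the underlying
    space, and here the identity becomes the linear bijection [th]. *)
Lemma algebra_transport (k : fieldType) (T : algType k) (V : lmodType k)
    (F : {linear T -> V}) :
  (forall v, exists p, F p = v) ->
  (forall u v p, F p = 0 -> F (u * p * v) = 0) -> F 1 != 0 ->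
  exists (D : algType k) (F' : {lrmorphism T -> D}) (th : {linear D -> V}),
    bijective th /\ forall p, th (F' p) = F p.
Proof.
move=> Fsurj Fker F1.
have ex a : exists p, F p == a by have [p <-] := Fsurj a; exists p.
pose s a := xchoose (ex a).
have Fs a : F (s a) = a by apply/eqP: (xchooseP (ex a)).
pose mul u v := F (s u * s v).
have FM p q : F (p * q) = mul (F p) (F q).
  (* Replacing p and q by the chosen preimages one factor at a time leaves two terms, each with a
     factor in the kernel. *)
  have -> : p * q = s (F p) * s (F q) + (1 * (p - s (F p)) * q +
      s (F p) * (q - s (F q)) * 1).
    by rewrite mul1r mulr1 mulrBl mulrBr addrCA [_ + (_ - _)]addrC subrK subrK.
  rewrite !linearD /= !Fker ?addr0 // linearB /= Fs subrr //.
have sE (P : V -> Prop) : (forall p, P (F p)) -> forall v, P v.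
  by move=> PF v; rewrite -(Fs v).
have mulA : associative mul.
  by move=> u v w; rewrite -[u]Fs -[v]Fs -[w]Fs -!FM mulrA.
have mul1 : left_id (F 1) mul by move=> u; rewrite -[u]Fs -!FM mul1r.
have mulr1 : right_id (F 1) mul by move=> u; rewrite -[u]Fs -!FM mulr1.
have mulDl : left_distributive mul +%R.
  by move=> u v w; rewrite -[u]Fs -[v]Fs -[w]Fs -linearD -!FM -linearD mulrDl.
have mulDr : right_distributive mul +%R.
  by move=> u v w; rewrite -[u]Fs -[v]Fs -[w]Fs -linearD -!FM -linearD mulrDr.
pose mR := GRing.Zmodule_isNzRing.Build V mulA mul1 mulr1 mulDl mulDr F1.
pose R : nzRingType := HB.pack_for nzRingType V mR.
have FZ (c : k) p : c *: F p = F (c *: p) by rewrite linearZ.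
have scAl (c : k) (u v : V) : c *: (mul u v) = mul (c *: u) v.
  by rewrite -[u]Fs -[v]Fs FZ -!FM FZ scalerAl.
have scAr (c : k) (u v : V) : c *: (mul u v) = mul u (c *: v).
  by rewrite -[u]Fs -[v]Fs FZ -!FM FZ scalerAr.
pose mL := GRing.Lmodule_isLalgebra.Build k R scAl.
pose L : lalgType k := HB.pack_for (lalgType k) V mR mL.
pose mA := GRing.Lalgebra_isAlgebra.Build k L scAr.
pose D : algType k := HB.pack_for (algType k) V mR mL mA.
have Flin : linear (F : T -> D) by move=> c u v; rewrite linearP.
have Fmul : monoid_morphism (F : T -> D) by split=> // p q; exact: FM.
pose F' : {lrmorphism T -> D} := HB.pack_for {lrmorphism T -> D} (F : T -> D)
  (GRing.isLinear.Build k T D _ (F : T -> D) Flin)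
  (GRing.isMonoidMorphism.Build T D (F : T -> D) Fmul).
have idlin : linear (id : D -> V) by [].
pose th : {linear D -> V} := HB.pack_for {linear D -> V} (id : D -> V)
  (GRing.isLinear.Build k D V _ (id : D -> V) idlin).
by exists D, F', th; split=> //; exists id.
Qed.

Section TwistMap.
Variables (k : fieldType) (I : choiceType) (T : free_algebra k I).
Notation hom := (hom (T := T) (fun=> 1%N)).

Definition monomial_morphism (phi : {lrmorphism T -> T}) :=
  forall i, exists c j, phi (var T i) = c *: var T j.

(** The word i1 i2 i3 ... goes to x_i1 phi(x_i2) phi^2(x_i3) ...: this is the morphism from T to its
    own twist by phi that fixes the variables. *)
Definition tw (phi : {lrmorphism T -> T}) : T -> T :=
  lext T (foldr (fun i p => var T i * phi p) 1).

HB.instance Definition _ phi := GRing.Linear.on (tw phi).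

Section OneMorphism.
Variable phi : {lrmorphism T -> T}.
Hypothesis phiM : monomial_morphism phi.

Lemma tw_1 : tw phi 1 = 1.
Proof. by rewrite -{1}mon0 /tw lext_mon. Qed.

Lemma tw_var i p : tw phi (var T i * p) = var T i * phi (tw phi p).
Proof.
elim/free_ind: p => [|c u v IHu IHv|s].
- by rewrite mulr0 !linear0 mulr0.
- by rewrite linr !linearP /= IHu IHv linr.
by rewrite -mon_cons /tw !lext_mon.
Qed.

Lemma hom_monomial d p : hom d p -> hom d (phi p).
Proof.
elim/hom_ind => [|c u v IHu IHv|s <-].
- by rewrite linear0; apply: hom0.
- by rewrite linearP; apply: hom_lin.
elim: s => [|i s IH]; first by rewrite mon0 rmorph1 /wgt big_nil; apply: hom1.
rewrite mon_cons rmorphM /wgt big_cons; apply: homM => //=.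
by have [c [j ->]] := phiM i; apply: homZ; apply: hom_var.
Qed.

Lemma tw_hom d p : hom d p -> hom d (tw phi p).
Proof.
elim/hom_ind => [|c u v IHu IHv|s <-].
- by rewrite linear0; apply: hom0.
- by rewrite linearP; apply: hom_lin.
elim: s => [|i s IH]; first by rewrite mon0 tw_1 /wgt big_nil; apply: hom1.
rewrite mon_cons tw_var /wgt big_cons; apply: homM; first exact: hom_var.
exact: hom_monomial.
Qed.

Lemma twM m u v : hom m u -> tw phi (u * v) = tw phi u * iter m phi (tw phi v).
Proof.
elim/hom_ind => [|c u1 u2 IH1 IH2|s <-].
- by rewrite mul0r !linear0 mul0r.
- by rewrite linl !linearP /= IH1 IH2 linl.
elim: s => [|i s IH]; first by rewrite mon0 tw_1 !mul1r /wgt big_nil.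
rewrite mon_cons -mulrA !tw_var IH rmorphM /= mulrA.
by rewrite {2}/wgt big_cons add1n iterS.
Qed.

End OneMorphism.

Lemma tw_comm (phi psi : {lrmorphism T -> T}) : monomial_morphism psi ->
  (forall p, phi (psi p) = psi (phi p)) ->
  forall p, tw phi (psi p) = psi (tw phi p).
Proof.
move=> psiM pp p; elim/free_ind: p => [|c u v IHu IHv|s].
- by rewrite !linear0.
- by rewrite !linearP /= IHu IHv.
elim: s => [|i s IH]; first by rewrite mon0 rmorph1 tw_1 rmorph1.
rewrite mon_cons tw_var !rmorphM /=; have [c [j ->]] := psiM i.
by rewrite -!scalerAl linearZ /= tw_var IH pp.
Qed.

(** After the first letter, [tw psi] has applied psi; [tw phi] commutes with it by [tw_comm] and
    then applies phi, which cancels it. *)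
Lemma twK (phi psi : {lrmorphism T -> T}) : monomial_morphism psi ->
  cancel psi phi -> cancel phi psi -> cancel (tw psi) (tw phi).
Proof.
move=> psiM pK pK' p; elim/free_ind: p => [|c u v IHu IHv|s].
- by rewrite !linear0.
- by rewrite !linearP /= IHu IHv.
elim: s => [|i s IH]; first by rewrite mon0 !tw_1.
rewrite mon_cons !tw_var tw_comm //; last by move=> q; rewrite pK pK'.
by rewrite pK IH.
Qed.

Lemma tw_ideal (phi : {lrmorphism T -> T}) (S1 S2 : T -> Prop) :
  monomial_morphism phi ->
  (forall r, S1 r -> exists e, hom e r) ->
  (forall p, ideal S2 p -> ideal S2 (phi p)) ->
  (forall r, S1 r -> ideal S2 (tw phi r)) ->
  forall p, ideal S1 p -> ideal S2 (tw phi p).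
Proof.
move=> phiM hS pS tS p; elim/ideal_words_ind => [|c u v IHu IHv|s r t Sr].
- by rewrite linear0; apply: ideal_0.
- by rewrite linearP; apply: ideal_lin.
have [e hr] := hS _ Sr.
rewrite -mulrA (twM _ _ (hom_mon _ _ _)); apply: ideal_mull.
elim: (wgt _ _) => [|m IH]; last by rewrite iterS; apply: pS.
by rewrite (twM _ _ hr); apply: ideal_mulr; apply: tS.
Qed.

End TwistMap.

Section TwistedAlgebra.
Variables (k : fieldType) (I : choiceType) (T : free_algebra k I).
Notation wt1 := (fun _ : I => 1%N).
Variables (phi psi : {lrmorphism T -> T}).
Hypotheses (phiM : monomial_morphism phi) (psiM : monomial_morphism psi).
Hypotheses (phiK : cancel phi psi) (psiK : cancel psi phi).
Variables (SA SD : T -> Prop).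
Hypotheses (hSA : forall r, SA r -> exists e, hom wt1 e r)
           (hSD : forall r, SD r -> exists e, hom wt1 e r).
Hypotheses (psiSA : forall r, SA r -> ideal SA (psi r))
           (phiSD : forall r, SD r -> ideal SD (phi r)).
Hypotheses (twSD : forall r, SD r -> ideal SA (tw psi r))
           (twSA : forall r, SA r -> ideal SD (tw phi r)).

Lemma tw_ideal_iff p : ideal SD p <-> ideal SA (tw psi p).
Proof.
split=> [|Ip]; first exact: (tw_ideal psiM hSD (ideal_morph psiSA) twSD).
rewrite -(twK psiM psiK phiK p).
exact: (tw_ideal phiM hSA (ideal_morph phiSD) twSA).
Qed.

Variables (A : algType k) (f : {lrmorphism T -> A}).
Hypothesis fP : presentation f SA.

(** D is T modulo [SD], carried by the space of A through the map f after [tw psi]. It is the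
    inverse psi that appears here because phi must be absorbed by the isomorphism from the twist of
    D onto A. *)
Lemma twisted_algebra : exists (D : algType k) (fD : {lrmorphism T -> D}),
  presentation fD SD /\ is_twist_of (gr f wt1) (gr fD wt1).
Proof.
have fker := pres_ker fP; have fsurj := pres_surj fP.
pose F : {linear T -> A} := f \o tw psi.
have Fsurj v : exists p, F p = v.
  by have [p <-] := fsurj v; exists (tw phi p); rewrite /F /= (twK phiM phiK psiK).
have Fker p : F p = 0 <-> ideal SD p by rewrite tw_ideal_iff -fker.
have F1 : F 1 != 0 by rewrite /F /= tw_1 rmorph1 oner_neq0.
have FI u v p : F p = 0 -> F (u * p * v) = 0.
  by move=> /Fker Ip; apply/Fker; apply: ideal_mul.
have [D [fD [th [thB thf]]]] := algebra_transport Fsurj FI F1.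
have thI := bij_inj thB.
have DP : presentation fD SD.
  split=> [d|p]; first by have [p Fp] := Fsurj (th d); exists p; apply: thI; rewrite thf.
  by rewrite -Fker -thf; split=> [->|?]; [rewrite linear0|apply: thI; rewrite linear0].
have lift (ph : {lrmorphism T -> T}) : (forall r, SD r -> ideal SD (ph r)) ->
    {ph' : {lrmorphism D -> D} | forall p, ph' (fD p) = fD (ph p)}.
  move=> phS; have ph0 p : ideal SD p -> (fD \o ph) p = 0.
    by move=> Ip; apply/(pres_ker DP)/(ideal_morph phS).
  have [ph' ph'E] := descend DP (h := fD \o ph) ph0.
  have pM : monoid_morphism ph'.
    split=> [|u v]; first by rewrite -(rmorph1 fD) ph'E /= !rmorph1.
    have [p <-] := pres_surj DP u; have [q <-] := pres_surj DP v.
    by rewrite -rmorphM !ph'E /= !rmorphM.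
  pose m := GRing.isMonoidMorphism.Build D D ph' pM.
  by exists (HB.pack_for {lrmorphism D -> D} (ph' : D -> D) ph' m).
have psiSD r : SD r -> ideal SD (psi r).
  move=> Sr; apply/tw_ideal_iff; rewrite tw_comm //.
  by apply: (ideal_morph psiSA); apply: twSD.
have [phD phDE] := lift _ phiSD; have [psD psDE] := lift _ psiSD.
exists D, fD; split=> //; exists phD.
have phDK : cancel phD psD.
  by move=> d; have [p <-] := pres_surj DP d; rewrite phDE psDE phiK.
have psDK : cancel psD phD.
  by move=> d; have [p <-] := pres_surj DP d; rewrite psDE phDE psiK.
split; first by exists psD.
  have grph (ph : {lrmorphism T -> T}) (ph' : {lrmorphism D -> D}) m u :
      (forall p, ph' (fD p) = fD (ph p)) -> monomial_morphism ph ->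
      gr fD wt1 m u -> gr fD wt1 m (ph' u).
    by move=> phE mm [p hp <-]; rewrite phE; exists (ph p) => //; apply: hom_monomial.
  move=> m u; split; first exact: grph phDE phiM.
  by move/(grph _ _ _ _ psDE psiM); rewrite phDK.
exists th; split=> //.
  move=> m u; split=> [[p hp <-]|[p hp pu]].
    by rewrite thf; exists (tw psi p) => //; apply: tw_hom.
  exists (tw phi p); first exact: tw_hom.
  by apply: thI; rewrite thf /F /= (twK phiM phiK psiK).
move=> m u v [p hp <-]; have [q <-] := pres_surj DP v.
have -> : iter m phD (fD q) = fD (iter m phi q).
  by elim: m {hp} => //= m ->; rewrite phDE.
(* Passing an element of degree m, [tw psi] produces m factors psi, which undo the m factors phi of
   the twisted product. *)
rewrite -rmorphM !thf /F /= (twM _ _ hp) rmorphM; congr (_ * f _).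
have -> : tw psi (iter m phi q) = iter m phi (tw psi q).
  elim: m {hp} => //= m <-; rewrite tw_comm // => r; by rewrite phiK psiK.
by elim: m {hp} => //= m IH; rewrite -iterS iterSr phiK.
Qed.

End TwistedAlgebra.

(** * A polynomial model and the PBW basis *)

Notation o0 := (inord 0 : 'I_3).
Notation o1 := (inord 1 : 'I_3).
Notation o2 := (inord 2 : 'I_3).

Lemma ord3P (i : 'I_3) : [\/ i = o0, i = o1 | i = o2].
Proof.
case: i => [[|[|[|]]]] // h; [apply: Or31|apply: Or32|apply: Or33];
  by apply: val_inj; rewrite /= inordK.
Qed.

Lemma ord3_neq : [/\ o0 != o1, o0 != o2 & o1 != o2].
Proof. by split; rewrite -val_eqE /= !inordK. Qed.

Lemma ord3_eqE : ((o0 == o0) = true) * ((o1 == o1) = true) * ((o2 == o2) = true) *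
  ((o0 == o1) = false) * ((o1 == o0) = false) * ((o0 == o2) = false) *
  ((o2 == o0) = false) * ((o1 == o2) = false) * ((o2 == o1) = false).
Proof.
by have [/negPf h01 /negPf h02 /negPf h12] := ord3_neq;
  rewrite !eqxx h01 [o1 == o0]eq_sym h01 h02 [o2 == o0]eq_sym h02 h12 eq_sym h12.
Qed.

Definition ord3_fun (V : Type) (v0 v1 v2 : V) (i : 'I_3) : V :=
  if i == o0 then v0 else if i == o1 then v1 else v2.

Section Ord3Fun.
Variables (V : Type) (v0 v1 v2 : V).
Lemma ord3_fun0 : ord3_fun v0 v1 v2 o0 = v0. Proof. by rewrite /ord3_fun eqxx. Qed.
Lemma ord3_fun1 : ord3_fun v0 v1 v2 o1 = v1.
Proof. by rewrite /ord3_fun eqxx eq_sym; have [/negPf->] := ord3_neq. Qed.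
Lemma ord3_fun2 : ord3_fun v0 v1 v2 o2 = v2.
Proof. by rewrite /ord3_fun ![o2 == _]eq_sym; have [_ /negPf-> /negPf->] := ord3_neq. Qed.
Definition ord3_funE := (ord3_fun0, ord3_fun1, ord3_fun2).
End Ord3Fun.

Lemma sum_ord3 (V : zmodType) (F : 'I_3 -> V) :
  \sum_i F i = F o0 + F o1 + F o2.
Proof.
rewrite big_ord_recl big_ord_recl big_ord1 addrA.
by congr (F _ + F _ + F _); apply: val_inj; rewrite /= inordK.
Qed.

Section XYZRelations.
Variables (k : fieldType) (T : free_algebra k 'I_3).
Notation x := (var T o0).
Notation y := (var T o1).
Notation z := (var T o2).

Definition xyz_rel (a b c : k) (p : T) : Prop :=
  [\/ p = a *: (x * y) + b *: (y * x) + c *: z ^+ 2,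
      p = a *: (y * z) + b *: (z * y) + c *: x ^+ 2
    | p = a *: (z * x) + b *: (x * z) + c *: y ^+ 2].

Lemma xyz_rel_hom a b c p : xyz_rel a b c p -> exists e, hom (fun=> 1%N) e p.
Proof.
have h i j : hom (fun=> 1%N) 2 (var T i * var T j).
  exact: (homM (d := 1) (e := 1) (hom_var _ _ _) (hom_var _ _ _)).
by case=> ->; exists 2; do ![apply: homD|apply: homZ|exact: h].
Qed.

Lemma xyz_rel_scale a b c p : a != 0 ->
  (xyz_rel a b c p <-> xyz_rel 1 (b / a) (c / a) (a^-1 *: p)).
Proof.
move=> a0.
have E (u v w : T) : (p = a *: u + b *: v + c *: w) <->
    (a^-1 *: p = 1 *: u + (b / a) *: v + (c / a) *: w).
  split=> [->|/(congr1 (fun p => a *: p))].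
    by rewrite !scalerDr !scalerA mulVf // ![_^-1 * _]mulrC.
  rewrite !scalerDr !scalerA mulfV // scale1r mulr1 ![a * (_ / _)]mulrC.
  by rewrite !divfK.
split; case=> /E h; [exact: Or31|exact: Or32|exact: Or33| | | ];
  [exact: Or31|exact: Or32|exact: Or33].
Qed.

Lemma ideal_xyz_scale a b c p : a != 0 ->
  ideal (xyz_rel a b c) p <-> ideal (xyz_rel 1 (b / a) (c / a)) p.
Proof.
move=> a0; split; apply: ideal_trans => r hr.
  have -> : r = a *: (a^-1 *: r) by rewrite scalerA mulfV // scale1r.
  apply: ideal_scale; apply: ideal_gen.
  exact/(xyz_rel_scale _ _ _ a0).
have -> : r = a^-1 *: (a *: r) by rewrite scalerA mulVf // scale1r.
apply: ideal_scale; apply: ideal_gen; apply/(xyz_rel_scale _ _ _ a0).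
by rewrite scalerA mulVf // scale1r.
Qed.

End XYZRelations.

Section PolynomialSpace.
Variable k : fieldType.

(* The commutative polynomial ring in three variables. *)
Record poly_space := PolySpace {
  ps_sort :> comAlgType k;
  psX : ps_sort; psY : ps_sort; psZ : ps_sort;
  ps_ext : forall V : lmodType k,
    (nat -> nat -> nat -> V) -> {linear ps_sort -> V};
  ps_extE : forall (V : lmodType k) (h : nat -> nat -> nat -> V) i j l,
    ps_ext h (psX ^+ i * psY ^+ j * psZ ^+ l) = h i j l;
  ps_ind : forall Q : ps_sort -> Prop,
    Q 0 -> (forall c u v, Q u -> Q v -> Q (c *: u + v)) ->
    (forall i j l, Q (psX ^+ i * psY ^+ j * psZ ^+ l)) -> forall p, Q p }.

End PolynomialSpace.
Arguments ps_ext {k} _ [V] _.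

Section Model.
Variables (k : fieldType) (P : poly_space k) (ga : k).
Notation a := (psX P).
Notation b := (psY P).
Notation c := (psZ P).
Notation G := (ga%:A : P).

(** Left multiplication by y on the ordered monomials. As x^2 and z^2 are to be central, only the
    parity of i matters, and y x = - x y - ga z^2 is applied once. *)
Definition opY : {linear P -> P} := ps_ext P (fun i j l =>
  if odd i then - (a ^+ i * b ^+ j.+1 * c ^+ l) - G * (a ^+ i.-1 * b ^+ j * c ^+ l.+2)
  else a ^+ i * b ^+ j.+1 * c ^+ l).

(** Stands for x^i (z y^j z^l), where z has already passed x^i; for odd j the relation z y = - y z -
    ga x^2 is applied once. *)
Definition opW i j l : P :=
  if odd j then - (a ^+ i * b ^+ j * c ^+ l.+1) - G * (a ^+ i.+2 * b ^+ j.-1 * c ^+ l)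
  else a ^+ i * b ^+ j * c ^+ l.+1.

Definition opZ : {linear P -> P} := ps_ext P (fun i j l =>
  if odd i then - opW i j l - G * (a ^+ i.-1 * b ^+ j.+2 * c ^+ l) else opW i j l).

Lemma opYE i j l : opY (a ^+ i * b ^+ j * c ^+ l) =
  if odd i then - (a ^+ i * b ^+ j.+1 * c ^+ l) - G * (a ^+ i.-1 * b ^+ j * c ^+ l.+2)
  else a ^+ i * b ^+ j.+1 * c ^+ l.
Proof. exact: ps_extE. Qed.

Lemma opZE i j l : opZ (a ^+ i * b ^+ j * c ^+ l) =
  if odd i then - opW i j l - G * (a ^+ i.-1 * b ^+ j.+2 * c ^+ l) else opW i j l.
Proof. exact: ps_extE. Qed.

Lemma ps_commute (f : {linear P -> P}) (m : P) :
  (forall i j l, f (m * (a ^+ i * b ^+ j * c ^+ l)) =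
    m * f (a ^+ i * b ^+ j * c ^+ l)) -> forall p, f (m * p) = m * f p.
Proof.
move=> fm; elim/ps_ind => [|d u v IHu IHv|//].
  by rewrite mulr0 linear0 mulr0.
by rewrite linr !linearP IHu IHv linr.
Qed.

Lemma opY_a2 p : opY (a ^+ 2 * p) = a ^+ 2 * opY p.
Proof.
apply: ps_commute => i j l.
have -> : a ^+ 2 * (a ^+ i * b ^+ j * c ^+ l) = a ^+ i.+2 * b ^+ j * c ^+ l.
  by rewrite !exprS; ring.
rewrite !opYE /= negbK.
by case: i => [|i] /=; [|case: ifP => _]; rewrite !exprS; ring.
Qed.

Lemma opY_b p : opY (b * p) = b * opY p.
Proof.
apply: ps_commute => i j l.
have -> : b * (a ^+ i * b ^+ j * c ^+ l) = a ^+ i * b ^+ j.+1 * c ^+ l.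
  by rewrite exprS; ring.
by rewrite !opYE; case: ifP => _; rewrite !exprS; ring.
Qed.

Lemma opY_c p : opY (c * p) = c * opY p.
Proof.
apply: ps_commute => i j l.
have -> : c * (a ^+ i * b ^+ j * c ^+ l) = a ^+ i * b ^+ j * c ^+ l.+1.
  by rewrite exprS; ring.
by rewrite !opYE; case: ifP => _; rewrite !exprS; ring.
Qed.

Lemma opZ_a2 p : opZ (a ^+ 2 * p) = a ^+ 2 * opZ p.
Proof.
apply: ps_commute => i j l.
have -> : a ^+ 2 * (a ^+ i * b ^+ j * c ^+ l) = a ^+ i.+2 * b ^+ j * c ^+ l.
  by rewrite !exprS; ring.
rewrite !opZE /= negbK /opW.
by case: i => [|i] /=; case: ifP => _; try (case: ifP => _); rewrite !exprS; ring.
Qed.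

Lemma opZ_b2 p : opZ (b ^+ 2 * p) = b ^+ 2 * opZ p.
Proof.
apply: ps_commute => i j l.
have -> : b ^+ 2 * (a ^+ i * b ^+ j * c ^+ l) = a ^+ i * b ^+ j.+2 * c ^+ l.
  by rewrite !exprS; ring.
rewrite !opZE /opW /= negbK.
by case: j => [|j] /=; case: ifP => _; try (case: ifP => _); rewrite !exprS; ring.
Qed.

Lemma opZ_c p : opZ (c * p) = c * opZ p.
Proof.
apply: ps_commute => i j l.
have -> : c * (a ^+ i * b ^+ j * c ^+ l) = a ^+ i * b ^+ j * c ^+ l.+1.
  by rewrite exprS; ring.
by rewrite !opZE /opW; case: ifP => _; case: ifP => _; rewrite !exprS; ring.
Qed.

Lemma opY1 : opY 1 = b.
Proof. by have := opYE 0 0 0; rewrite /= !(expr0, mulr1, mul1r). Qed.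

Lemma opYa : opY a = - (a * b) - G * c ^+ 2.
Proof. by have := opYE 1 0 0; rewrite /= !(expr0, expr1, mulr1, mul1r). Qed.

Lemma opZ1 : opZ 1 = c.
Proof. by have := opZE 0 0 0; rewrite /opW /= !(expr0, expr1, mulr1, mul1r). Qed.

Lemma opZa : opZ a = - (a * c) - G * b ^+ 2.
Proof. by have := opZE 1 0 0; rewrite /opW /= !(expr0, expr1, mulr1, mul1r). Qed.

Lemma opZb : opZ b = - (b * c) - G * a ^+ 2.
Proof. by have := opZE 0 1 0; rewrite /opW /= !(expr0, expr1, mulr1, mul1r). Qed.

Lemma opZab : opZ (a * b) = a * b * c + G * a ^+ 3 - G * b ^+ 3.
Proof.
have := opZE 1 1 0; rewrite /opW /= !(expr0, expr1, mulr1, mul1r) => ->.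
by rewrite opprD !opprK.
Qed.

Lemma opYab : opY (a * b) = b * (- (a * b) - G * c ^+ 2).
Proof. by rewrite -opYa -opY_b [b * a]mulrC. Qed.

(* Over k[a^2, b^2, c] the operators a, opY and opZ are linear and the model is
   free on 1, a, b, ab. *)
Lemma model_relation (R : P -> P) :
  (forall d u v, R (d *: u + v) = d *: R u + R v) ->
  (forall p, R (a ^+ 2 * p) = a ^+ 2 * R p) ->
  (forall p, R (b ^+ 2 * p) = b ^+ 2 * R p) -> (forall p, R (c * p) = c * R p) ->
  R 1 = 0 -> R a = 0 -> R b = 0 -> R (a * b) = 0 -> forall p, R p = 0.
Proof.
move=> Rl Ra Rb Rc R1 R_a R_b Rab; elim/ps_ind => [|d u v IHu IHv|i j l].
- by have := Rl (-1) 0 0; rewrite scaler0 addr0 scaleN1r addNr.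
- by rewrite Rl IHu IHv scaler0 addr0.
have Rc' p n : R p = 0 -> R (p * c ^+ n) = 0.
  move=> p0; rewrite mulrC; elim: n => [|n IH]; first by rewrite expr0 mul1r.
  by rewrite exprS -mulrA Rc IH mulr0.
have Ra' p n : R p = 0 -> R (a ^+ n.*2 * p) = 0.
  move=> p0; elim: n => [|n IH]; first by rewrite double0 expr0 mul1r.
  rewrite doubleS !exprS.
  by rewrite (_ : _ * p = a ^+ 2 * (a ^+ n.*2 * p)) ?Ra ?IH ?mulr0 //; ring.
have Rb' p n : R p = 0 -> R (b ^+ n.*2 * p) = 0.
  move=> p0; elim: n => [|n IH]; first by rewrite double0 expr0 mul1r.
  rewrite doubleS !exprS.
  by rewrite (_ : _ * p = b ^+ 2 * (b ^+ n.*2 * p)) ?Rb ?IH ?mulr0 //; ring.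
apply: Rc'; rewrite -[i]odd_double_half -[j]odd_double_half !exprD.
rewrite (_ : _ * _ * _ = a ^+ i./2.*2 * (b ^+ j./2.*2 * (a ^+ odd i * b ^+ odd j))).
  by apply: Ra'; apply: Rb'; do 2!case: odd; rewrite ?expr0 ?expr1 ?mulr1 ?mul1r.
by ring.
Qed.

Let opYG p : opY (G * p) = G * opY p. Proof. by rewrite !mulr_algl linearZ. Qed.
Let opZG p : opZ (G * p) = G * opZ p. Proof. by rewrite !mulr_algl linearZ. Qed.
Let opYD p q : opY (p + q) = opY p + opY q. Proof. exact: linearD. Qed.
Let opZD p q : opZ (p + q) = opZ p + opZ q. Proof. exact: linearD. Qed.
Let opYN p : opY (- p) = - opY p. Proof. exact: linearN. Qed.
Let opZN p : opZ (- p) = - opZ p. Proof. exact: linearN. Qed.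

Let opYbn n : opY (b ^+ n) = b ^+ n.+1.
Proof. by elim: n => [|n IH]; [rewrite expr0 opY1|rewrite exprS opY_b IH -exprS]. Qed.
Let opYcn n : opY (c ^+ n) = c ^+ n * b.
Proof. by elim: n => [|n IH]; [rewrite expr0 opY1 mul1r|rewrite exprS opY_c IH mulrA]. Qed.
Let opZcn n : opZ (c ^+ n) = c ^+ n.+1.
Proof. by elim: n => [|n IH]; [rewrite expr0 opZ1|rewrite exprS opZ_c IH -exprS]. Qed.
Let opYa2 : opY (a ^+ 2) = a ^+ 2 * b.
Proof. by rewrite -[a ^+ 2 in LHS]mulr1 opY_a2 opY1. Qed.
Let opYa3 : opY (a ^+ 3) = a ^+ 2 * opY a.
Proof. by rewrite exprSr opY_a2. Qed.
Let opZa2 : opZ (a ^+ 2) = a ^+ 2 * c.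
Proof. by rewrite -[a ^+ 2 in LHS]mulr1 opZ_a2 opZ1. Qed.
Let opZa3 : opZ (a ^+ 3) = a ^+ 2 * opZ a.
Proof. by rewrite exprSr opZ_a2. Qed.
Let opZb2 : opZ (b ^+ 2) = b ^+ 2 * c.
Proof. by rewrite -[b ^+ 2 in LHS]mulr1 opZ_b2 opZ1. Qed.
Let opZb3 : opZ (b ^+ 3) = b ^+ 2 * opZ b.
Proof. by rewrite exprSr opZ_b2. Qed.

Let opYb : opY b = b ^+ 2. Proof. exact: (opYbn 1). Qed.
Let opYc : opY c = c * b. Proof. exact: (opYcn 1). Qed.
Let opZc : opZ c = c ^+ 2. Proof. exact: (opZcn 1). Qed.

Let opE := (opYG, opZG, opYD, opZD, opYN, opZN, opYb, opYc, opZc, opYa3, opZa3,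
  opZb3, opYab, opZab, opY1, opYa, opZ1, opZa, opZb, opYa2, opZa2, opZb2, opYbn, opYcn, opZcn).

(** With [opZZ], this makes the squared term of each relation a plain multiplication, so that
    linearity over k[a^2, b^2, c] can be applied. *)
Lemma opYY p : opY (opY p) = b ^+ 2 * p.
Proof.
apply/eqP; rewrite -subr_eq0; apply/eqP; move: p.
apply: model_relation => [d u v|p|p|p||||].
- by rewrite linr !linearP /=; lin_comb P; ring.
- by rewrite !opY_a2; ring.
- by rewrite expr2 -!mulrA !opY_b; ring.
- by rewrite !opY_c; ring.
- by rewrite !opE; ring.
- by rewrite !opE; ring.
- by rewrite !opE; ring.
- by rewrite opYab opY_b !opE; ring.
Qed.

Lemma opZZ p : opZ (opZ p) = c ^+ 2 * p.
Proof.
apply/eqP; rewrite -subr_eq0; apply/eqP; move: p.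
apply: model_relation => [d u v|p|p|p||||].
- by rewrite linr !linearP /=; lin_comb P; ring.
- by rewrite !opZ_a2; ring.
- by rewrite !opZ_b2; ring.
- by rewrite !opZ_c; ring.
- by rewrite !opE; ring.
- by rewrite !opE (mulrC a c) ?(mulrC a c) ?opZ_c !opE; ring.
- by rewrite !opE (mulrC b c) ?(mulrC b c) ?opZ_c !opE; ring.
- by rewrite !opE (mulrC (a * b) c) ?(mulrC (a * b) c) ?opZ_c !opE; ring.
Qed.

Lemma model_xy p : a * opY p + opY (a * p) + G * (opZ (opZ p)) = 0.
Proof.
rewrite opZZ; move: p; apply: model_relation => [d u v|p|p|p||||].
- by rewrite !(linr, linearP) /=; lin_comb P; ring.
- by rewrite (mulrCA a) !opY_a2; ring.
- by rewrite (mulrCA a) expr2 -!mulrA !opY_b; ring.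
- by rewrite (mulrCA a) !opY_c; ring.
- by rewrite mulr1 !opE; ring.
- by rewrite -expr2 !opE; ring.
- by rewrite !opE; ring.
- by rewrite mulrA -expr2 opY_a2 !opE; ring.
Qed.

Lemma model_zx p : opZ (a * p) + a * opZ p + G * (opY (opY p)) = 0.
Proof.
rewrite opYY; move: p; apply: model_relation => [d u v|p|p|p||||].
- by rewrite !(linr, linearP) /=; lin_comb P; ring.
- by rewrite (mulrCA a) !opZ_a2; ring.
- by rewrite (mulrCA a) !opZ_b2; ring.
- by rewrite (mulrCA a) !opZ_c; ring.
- by rewrite mulr1 !opE; ring.
- by rewrite -expr2 !opE; ring.
- by rewrite !opE; ring.
- by rewrite mulrA -expr2 opZ_a2 !opE; ring.
Qed.

Lemma model_yz p : opY (opZ p) + opZ (opY p) + G * (a * (a * p)) = 0.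
Proof.
move: p; apply: model_relation => [d u v|p|p|p||||].
- by rewrite !(linr, linearP) /=; lin_comb P; ring.
- by rewrite !(opZ_a2, opY_a2); ring.
- by rewrite opZ_b2 expr2 -!mulrA !opY_b !mulrA -expr2 opZ_b2; ring.
- by rewrite !(opY_c, opZ_c); ring.
- by rewrite !opE; ring.
- by rewrite !opE (mulrC a c) opY_c !opE; ring.
- by rewrite !opE (mulrC b c) opY_c !opE; ring.
- have -> : opZ (opY (a * b)) = - (b ^+ 2 * opZ a) - G * (c ^+ 2 * opZ b).
    rewrite opYab (_ : _ * _ = - (b ^+ 2 * a) - G * (c * (c * b))); last by ring.
    by rewrite opZD !opZN opZG opZ_b2 !opZ_c; ring.
  by rewrite !opE (mulrC (a * b) c) opY_c !opE; ring.
Qed.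

End Model.

(** * Normality of the squares *)

Lemma linear_combination2 (k : fieldType) (V : lmodType k) (al be : k) (u v p q : V) :
  u = 0 -> v = 0 -> p - q = al *: u + be *: v -> p = q.
Proof.
by move=> -> ->; rewrite !scaler0 addr0 => /eqP; rewrite subr_eq0 => /eqP.
Qed.

Section SquaresNormal.
Variables (k : fieldType) (A : algType k) (q ga : k).
Hypotheses (q3 : q ^+ 3 = 1) (ga3 : ga ^+ 3 != 1).

Definition skew_relation (x y z : A) := x * y + q *: (y * x) + ga *: (z * z) = 0.

(** Multiplying the relation by x on the left, and by - q x on the right, cancels xyx. What remains
    passes the defect of (x, y) on to (z, x), so three steps close the cycle with factor (ga q)^3 =
    ga^3. *)
Let step1 (x y z : A) : skew_relation x y z ->
  x * x * y - q ^+ 2 *: (y * (x * x)) =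
  (ga * q) *: (z * z * x - q ^+ 2 *: (x * (z * z))).
Proof.
move=> h; have h1 := congr1 (fun u => x * u) h; have h2 := congr1 (fun u => u * x) h.
move: h1 h2; rewrite mulr0 mul0r !mulrDr !mulrDl -!scalerAr -!scalerAl !mulrA => h1 h2.
apply: (linear_combination2 (al := 1) (be := - q) h1 h2).
by lin_comb A; ring: q3.
Qed.

Let step2 (x y z : A) : skew_relation z x y ->
  x * x * z - q *: (z * (x * x)) = (ga * q) *: (y * y * x - q *: (x * (y * y))).
Proof.
move=> h; have h1 := congr1 (fun u => x * u) h; have h2 := congr1 (fun u => u * x) h.
move: h1 h2; rewrite mulr0 mul0r !mulrDr !mulrDl -!scalerAr -!scalerAl !mulrA => h1 h2.
apply: (linear_combination2 (al := q ^+ 2) (be := - q) h1 h2).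
lin_comb A; ring: q3.
Qed.

Variables x y z : A.
Hypotheses (hxy : skew_relation x y z) (hyz : skew_relation y z x)
           (hzx : skew_relation z x y).

Let cube_fixed (u : A) : u = (ga * q) *: ((ga * q) *: ((ga * q) *: u)) -> u = 0.
Proof.
rewrite !scalerA => /eqP; rewrite -[X in X == _]scale1r -subr_eq0 -scalerBl.
rewrite scaler_eq0 => /orP[|/eqP //]; rewrite subr_eq0 => /eqP h.
by case/eqP: ga3; rewrite h; ring: q3.
Qed.

Lemma square_skew_next : x * x * y = q ^+ 2 *: (y * (x * x)).
Proof.
apply/eqP; rewrite -subr_eq0; apply/eqP/cube_fixed.
by rewrite -(step1 hyz) -(step1 hzx) -(step1 hxy).
Qed.

Lemma square_skew_prev : x * x * z = q *: (z * (x * x)).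
Proof.
apply/eqP; rewrite -subr_eq0; apply/eqP/cube_fixed.
by rewrite -(step2 hyz) -(step2 hxy) -(step2 hzx).
Qed.

End SquaresNormal.

(** * The PBW basis for q = 1 *)

Section PBW.
Variables (k : fieldType) (T : free_algebra k 'I_3) (P : poly_space k).
Notation x := (var T o0).
Notation y := (var T o1).
Notation z := (var T o2).
Notation a := (psX P).
Notation b := (psY P).
Notation c := (psZ P).

(** Collects what can be transported along a twist: a linear identification of T modulo S with P,
    degree by degree, and the regularity of x on both sides. Products in P are not compared with
    products in T. *)
Record PBW (S : T -> Prop) (kap : {linear T -> P}) (Lam : {linear P -> T}) : Prop := {
  PBW_ker : forall p, kap p = 0 <-> ideal S p;
  PBW_sec : cancel Lam kap;
  PBW_hom : forall i j l, hom (fun=> 1%N) (i + j + l)%N (Lam (a ^+ i * b ^+ j * c ^+ l));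
  PBW_cancell : forall p, ideal S (x * p) -> ideal S p;
  PBW_cancelr : forall p, ideal S (p * x) -> ideal S p }.

Section Commutative.
Variable ga : k.
Hypothesis ga3 : ga ^+ 3 != 1.
Notation S := (xyz_rel (T := T) 1 1 ga).

Definition model_op (i : 'I_3) : P -> P :=
  ord3_fun (fun p => a * p) (opY P ga) (opZ P ga) i.

Lemma model_op_lin i d u v : model_op i (d *: u + v) = d *: model_op i u + model_op i v.
Proof. by case: (ord3P i) => ->; rewrite /model_op ord3_funE ?linr ?linearP. Qed.

Definition model_act (n : P) : {linear T -> P} := lext T (foldr model_op n).

Lemma model_actM n p q : model_act n (p * q) = model_act (model_act n q) p.
Proof.
elim/free_ind: p => [|d u v IHu IHv|s]; first by rewrite mul0r !linear0.
  by rewrite linl !linearP /= IHu IHv.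
elim/free_ind: q => [|d u v IHu IHv|t].
- rewrite mulr0 linear0 [RHS]lext_mon; elim: s => //= i s <-.
  by have := model_op_lin i (-1) 0 0; rewrite scaler0 addr0 scaleN1r addNr.
- rewrite linr !linearP /= IHu IHv !lext_mon.
  by elim: s {IHu IHv} => //= i s <-; rewrite model_op_lin.
by rewrite -mon_cat !lext_mon foldr_cat.
Qed.

Lemma model_act_var n i : model_act n (var T i) = model_op i n.
Proof. exact: lext_mon. Qed.

Lemma model_act_rel n r : S r -> model_act n r = 0.
Proof.
case=> ->; rewrite !linearD !linearZ /= expr2 !model_actM !model_act_var /model_op
  !ord3_funE !scale1r -mulr_algl.
- exact: model_xy.
- exact: model_yz.
- exact: model_zx.
Qed.

Lemma model_act_ideal n p : ideal S p -> model_act n p = 0.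
Proof.
elim/ideal_words_ind=> [|d u v IHu IHv|s r t Sr].
- exact: linear0.
- by rewrite linearP /= IHu IHv scaler0 addr0.
rewrite !model_actM (model_act_rel _ Sr) [LHS]lext_mon.
elim: s => //= i s ->.
by have := model_op_lin i (-1) 0 0; rewrite scaler0 addr0 scaleN1r addNr.
Qed.

Variables (A : algType k) (f : {lrmorphism T -> A}).
Hypothesis fP : presentation f S.
Notation fx := (f x).
Notation fy := (f y).
Notation fz := (f z).

Lemma pres_skew_relations :
  [/\ skew_relation 1 ga fx fy fz, skew_relation 1 ga fy fz fx
    & skew_relation 1 ga fz fx fy].
Proof.
have h p : S p -> f p = 0 by move=> Sp; apply/(pres_ker fP)/ideal_gen.
by split; [have := h _ (Or31 _ _ erefl)|have := h _ (Or32 _ _ erefl)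
  |have := h _ (Or33 _ _ erefl)];
  rewrite /skew_relation !linearD !linearZ /= expr2 !rmorphM /= !scale1r.
Qed.

Lemma square_central i j : GRing.comm (f (var T i) * f (var T i)) (f (var T j)).
Proof.
have [hxy hyz hzx] := pres_skew_relations.
have q1 : 1 ^+ 3 = 1 :> k by rewrite expr1n.
have nx (X Y Z : A) (h1 : skew_relation 1 ga X Y Z) (h2 : skew_relation 1 ga Y Z X)
    (h3 : skew_relation 1 ga Z X Y) : GRing.comm (X * X) Y /\ GRing.comm (X * X) Z.
  rewrite /GRing.comm (square_skew_next q1 ga3 h1 h2 h3).
  by rewrite (square_skew_prev q1 ga3 h1 h2 h3) expr1n !scale1r.
have [h01 h02] := nx _ _ _ hxy hyz hzx; have [h12 h10] := nx _ _ _ hyz hzx hxy.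
have [h20 h21] := nx _ _ _ hzx hxy hyz.
by case: (ord3P i) => ->; case: (ord3P j) => -> //; rewrite /GRing.comm mulrA.
Qed.

Definition pbw_lam : {linear P -> A} :=
  ps_ext P (fun i j l => fx ^+ i * fy ^+ j * fz ^+ l).

Notation L i j l := (fx ^+ i * fy ^+ j * fz ^+ l).

Lemma pbw_lamE i j l : pbw_lam (a ^+ i * b ^+ j * c ^+ l) = L i j l.
Proof. exact: ps_extE. Qed.

Let lamG p : pbw_lam (ga%:A * p) = ga *: pbw_lam p.
Proof. by rewrite mulr_algl linearZ. Qed.

Let lamBG p q : pbw_lam (p - ga%:A * q) = pbw_lam p - ga *: pbw_lam q.
Proof. by rewrite linearB /= lamG. Qed.

Let lamN p : pbw_lam (- p) = - pbw_lam p.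
Proof. exact: linearN. Qed.

Let even_comm i j n : GRing.comm (f (var T i) ^+ n.*2) (f (var T j)).
Proof.
rewrite -mul2n exprM expr2; apply: commr_sym; apply: commrX; apply: commr_sym.
exact: square_central.
Qed.

Lemma lam_opX p : pbw_lam (a * p) = fx * pbw_lam p.
Proof.
elim/ps_ind: p => [|d u v IHu IHv|i j l]; first by rewrite mulr0 !linear0 mulr0.
  by rewrite linr !linearP /= IHu IHv linr.
by rewrite !mulrA -exprS !pbw_lamE exprS !mulrA.
Qed.

(** Moves v past an odd power X u: the even power X commutes with v, the swap of v and u creates the
    square w, and w moves on past r. *)
Let odd_swap (u v w r s X : A) : v * u = - (u * v) - ga *: w ->
  X * v = v * X -> w * r = r * w ->
  v * (X * u * r * s) = - (X * u * (v * r) * s) - ga *: (X * r * (w * s)).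
Proof.
move=> vu Xv wr; have -> : v * (X * u * r * s) = X * (v * u) * r * s.
  by rewrite !mulrA -Xv.
rewrite vu mulrBr mulrN !mulrBl !mulNr -scalerAr -!scalerAl !mulrA; congr (_ - _ *: _).
by rewrite -(mulrA X w r) wr !mulrA.
Qed.

Let even_odd i : odd i -> i = i./2.*2.+1.
Proof. by move=> oi; rewrite -{1}[i]odd_double_half oi. Qed.

Let even_even i : ~~ odd i -> i = i./2.*2.
Proof. by move=> /negPf oi; rewrite -{1}[i]odd_double_half oi. Qed.

Lemma lam_opY p : pbw_lam (opY P ga p) = fy * pbw_lam p.
Proof.
elim/ps_ind: p => [|d u v IHu IHv|i j l]; first by rewrite !linear0 mulr0.
  by rewrite !linearP /= IHu IHv linr.
have [hxy _ _] := pres_skew_relations.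
rewrite opYE; case: ifPn => [/even_odd|/even_even] ->; move: i./2 => m.
  have cy := even_comm o0 o1 m; rewrite /GRing.comm in cy.
  rewrite lamBG lamN !pbw_lamE.
  rewrite exprSr [fy ^+ j.+1]exprS [fz ^+ l.+2]exprS [fz ^+ l.+1]exprS [fz * (_ * _)]mulrA.
  symmetry; apply: odd_swap => //.
    apply/eqP; rewrite -subr_eq0 opprD !opprK -hxy scale1r; apply/eqP.
    by lin_comb A; ring.
  by apply: commrX; apply: square_central.
rewrite !pbw_lamE exprS !mulrA; congr (_ * _ * _); exact: even_comm.
Qed.

Let lam_opW i j l : pbw_lam (opW P ga i j l) = fx ^+ i * (fz * (fy ^+ j * fz ^+ l)).
Proof.
have [_ hyz _] := pres_skew_relations.
rewrite /opW; case: ifPn => [/even_odd|/even_even] ->; move: j./2 => m.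
  have cy := even_comm o1 o2 m; rewrite /GRing.comm in cy.
  rewrite lamBG lamN !pbw_lamE -(addn2 i) exprD expr2.
  transitivity (fx ^+ i * (- (fy ^+ m.*2.+1 * fz ^+ l.+1) -
      ga *: (fx * fx * (fy ^+ m.*2 * fz ^+ l)))).
    by rewrite mulrBr mulrN -scalerAr !mulrA.
  congr (_ * _).
  rewrite [fz ^+ l.+1]exprS.
  have := @odd_swap fy fz (fx * fx) 1 (fz ^+ l) (fy ^+ m.*2).
  rewrite !mulr1 -exprSr -!mulrA => -> //; last by rewrite mul1r ?mulr1.
    congr (_ - _ *: _); rewrite !mulrA -(mulrA (fy ^+ _)); congr (_ * _).
    by apply: commrX; apply: square_central.
  apply/eqP; rewrite -subr_eq0 opprD !opprK -hyz scale1r; apply/eqP.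
  by lin_comb A; ring.
rewrite !pbw_lamE exprS -!mulrA; congr (_ * _); rewrite !mulrA; congr (_ * _).
exact: even_comm.
Qed.

Lemma lam_opZ p : pbw_lam (opZ P ga p) = fz * pbw_lam p.
Proof.
elim/ps_ind: p => [|d u v IHu IHv|i j l]; first by rewrite !linear0 mulr0.
  by rewrite !linearP /= IHu IHv linr.
have [_ _ hzx] := pres_skew_relations.
rewrite opZE; case: ifPn => [/even_odd|/even_even] ->; move: i./2 => m.
  have cy := even_comm o0 o2 m; rewrite /GRing.comm in cy.
  have e2 : fy ^+ j.+2 = fy * fy * fy ^+ j by rewrite exprS exprS mulrA.
  rewrite lamBG lamN lam_opW !pbw_lamE e2 [in fx ^+ _.-1]succnK.
  have := @odd_swap fx fz (fy * fy) 1 (fy ^+ j * fz ^+ l) (fx ^+ m.*2).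
  rewrite !mulr1 -exprSr -!mulrA => -> //.
  - apply/eqP; rewrite -subr_eq0 opprD !opprK -hzx scale1r; apply/eqP.
    by lin_comb A; ring.
  - by rewrite mul1r ?mulr1.
rewrite lam_opW !pbw_lamE !mulrA; congr (_ * _ * _); exact: even_comm.
Qed.

(** [pbw_lam] intertwines the model operators with left multiplication by the generators. Hence p
    acts by zero on 1 only if p lies in the ideal: the ordered monomials span. *)
Lemma lam_act p : pbw_lam (model_act 1 p) = f p.
Proof.
elim/free_ind: p => [|d u v IHu IHv|s]; first by rewrite !linear0.
  by rewrite !linearP /= IHu IHv.
rewrite [model_act _ _]lext_mon; elim: s => [|i s IH] /=.
  by have := pbw_lamE 0 0 0; rewrite !expr0 !mulr1 mon0 rmorph1.
rewrite mon_cons rmorphM /= -IH /model_op.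
by case: (ord3P i) => ->; rewrite ord3_funE /= (lam_opX, lam_opY, lam_opZ).
Qed.

Definition pbw_word i j l : seq 'I_3 := nseq i o0 ++ nseq j o1 ++ nseq l o2.

(** The ordered words take distinct monomials as values, which gives their independence and the
    section [Lam]. *)
Lemma act_word i j l : model_act 1 (mon T (pbw_word i j l)) = a ^+ i * b ^+ j * c ^+ l.
Proof.
rewrite [LHS]lext_mon !foldr_cat.
have -> : foldr model_op 1 (nseq l o2) = c ^+ l.
  elim: l => //= l ->; rewrite /model_op ord3_funE.
  by have := opZE P ga 0 0 l; rewrite /opW /= !expr0 !mul1r.
have -> : foldr model_op (c ^+ l) (nseq j o1) = b ^+ j * c ^+ l.
  elim: j => /= [|j ->]; first by rewrite expr0 mul1r.
  by rewrite /model_op ord3_funE; have := opYE P ga 0 j l; rewrite /= !expr0 !mul1r.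
elim: i => /= [|i ->]; first by rewrite expr0 mul1r.
by rewrite /model_op ord3_funE exprS !mulrA.
Qed.

Lemma psX_cancel (p : P) : a * p = 0 -> p = 0.
Proof.
pose D : {linear P -> P} :=
  ps_ext P (fun i j l => if i is i'.+1 then a ^+ i' * b ^+ j * c ^+ l else 0).
have DK q : D (a * q) = q.
  elim/ps_ind: q => [|d u v IHu IHv|i j l]; first by rewrite mulr0 linear0.
    by rewrite linr linearP /= IHu IHv.
  by rewrite !mulrA -exprS [LHS]ps_extE.
by move=> ap; rewrite -(DK p) ap linear0.
Qed.

Theorem PBW_commutative : exists kap Lam, PBW S kap Lam.
Proof.
pose Lam : {linear P -> T} := ps_ext P (fun i j l => mon T (pbw_word i j l)).
have ker p : model_act 1 p = 0 <-> ideal S p.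
  split=> [p0|]; last exact: model_act_ideal.
  by apply/(pres_ker fP); rewrite -lam_act p0 linear0.
have cancell p : ideal S (x * p) -> ideal S p.
  move/ker; rewrite model_actM model_act_var /model_op ord3_funE => /psX_cancel.
  by move/ker.
exists (model_act 1), Lam; split=> //.
- elim/ps_ind => [|d u v IHu IHv|i j l]; first by rewrite !linear0.
    by rewrite !linearP /= IHu IHv.
  by rewrite [Lam _]ps_extE act_word.
- move=> i j l; rewrite [Lam _]ps_extE.
  suff -> : (i + j + l)%N = wgt (fun=> 1%N) (pbw_word i j l) by exact: hom_mon.
  by rewrite /wgt sum1_size !size_cat !size_nseq addnA.
have cen p : GRing.comm (fx * fx) (f p).
  elim/free_ind: p => [|d u v IHu IHv|s]; rewrite /GRing.comm.
  - by rewrite linear0 mul0r mulr0.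
  - by rewrite linearP /= linl linr IHu IHv.
  elim: s => [|i s IH]; first by rewrite mon0 rmorph1 mul1r mulr1.
  by rewrite mon_cons rmorphM /= mulrA square_central -mulrA IH !mulrA.
(* Since x^2 is central, p x = 0 gives x^2 p = 0, and x is cancelled twice on the left. *)
move=> p /(pres_ker fP); rewrite rmorphM => px; do 2!apply: (cancell).
apply/(pres_ker fP); rewrite !rmorphM mulrA [LHS]cen mulrA.
by rewrite (px : f p * f x = 0) mul0r.
Qed.

End Commutative.
End PBW.

(** * Diagonal and cyclic automorphisms and their twists *)

Section Automorphisms.
Variables (k : fieldType) (T : free_algebra k 'I_3).
Notation x := (var T o0).
Notation y := (var T o1).
Notation z := (var T o2).

Definition diag (s : k) : {lrmorphism T -> T} :=
  ev (ord3_fun x (s *: y) (s ^+ 2 *: z)).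

Definition rot : {lrmorphism T -> T} := ev (ord3_fun y z x).
Definition rot' : {lrmorphism T -> T} := ev (ord3_fun z x y).

Lemma diagE s : (diag s x = x) * (diag s y = s *: y) * (diag s z = s ^+ 2 *: z).
Proof. by rewrite /diag /= !ev_var !ord3_funE. Qed.

Lemma rotE : (rot x = y) * (rot y = z) * (rot z = x).
Proof. by rewrite /rot /= !ev_var !ord3_funE. Qed.

Lemma rot'E : (rot' x = z) * (rot' y = x) * (rot' z = y).
Proof. by rewrite /rot' /= !ev_var !ord3_funE. Qed.

Lemma diag_monomial s : monomial_morphism (diag s).
Proof.
move=> i; case: (ord3P i) => ->; rewrite diagE.
- by exists 1, o0; rewrite scale1r.
- by exists s, o1.
- by exists (s ^+ 2), o2.
Qed.

Lemma rot_monomial : monomial_morphism rot.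
Proof.
by move=> i; exists 1; case: (ord3P i) => ->; rewrite rotE;
  [exists o1|exists o2|exists o0]; rewrite scale1r.
Qed.

Lemma rot'_monomial : monomial_morphism rot'.
Proof.
by move=> i; exists 1; case: (ord3P i) => ->; rewrite rot'E;
  [exists o2|exists o0|exists o1]; rewrite scale1r.
Qed.

Lemma lrmorphism_cancel (phi psi : {lrmorphism T -> T}) :
  (forall i, psi (phi (var T i)) = var T i) -> cancel phi psi.
Proof.
move=> h p; elim/free_ind: p => [|d u v IHu IHv|s]; first by rewrite !linear0.
  by rewrite !linearP /= IHu IHv.
elim: s => [|i s IH]; first by rewrite mon0 !rmorph1.
by rewrite mon_cons !rmorphM /= h IH.
Qed.

Lemma diagK s t : s * t = 1 -> cancel (diag s) (diag t).
Proof.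
move=> st; apply: lrmorphism_cancel => i; case: (ord3P i) => ->;
  rewrite !diagE // linearZ /= diagE scalerA ?st ?scale1r //.
by rewrite -exprMn st expr1n scale1r.
Qed.

Lemma rotK : cancel rot rot'.
Proof.
by apply: lrmorphism_cancel => i; case: (ord3P i) => ->; rewrite !rotE !rot'E.
Qed.

Lemma rot'K : cancel rot' rot.
Proof.
by apply: lrmorphism_cancel => i; case: (ord3P i) => ->; rewrite !rot'E !rotE.
Qed.

Lemma tw_var2 (phi : {lrmorphism T -> T}) i j :
  tw phi (var T i * var T j) = var T i * phi (var T j).
Proof.
rewrite tw_var; congr (_ * phi _).
by rewrite -[var T j in LHS]mulr1 tw_var tw_1 rmorph1 mulr1.
Qed.

Lemma ideal_xyz_image a b c (d : k) p (r : T) :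
  p = d *: r -> xyz_rel a b c r -> ideal (xyz_rel a b c) p.
Proof. by move=> -> Sr; apply: ideal_scale; apply: ideal_gen. Qed.

Notation xyz_ideal a b c := (ideal (xyz_rel (T := T) a b c)).

Lemma diag_ideal s a b c r : s ^+ 3 = 1 ->
  xyz_rel a b c r -> xyz_ideal a b c (diag s r).
Proof.
move=> s3; case=> ->;
  [apply: (@ideal_xyz_image _ _ _ s _ _ _ (Or31 _ _ erefl))
  |apply: (@ideal_xyz_image _ _ _ 1 _ _ _ (Or32 _ _ erefl))
  |apply: (@ideal_xyz_image _ _ _ (s ^+ 2) _ _ _ (Or33 _ _ erefl))];
rewrite !linearD !linearZ /= !expr2 !rmorphM /= !diagE -?scalerAl -?scalerAr;
by lin_comb T; ring: s3.
Qed.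

Lemma rot_ideal a b c r : xyz_rel a b c r -> xyz_ideal a b c (rot r).
Proof.
case=> ->;
  [apply: (@ideal_xyz_image _ _ _ 1 _ _ _ (Or32 _ _ erefl))
  |apply: (@ideal_xyz_image _ _ _ 1 _ _ _ (Or33 _ _ erefl))
  |apply: (@ideal_xyz_image _ _ _ 1 _ _ _ (Or31 _ _ erefl))];
rewrite !linearD !linearZ /= !expr2 !rmorphM /= !rotE;
by lin_comb T; ring.
Qed.

Lemma rot'_ideal a b c r : xyz_rel a b c r -> xyz_ideal a b c (rot' r).
Proof.
case=> ->;
  [apply: (@ideal_xyz_image _ _ _ 1 _ _ _ (Or33 _ _ erefl))
  |apply: (@ideal_xyz_image _ _ _ 1 _ _ _ (Or31 _ _ erefl))
  |apply: (@ideal_xyz_image _ _ _ 1 _ _ _ (Or32 _ _ erefl))];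
rewrite !linearD !linearZ /= !expr2 !rmorphM /= !rot'E;
by lin_comb T; ring.
Qed.

(** In x y, y x and z^2 the second letter brings s, 1 and s^2; dividing by s leaves 1, s^2 and s,
    and the other relations give the same ratios. The choice s = q turns q into q^3 = 1. *)
Lemma tw_diag_ideal s q ga r : s ^+ 3 = 1 ->
  xyz_rel 1 q ga r -> xyz_ideal 1 (q * s ^+ 2) (ga * s) (tw (diag s) r).
Proof.
move=> s3; case=> ->;
  [apply: (@ideal_xyz_image _ _ _ s _ _ _ (Or31 _ _ erefl))
  |apply: (@ideal_xyz_image _ _ _ (s ^+ 2) _ _ _ (Or32 _ _ erefl))
  |apply: (@ideal_xyz_image _ _ _ 1 _ _ _ (Or33 _ _ erefl))];
rewrite !linearD !linearZ /= !expr2 !tw_var2 !diagE -?scalerAr;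
by lin_comb T; ring: s3.
Qed.

(** The monomials x y, y x and z^2 become x^2, y z and z y: the twist permutes the three kinds of
    monomials cyclically, and with them the coefficients. *)
Lemma tw_rot'_ideal a b c r : xyz_rel a b c r -> xyz_ideal b c a (tw rot' r).
Proof.
case=> ->;
  [apply: (@ideal_xyz_image _ _ _ 1 _ _ _ (Or32 _ _ erefl))
  |apply: (@ideal_xyz_image _ _ _ 1 _ _ _ (Or33 _ _ erefl))
  |apply: (@ideal_xyz_image _ _ _ 1 _ _ _ (Or31 _ _ erefl))];
rewrite !linearD !linearZ /= !expr2 !tw_var2 !rot'E;
by lin_comb T; ring.
Qed.

Lemma tw_rot_ideal a b c r : xyz_rel a b c r -> xyz_ideal c a b (tw rot r).
Proof.
case=> ->;
  [apply: (@ideal_xyz_image _ _ _ 1 _ _ _ (Or33 _ _ erefl))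
  |apply: (@ideal_xyz_image _ _ _ 1 _ _ _ (Or31 _ _ erefl))
  |apply: (@ideal_xyz_image _ _ _ 1 _ _ _ (Or32 _ _ erefl))];
rewrite !linearD !linearZ /= !expr2 !tw_var2 !rotE;
by lin_comb T; ring.
Qed.

Section TwistsOfA.
Variables (A : algType k) (f : {lrmorphism T -> A}).
Notation wt1 := (fun _ : 'I_3 => 1%N).

Lemma twist_diag q ga : q ^+ 3 = 1 -> presentation f (xyz_rel 1 q ga) ->
  exists (D : algType k) (fD : {lrmorphism T -> D}),
    presentation fD (xyz_rel 1 1 (ga * q)) /\ is_twist_of (gr f wt1) (gr fD wt1).
Proof.
move=> q3 fP.
have q23 : (q ^+ 2) ^+ 3 = 1 by rewrite -exprM mulnC exprM q3 expr1n.
have qq : q * q ^+ 2 = 1 by rewrite -exprS.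
refine (twisted_algebra (phi := diag q) (psi := diag (q ^+ 2))
  _ _ _ _ _ _ _ _ _ _ fP).
- exact: diag_monomial.
- exact: diag_monomial.
- exact: diagK.
- by apply: diagK; rewrite mulrC.
- exact: xyz_rel_hom.
- exact: xyz_rel_hom.
- by move=> r; apply: diag_ideal.
- by move=> r; apply: diag_ideal.
- move=> r /(tw_diag_ideal q23).
  have -> : 1 * (q ^+ 2) ^+ 2 = q by ring: q3.
  by have -> : ga * q * q ^+ 2 = ga by ring: q3.
- move=> r /(tw_diag_ideal q3).
  by have -> : q * q ^+ 2 = 1 by ring: q3.
Qed.

Lemma twist_rot a b c : presentation f (xyz_rel a b c) ->
  exists (D : algType k) (fD : {lrmorphism T -> D}),
    presentation fD (xyz_rel c a b) /\ is_twist_of (gr f wt1) (gr fD wt1).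
Proof.
move=> fP; refine (twisted_algebra (phi := rot) (psi := rot')
  _ _ _ _ _ _ _ _ _ _ fP).
- exact: rot_monomial.
- exact: rot'_monomial.
- exact: rotK.
- exact: rot'K.
- exact: xyz_rel_hom.
- exact: xyz_rel_hom.
- by move=> r; apply: rot'_ideal.
- by move=> r; apply: rot_ideal.
- by move=> r; apply: tw_rot'_ideal.
- by move=> r; apply: tw_rot_ideal.
Qed.

Lemma twist_rot' a b c : presentation f (xyz_rel a b c) ->
  exists (D : algType k) (fD : {lrmorphism T -> D}),
    presentation fD (xyz_rel b c a) /\ is_twist_of (gr f wt1) (gr fD wt1).
Proof.
move=> fP; refine (twisted_algebra (phi := rot') (psi := rot)
  _ _ _ _ _ _ _ _ _ _ fP).
- exact: rot'_monomial.
- exact: rot_monomial.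
- exact: rot'K.
- exact: rotK.
- exact: xyz_rel_hom.
- exact: xyz_rel_hom.
- by move=> r; apply: rot_ideal.
- by move=> r; apply: rot'_ideal.
- by move=> r; apply: tw_rot_ideal.
- by move=> r; apply: tw_rot'_ideal.
Qed.

Variable P : poly_space k.

(* The PBW basis is transported along the twist to the case q = 1. *)
Theorem PBW_basis q ga : q ^+ 3 = 1 -> ga ^+ 3 != 1 ->
  presentation f (xyz_rel 1 q ga) ->
  exists kap Lam, @PBW k T P (xyz_rel 1 q ga) kap Lam.
Proof.
move=> q3 ga3 fP.
have q23 : (q ^+ 2) ^+ 3 = 1 by rewrite -exprM mulnC exprM q3 expr1n.
have qq : q * q ^+ 2 = 1 by rewrite -exprS.
have qq' : q ^+ 2 * q = 1 by rewrite -exprSr.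
have [D [fD [fDP _]]] := twist_diag q3 fP.
have gaq3 : (ga * q) ^+ 3 != 1 by rewrite exprMn q3 mulr1.
have [kap [Lam [hker hsec hhom hcl hcr]]] := PBW_commutative P gaq3 fDP.
have dK := diagK qq; have dK' := diagK qq'.
have twKq := twK (@diag_monomial q) dK dK'.
have twKq' := twK (@diag_monomial (q ^+ 2)) dK' dK.
have h1 := @xyz_rel_hom _ T 1 q ga; have h2 := @xyz_rel_hom _ T 1 1 (ga * q).
have I1 p : ideal (xyz_rel 1 q ga) p -> ideal (xyz_rel 1 1 (ga * q)) (tw (diag q) p).
  apply: tw_ideal => //; first exact: diag_monomial.
    by apply: ideal_morph => r; apply: diag_ideal.
  move=> r /(tw_diag_ideal q3).
  by have -> : q * q ^+ 2 = 1 by ring: q3.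
have I2 p : ideal (xyz_rel 1 1 (ga * q)) p ->
    ideal (xyz_rel 1 q ga) (tw (diag (q ^+ 2)) p).
  apply: tw_ideal => //; first exact: diag_monomial.
    by apply: ideal_morph => r; apply: diag_ideal.
  move=> r /(tw_diag_ideal q23).
  have -> : 1 * (q ^+ 2) ^+ 2 = q by ring: q3.
  by have -> : ga * q * q ^+ 2 = ga by ring: q3.
have I12 p : ideal (xyz_rel 1 q ga) p <-> ideal (xyz_rel 1 1 (ga * q)) (tw (diag q) p).
  by split=> [/I1 //|/I2]; rewrite twKq.
pose kq : {linear T -> P} := kap \o tw (diag q).
pose Lq : {linear P -> T} := tw (diag (q ^+ 2)) \o Lam.
exists kq, Lq; split.
- by move=> p; rewrite I12 -hker.
- by move=> v; rewrite /kq /Lq /= twKq' hsec.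
- by move=> i j l; rewrite /Lq /=; apply: tw_hom; [exact: diag_monomial|exact: hhom].
- move=> p /I12; rewrite tw_var => /hcl Ip; apply/I12.
  rewrite -[tw _ p]dK; apply: ideal_morph Ip => r; exact: diag_ideal.
- move=> p /I12 h; apply/I12/hcr; move: h.
  (* A final x survives the twist unchanged because [diag q] fixes x. *)
  suff -> : tw (diag q) (p * x) = tw (diag q) p * x by [].
  elim/free_ind: p => [|d u v IHu IHv|s]; first by rewrite mul0r !linear0 mul0r.
    by rewrite linl !linearP /= IHu IHv linl.
  elim: s => [|i s IH]; first by rewrite mon0 tw_1 !mul1r
      -[x in LHS]mulr1 tw_var tw_1 rmorph1 mulr1.
  by rewrite mon_cons -mulrA !tw_var IH rmorphM /= diagE mulrA.
Qed.

End TwistsOfA.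
End Automorphisms.

(** * Koszul complexes *)

Section ExactByDimension.
Variables (k : fieldType) (V0 V1 V2 V3 : vectType k).
Variables (L3 : {linear V0 -> V1}) (L2 : {linear V1 -> V2}) (L1 : {linear V2 -> V3}).

(** The Euler characteristic is zero, so exactness at the other three places makes the image of [L3]
    as large as the kernel of [L2] that contains it. *)
Lemma exact_by_dimension :
  injective L3 -> (forall w, exists v, L1 v = w) ->
  (forall v, L1 v = 0 -> exists u, L2 u = v) -> (forall v, L2 (L3 v) = 0) ->
  (dim V0 + dim V2 = dim V1 + dim V3)%N ->
  forall v, L2 v = 0 -> exists u, L3 u = v.
Proof.
move=> inj3 surj1 ex2 L23 dims v v0.
have k3 : lker (linfun L3) == 0%VS.
  by apply/lker0P => u w; rewrite !lfunE; apply: inj3.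
have r3 := limg_ker_dim (linfun L3) fullv.
have r2 := limg_ker_dim (linfun L2) fullv; have r1 := limg_ker_dim (linfun L1) fullv.
rewrite !capfv (eqP k3) dimv0 in r3; rewrite !capfv !dimvf in r1 r2.
have s1 : limg (linfun L1) = fullv.
  apply/eqP; rewrite eqEsubv subvf /=; apply/subvP => w _.
  by have [u <-] := surj1 w; apply/memv_imgP; exists u; rewrite ?memvf ?lfunE.
have s2 : (lker (linfun L1) <= limg (linfun L2))%VS.
  apply/subvP => w; rewrite memv_ker lfunE => /eqP /ex2[u <-].
  by apply/memv_imgP; exists u; rewrite ?memvf ?lfunE.
have s3 : (limg (linfun L3) <= lker (linfun L2))%VS.
  apply/subvP => w /memv_imgP[u _ ->]; rewrite memv_ker !lfunE L23 eqxx //.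
have := dimvS s2; rewrite s1 dimvf in r1 *; rewrite dimvf in r3 => d2.
have e3 : limg (linfun L3) = lker (linfun L2).
  apply/eqP; rewrite eqEdim s3 /=; lia.
have : v \in lker (linfun L2) by rewrite memv_ker lfunE v0.
by rewrite -e3 => /memv_imgP[u _ ->]; exists u; rewrite lfunE.
Qed.

End ExactByDimension.

Section TriangleIndex.

(** Indexes the monomials of degree m - 1 in three variables, whose third exponent is determined by
    the first two; empty for m = 0, in agreement with [gp]. *)
Definition tri m := {ij : 'I_m * 'I_m | (ij.1 + ij.2 < m)%N}.
HB.instance Definition _ m := Finite.on (tri m).

Lemma card_tri m : (#|{: tri m}| * 2 = m * m.+1)%N.
Proof.
have -> : #|{: tri m}| = (\sum_(i < m) (m - i))%N.
  rewrite card_sig -sum1_card big_mkcond /=.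
  rewrite -(pair_bigA _ (fun i j : 'I_m => if (i + j < m)%N then 1%N else 0%N)) /=.
  apply: eq_bigr => i _; rewrite -big_mkcond /=.
  rewrite (eq_bigl (fun j : 'I_m => (j < m - i)%N)); last first.
    by move=> j; rewrite ltn_subRL.
  by rewrite -(big_ord_widen _ (fun=> 1%N)) ?leq_subr // sum1_card card_ord.
elim: m => [|m IH]; first by rewrite big_ord0.
rewrite big_ord_recl subn0 (eq_bigr (fun i : 'I_m => (m - i)%N)); last first.
  by move=> i _; rewrite lift0 subSS.
by rewrite mulnDl IH; lia.
Qed.

End TriangleIndex.

Section Triples.
Variables (R : nzRingType) (V W : lmodType R).

Definition map3 (h : V -> W) (v : V * V * V) : W * W * W :=
  (h v.1.1, h v.1.2, h v.2).

Lemma pair3_eq (u v : V * V * V) :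
  u.1.1 = v.1.1 -> u.1.2 = v.1.2 -> u.2 = v.2 -> u = v.
Proof. by case: u v => [[? ?] ?] [[? ?] ?] /= -> -> ->. Qed.

End Triples.

Section GradedCoordinates.
Variables (k : fieldType) (T : free_algebra k 'I_3) (P : poly_space k).
Variables (S : T -> Prop) (A : algType k) (f : {lrmorphism T -> A}).
Variables (kap : {linear T -> P}) (Lam : {linear P -> T}).
Notation wt1 := (fun _ : 'I_3 => 1%N).
Hypotheses (fP : presentation f S)
  (hS : forall r, S r -> exists e, hom wt1 e r) (pbw : PBW S kap Lam).

Notation gpr := (gpr fP hS).
Notation A3 := (A * A * A)%type.

(* The homogeneous component of degree m - 1; the shift makes A_(-1) = 0
   available. *)
Definition gp (m : nat) : {linear A -> A} := if m is m'.+1 then gpr m' else \0.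

Let pm i j l : P := psX P ^+ i * psY P ^+ j * psZ P ^+ l.
Let tpm m (t : tri m) : P :=
  pm (val t).1 (val t).2 (m.-1 - ((val t).1 + (val t).2)).

Definition coef m (t : tri m) : {linear P -> k^o} :=
  ps_ext P (fun i j l => ([&& i == (val t).1 :> nat, j == (val t).2 :> nat
    & l == m.-1 - ((val t).1 + (val t).2)])%N%:R : k^o).

Lemma coef_tpm m (s t : tri m) : coef t (tpm s) = (s == t)%:R.
Proof.
rewrite /tpm /pm [LHS]ps_extE; congr (_%:R); congr nat_of_bool.
rewrite -val_eqE; case: s t => [[i j] ij] [[i' j'] ij'] /=.
rewrite xpair_eqE -!val_eqE /=.
by case: eqP => [->|] //=; case: eqP => [->|] //=; rewrite eqxx.
Qed.

Lemma pres_kap : {kA : {linear A -> P} | forall p, kA (f p) = kap p}.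
Proof. by apply: (descend fP) => p /(PBW_ker pbw). Qed.

Lemma pres_Lam p : f (Lam (kap p)) = f p.
Proof.
apply/eqP; rewrite -subr_eq0 -linearB; apply/eqP/(pres_ker fP)/(PBW_ker pbw).
by rewrite linearB /= (PBW_sec pbw) subrr.
Qed.

Definition gspace m : vectType k := {ffun tri m -> k^o}.

Lemma dim_gspace m : (dim (gspace m) * 2 = m * m.+1)%N.
Proof. by rewrite -card_tri /dim /= muln1. Qed.

Definition gemb m (v : gspace m) : A := \sum_t (v t : k) *: f (Lam (tpm t)).

Fact gemb_is_linear m : linear (@gemb m).
Proof.
move=> d u v; rewrite /gemb scaler_sumr -big_split; apply: eq_bigr => t _.
by rewrite !ffunE scalerA scalerDl.
Qed.
HB.instance Definition _ m :=
  GRing.isLinear.Build k (gspace m) A _ (@gemb m) (@gemb_is_linear m).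

Definition gco m (a : A) : gspace m := [ffun t => coef t (sval pres_kap a)].

Fact gco_is_linear m : linear (@gco m).
Proof. by move=> d u v; apply/ffunP => t; rewrite !ffunE !linearP. Qed.
HB.instance Definition _ m :=
  GRing.isLinear.Build k A (gspace m) _ (@gco m) (@gco_is_linear m).

Lemma gembK m : cancel (@gemb m) (@gco m).
Proof.
move=> v; apply/ffunP => t; rewrite ffunE /gemb !linear_sum (bigD1 t) //=.
rewrite !linearZ /= (svalP pres_kap) (PBW_sec pbw) coef_tpm eqxx big1 => [|s st].
  by rewrite addr0; exact: mulr1.
rewrite !linearZ /= (svalP pres_kap) (PBW_sec pbw) coef_tpm (negPf st).
exact: mulr0.
Qed.

(** A basis monomial of the right degree is its own expansion, and one of any other degree has only
    zero coordinates. So expanding in degree m - 1 is projecting. *)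
Lemma gcoK m a : gemb (gco m a) = gp m a.
Proof.
have [p <-] := pres_surj fP a; rewrite -pres_Lam.
elim/ps_ind: (kap p) => [|d u v IHu IHv|i j l]; first by rewrite !linear0.
  by rewrite !linearP /= IHu IHv.
rewrite -/(pm i j l) /gemb.
have E t : gco m (f (Lam (pm i j l))) t = coef t (pm i j l).
  by rewrite ffunE (svalP pres_kap) (PBW_sec pbw).
under eq_bigr do rewrite E.
have hg : gr f wt1 (i + j + l)%N (f (Lam (pm i j l))).
  by exists (Lam (pm i j l)) => //; exact: (PBW_hom pbw).
have cE (t : tri m) : coef t (pm i j l) = ([&& i == (val t).1 :> nat, j == (val t).2 :> nat
    & l == m.-1 - ((val t).1 + (val t).2)])%N%:R by rewrite /pm [LHS]ps_extE.
have [ijl|ijl] := eqVneq (i + j + l).+1 m; last first.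
  rewrite big1 => [|t _].
    case: m ijl {E cE} => [|m] ijl; first by [].
    by rewrite /gp (gpr_id _ _ _ hg) -eqSS (negPf ijl).
  rewrite cE; case: and3P => [[/eqP it /eqP jt /eqP lt]|_]; last by rewrite scale0r.
  by case/eqP: ijl; rewrite lt it jt; case: (val t) (valP t) => i1 j1 /=; lia.
subst m; rewrite /gp (gpr_id _ _ _ hg) eqxx.
have ilt : (i < (i + j + l).+1)%N by lia.
have jlt : (j < (i + j + l).+1)%N by lia.
have ijlt : (i + j < (i + j + l).+1)%N by lia.
pose t0 : tri (i + j + l).+1 := exist _ (Ordinal ilt, Ordinal jlt) ijlt.
have t0E : tpm t0 = pm i j l by rewrite /tpm /=; congr pm; lia.
rewrite (bigD1 t0) //= -t0E coef_tpm eqxx scale1r big1 ?addr0 // => t tt0.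
by rewrite coef_tpm eq_sym (negPf tt0) scale0r.
Qed.

Lemma gp_gp m n a : gp m (gp n a) = if m == n then gp n a else 0.
Proof.
case: m n => [|m] [|n] //=; first by rewrite linear0.
by rewrite (gpr_id _ _ _ (gr_gpr fP hS n a)) eqSS eq_sym.
Qed.

Lemma gp_gemb m (v : gspace m) : gp m (gemb v) = gemb v.
Proof. by rewrite -gcoK gembK. Qed.

Section Koszul.
Variables (d3 : {linear A -> A3}) (d2 : {linear A3 -> A3})
  (d1 : {linear A3 -> A}).
Hypotheses (gd3 : forall m a, map3 (gp m.+1) (d3 a) = d3 (gp m a))
  (gd2 : forall m b, map3 (gp m.+1) (d2 b) = d2 (map3 (gp m) b))
  (gd1 : forall m b, gp m.+1 (d1 b) = d1 (map3 (gp m) b)).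
Hypotheses (inj3 : forall a, d3 a = 0 -> a = 0) (d23 : forall a, d2 (d3 a) = 0)
  (ex1 : forall b, d1 b = 0 -> exists c, d2 c = b)
  (ex0 : forall m a, exists b, d1 b = gp m.+2 a).

Let emb3 m (v : gspace m * gspace m * gspace m) : A3 := map3 (@gemb m) v.
Let co3 m (a : A3) : gspace m * gspace m * gspace m := map3 (@gco m) a.
Let emb3_lin m : linear (@emb3 m).
Proof. by move=> d u v; apply: pair3_eq => /=; rewrite linearP. Qed.
Let co3_lin m : linear (@co3 m).
Proof. by move=> d u v; apply: pair3_eq => /=; rewrite linearP. Qed.
Let co3K m a : emb3 (co3 m a) = map3 (gp m) a.
Proof. by apply: pair3_eq => /=; rewrite gcoK. Qed.
Let emb3K m (v : gspace m * gspace m * gspace m) : co3 m (emb3 v) = v.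
Proof. by apply: pair3_eq => /=; rewrite gembK. Qed.
Let gp3_emb3 m (v : gspace m * gspace m * gspace m) : map3 (gp m) (emb3 v) = emb3 v.
Proof. by apply: pair3_eq => /=; rewrite gp_gemb. Qed.

Lemma koszul_graded m b : d2 (map3 (gp m.+1) b) = 0 ->
  exists a, d3 (gp m a) = map3 (gp m.+1) b.
Proof.
pose L3 v := co3 m.+1 (d3 (@gemb m v)).
pose L2 v := co3 m.+2 (d2 (@emb3 m.+1 v)).
pose L1 v := gco m.+3 (d1 (@emb3 m.+2 v)).
have L3l : linear L3 by move=> d u v; rewrite /L3 !linearP co3_lin.
have L2l : linear L2 by move=> d u v; rewrite /L2 emb3_lin linearP co3_lin.
have L1l : linear L1 by move=> d u v; rewrite /L1 emb3_lin !linearP.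
pose L3L : {linear gspace m -> (gspace m.+1 * gspace m.+1 * gspace m.+1)%type} :=
  HB.pack L3 (GRing.isLinear.Build _ _ _ _ L3 L3l).
pose L2L : {linear (gspace m.+1 * gspace m.+1 * gspace m.+1)%type ->
    (gspace m.+2 * gspace m.+2 * gspace m.+2)%type} :=
  HB.pack L2 (GRing.isLinear.Build _ _ _ _ L2 L2l).
pose L1L : {linear (gspace m.+2 * gspace m.+2 * gspace m.+2)%type -> gspace m.+3} :=
  HB.pack L1 (GRing.isLinear.Build _ _ _ _ L1 L1l).
have eL3 v : emb3 (L3 v) = d3 (gemb v) by rewrite /L3 co3K gd3 gp_gemb.
have eL2 v : emb3 (L2 v) = d2 (emb3 v) by rewrite /L2 co3K gd2 gp3_emb3.
have eL1 v : gemb (L1 v) = d1 (emb3 v) by rewrite /L1 gcoK gd1 gp3_emb3.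
have e30 n v : @emb3 n v = 0 -> v = 0.
  by move=> e0; rewrite -[v]emb3K e0; apply: pair3_eq; exact: linear0.
have e0 n v : @gemb n v = 0 -> v = 0 by move=> e0; rewrite -[v]gembK e0 linear0.
have : forall v, L2L v = 0 -> exists u, L3L u = v.
  apply: (@exact_by_dimension _ _ _ _ _ L3L L2L L1L).
  - apply: raddf_inj => v /= /(congr1 (@emb3 _)); rewrite eL3.
    have -> : @emb3 m.+1 0 = 0 by apply: pair3_eq; exact: linear0.
    by move/inj3/e0.
  - move=> w; have [b' b'w] := ex0 m.+1 (gemb w).
    exists (co3 m.+2 b'); apply: (can_inj (@gembK _)).
    by rewrite /= eL1 co3K -gd1 b'w gp_gemb gp_gemb.
  - move=> v /(congr1 (@gemb _)); rewrite linear0 /= eL1 => /ex1[c cv].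
    exists (co3 m.+1 c); apply: (can_inj (@emb3K _)).
    by rewrite /= eL2 co3K -gd2 cv gp3_emb3.
  - by move=> v; apply: e30; rewrite /= eL2 eL3 d23.
  (* The dimension n (n + 1) / 2 is quadratic in n, so the alternating sum with weights 1, 3, 3, 1,
     a third difference, vanishes. *)
  - have E n : dim (gspace n * gspace n * gspace n)%type =
      (dim (gspace n) + dim (gspace n) + dim (gspace n))%N by [].
    rewrite !E; move: (dim_gspace m) (dim_gspace m.+1) (dim_gspace m.+2).
    move: (dim_gspace m.+3).
    move: (dim (gspace m)) (dim (gspace m.+1)) (dim (gspace m.+2)) (dim (gspace m.+3)).
    by move=> n0 n1 n2 n3; lia.
move=> ex2 b0; have [|u uv] := ex2 (co3 m.+1 b).
  by apply: e30; rewrite /= eL2 co3K b0.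
by exists (gemb u); rewrite gp_gemb -eL3 (uv : L3 u = _) co3K.
Qed.

Lemma koszul_exact b : d2 b = 0 -> exists a, d3 a = b.
Proof.
move=> b0.
have bm m : exists a, d3 a = map3 (gp m.+1) b.
  have [|a <-] := @koszul_graded m b; last by exists (gp m a).
  by rewrite -gd2 b0; apply: pair3_eq; exact: linear0.
have sN N : exists a, d3 a = \sum_(i < N) map3 (gp i.+1) b.
  elim: N => [|N [a aN]]; first by exists 0; rewrite big_ord0 linear0.
  have [a' a'N] := bm N; exists (a + a').
  by rewrite linearD big_ord_recr /= aN a'N.
have [N0 h0] := gpr_sum fP hS b.1.1; have [N1 h1] := gpr_sum fP hS b.1.2.
have [N2 h2] := gpr_sum fP hS b.2.
have [a aN] := sN (maxn N0 (maxn N1 N2)); exists a; rewrite aN.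
have p11 : {morph (fun v : A3 => v.1.1) : u v / u + v} by [].
have p12 : {morph (fun v : A3 => v.1.2) : u v / u + v} by [].
have p2 : {morph (fun v : A3 => v.2) : u v / u + v} by [].
apply: pair3_eq.
- by rewrite (big_morph _ p11 (erefl _)) /= h0 // leq_maxl.
- by rewrite (big_morph _ p12 (erefl _)) /= h1 // leq_max leq_maxl orbT.
- by rewrite (big_morph _ p2 (erefl _)) /= h2 // !leq_max leqnn !orbT.
Qed.

End Koszul.
End GradedCoordinates.

Section Augmentation.
Variables (k : fieldType) (T : free_algebra k 'I_3) (S : T -> Prop).
Variables (A : algType k) (f : {lrmorphism T -> A}).
Hypotheses (fP : presentation f S)
  (hS : forall r, S r -> hom (fun=> 1%N) 2 r).

Definition counit : {linear T -> k^o} :=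
  lext T (fun s => (if s is [::] then 1 else 0) : k^o).

Lemma counit_mon s : counit (mon T s) = (s == [::])%:R.
Proof. by rewrite [LHS]lext_mon; case: s. Qed.

Lemma counitM p q : counit (p * q) = counit p * counit q.
Proof.
elim/free_ind: p => [|c u v IHu IHv|s]; first by rewrite mul0r !linear0 mul0r.
  by rewrite linl !linearP /= IHu IHv mulrDl -scalerAl.
elim/free_ind: q => [|c u v IHu IHv|t]; first by rewrite mulr0 !linear0 mulr0.
  by rewrite linr !linearP /= IHu IHv mulrDr -scalerAr.
by rewrite -mon_cat !counit_mon; case: s t => [|? ?] [|? ?]; rewrite ?mulr1 ?mulr0.
Qed.

Lemma counit_hom d p : hom (fun=> 1%N) d.+1 p -> counit p = 0.
Proof.
elim/hom_ind => [|c u v IHu IHv|s]; first exact: linear0.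
  by rewrite linearP /= IHu IHv scaler0 addr0.
by rewrite counit_mon; case: s => //; rewrite /wgt big_nil.
Qed.

Lemma counit_ideal p : ideal S p -> counit p = 0.
Proof.
elim/ideal_words_ind => [|c u v IHu IHv|s r t /hS /counit_hom r0].
- exact: linear0.
- by rewrite linearP /= IHu IHv scaler0 addr0.
by rewrite !counitM r0 mulr0 mul0r.
Qed.

Definition aug : {linear A -> k^o} := sval (descend fP counit_ideal).

Lemma augE p : aug (f p) = counit p.
Proof. exact: (svalP (descend fP counit_ideal)). Qed.

Lemma augM u v : aug (u * v) = aug u * aug v.
Proof.
have [p <-] := pres_surj fP u; have [q <-] := pres_surj fP v.
by rewrite -rmorphM !augE counitM.
Qed.

Lemma aug1 : aug 1 = 1.
Proof. by rewrite -(rmorph1 f) augE -mon0 counit_mon. Qed.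

Lemma aug_alg (c : k) : aug c%:A = c.
Proof. by rewrite linearZ /= aug1; apply: mulr1. Qed.

Lemma aug_var i : aug (f (var T i)) = 0.
Proof. by rewrite augE counit_mon. Qed.

Lemma aug_gr d a : gr f (fun=> 1%N) d.+1 a -> aug a = 0.
Proof. by case=> p hp <-; rewrite augE; apply: counit_hom hp. Qed.

End Augmentation.

(** * The Koszul complexes of left and of right modules *)

Section XYZAlgebra.
Variables (k : fieldType) (T : free_algebra k 'I_3) (P : poly_space k) (q ga : k).
Hypotheses (q3 : q ^+ 3 = 1) (ga3 : ga ^+ 3 != 1).
Notation S := (xyz_rel (T := T) 1 q ga).
Variables (A : algType k) (f : {lrmorphism T -> A}).
Hypothesis fP : presentation f S.
Notation A3 := (A * A * A)%type.
Notation x := (f (var T o0)).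
Notation y := (f (var T o1)).
Notation z := (f (var T o2)).

Lemma xyz_hom2 a b c r : xyz_rel (T := T) a b c r -> hom (fun=> 1%N) 2 r.
Proof.
have h i j : hom (fun=> 1%N) 2 (var T i * var T j).
  exact: (homM (d := 1) (e := 1) (hom_var _ _ _) (hom_var _ _ _)).
by case=> ->; do ![apply: homD|apply: homZ|exact: h].
Qed.

Lemma skew_relations :
  [/\ skew_relation q ga x y z, skew_relation q ga y z x & skew_relation q ga z x y].
Proof.
have h p : S p -> f p = 0 by move=> Sp; apply/(pres_ker fP)/ideal_gen.
by split; [have := h _ (Or31 _ _ erefl)|have := h _ (Or32 _ _ erefl)
  |have := h _ (Or33 _ _ erefl)];
  rewrite /skew_relation !linearD !linearZ /= expr2 !rmorphM /= !scale1r.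
Qed.

Notation hS := (@xyz_rel_hom k T 1 q ga).
Notation gp := (gp fP hS).
Notation aug := (aug fP (@xyz_hom2 1 q ga)).

(** For m = 0 this says that a multiple of a variable has no component of degree 0. *)
Lemma gp_mulr i m a : gp m.+1 (a * f (var T i)) = gp m a * f (var T i).
Proof.
case: m => [|m] /=; last first.
  rewrite -(addn1 m); exact: (gprMr fP hS m a (gr_var f (fun=> 1%N) i)).
rewrite mul0r; have [p <-] := pres_surj fP a.
rewrite -rmorphM gprE; elim/free_ind: p => [|c u v IHu IHv|s].
- by rewrite mul0r !linear0.
- by rewrite linl !linearP /= IHu IHv scaler0 addr0.
by rewrite -mon_rcons comp_mon /wgt -cats1 big_cat big_seq1 /= addn1 linear0.
Qed.

Lemma gp_mull i m a : gp m.+1 (f (var T i) * a) = f (var T i) * gp m a.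
Proof.
case: m => [|m] /=; last first.
  rewrite -(add1n m); exact: (gprMl fP hS m a (gr_var f (fun=> 1%N) i)).
rewrite mulr0; have [p <-] := pres_surj fP a.
rewrite -rmorphM gprE; elim/free_ind: p => [|c u v IHu IHv|s].
- by rewrite mulr0 !linear0.
- by rewrite linr !linearP /= IHu IHv scaler0 addr0.
by rewrite -mon_cons comp_mon /wgt big_cons linear0.
Qed.

Lemma aug_gp m a : aug (gp m.+2 a) = 0.
Proof. by rewrite (aug_gr _ _ (d := m)) //; apply: gr_gpr. Qed.

Lemma mulx_inj a : x * a = 0 -> a = 0.
Proof.
have [kap [Lam pbw]] := PBW_basis P q3 ga3 fP.
have [p <-] := pres_surj fP a; rewrite -rmorphM => /(pres_ker fP) /(PBW_cancell pbw).
by move/(pres_ker fP).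
Qed.

Lemma mulrx_inj a : a * x = 0 -> a = 0.
Proof.
have [kap [Lam pbw]] := PBW_basis P q3 ga3 fP.
have [p <-] := pres_surj fP a; rewrite -rmorphM => /(pres_ker fP) /(PBW_cancelr pbw).
by move/(pres_ker fP).
Qed.

Section LeftModules.

Definition dL3 (a : A) : A3 := (a * x, a * y, a * z).
(** The entries of b are coefficients of the relations headed yz, zx and xy, in this order. The
    components collect what is left of them when a last letter x, y or z is removed. *)
Definition dL2 (b : A3) : A3 :=
  (ga *: (b.1.1 * x) + b.1.2 * z + q *: (b.2 * y),
   q *: (b.1.1 * z) + ga *: (b.1.2 * y) + b.2 * x,
   b.1.1 * y + q *: (b.1.2 * x) + ga *: (b.2 * z)).
Definition dL1 (c : A3) : A := c.1.1 * x + c.1.2 * y + c.2 * z.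

Fact dL3_linear : linear dL3.
Proof. by move=> d u v; apply: pair3_eq => /=; rewrite linl. Qed.
Fact dL2_linear : linear dL2.
Proof.
by move=> d u v; apply: pair3_eq => /=; rewrite !linl; lin_comb A; ring.
Qed.
Fact dL1_linear : linear dL1.
Proof. by move=> d u v; rewrite /dL1 /= !linl; lin_comb A; ring. Qed.
HB.instance Definition _ := GRing.isLinear.Build k A A3 _ dL3 dL3_linear.
HB.instance Definition _ := GRing.isLinear.Build k A3 A3 _ dL2 dL2_linear.
HB.instance Definition _ := GRing.isLinear.Build k A3 A _ dL1 dL1_linear.

Lemma dL23 a : dL2 (dL3 a) = 0.
Proof.
have [hxy hyz hzx] := skew_relations.
have h u : u = 0 -> a * u = 0 by move=> ->; rewrite mulr0.
move: (h _ hyz) (h _ hzx) (h _ hxy).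
rewrite !mulrDr -!scalerAr !mulrA => h0 h1 h2.
apply: pair3_eq => /=; [rewrite -[RHS]h0|rewrite -[RHS]h1|rewrite -[RHS]h2];
  by lin_comb A; ring.
Qed.

(** Writing p as a constant plus a sum of terms p_j x_j, this is the image of p_j in A. *)
Definition partial_r (j : 'I_3) : {linear T -> A} := lext T (fun s =>
  if rev s is i :: w then (if i == j then f (mon T (rev w)) else 0) else 0).

Lemma partial_r_var j p i : partial_r j (p * var T i) = if i == j then f p else 0.
Proof.
elim/free_ind: p => [|c u v IHu IHv|s].
- by rewrite mul0r !linear0 if_same.
- by rewrite linl !linearP /= IHu IHv; case: eqP; rewrite ?scaler0 ?addr0.
by rewrite -mon_rcons [LHS]lext_mon rev_rcons revK.
Qed.

Lemma dL1_exact c : dL1 c = 0 -> exists b, dL2 b = c.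
Proof.
pose pr p : A3 := (partial_r o0 p, partial_r o1 p, partial_r o2 p).
have prv p i : pr (p * var T i) = ord3_fun (f p, 0, 0) (0, f p, 0) (0, 0, f p) i.
  by rewrite /pr !partial_r_var; case: (ord3P i) => ->; rewrite ord3_funE !ord3_eqE.
have prl d u v : pr (d *: u + v) = d *: pr u + pr v.
  by apply: pair3_eq; rewrite /= linearP.
have prD u v : pr (u + v) = pr u + pr v by rewrite -{1}[u]scale1r prl scale1r.
have prZ d u : pr (d *: u) = d *: pr u by apply: pair3_eq; rewrite /= linearZ.
have key p : ideal S p -> exists b, dL2 b = pr p.
  elim/ideal_words_ind => [|d u v [b1 h1] [b2 h2]|s r t Sr].
  - by exists 0; rewrite linear0; apply: pair3_eq; rewrite /= linear0.
  - by exists (d *: b1 + b2); rewrite linearP /= h1 h2 prl.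
  (* If letters follow the relation, removing the last one leaves the relation inside, and the
     result is zero in A. Only a relation at the right end contributes, by its row of [dL2]. *)
  case/lastP: t => [|t i]; last first.
    have r0 : f (mon T s * r * mon T t) = 0.
      by apply/(pres_ker fP)/ideal_mul/ideal_gen.
    exists 0; rewrite linear0 mon_rcons mulrA prv r0.
    by case: (ord3P i) => ->; rewrite ord3_funE.
  rewrite mon0 mulr1.
  case: Sr => ->; rewrite expr2 !mulrDr -!scalerAr !mulrA !prD !prZ !prv !ord3_funE.
  - exists (0, 0, f (mon T s)); apply: pair3_eq;
      by rewrite /= !rmorphM /= ?mul0r; lin_comb A; ring.
  - exists (f (mon T s), 0, 0); apply: pair3_eq;
      by rewrite /= !rmorphM /= ?mul0r; lin_comb A; ring.
  - exists (0, f (mon T s), 0); apply: pair3_eq;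
      by rewrite /= !rmorphM /= ?mul0r; lin_comb A; ring.
move=> c0; have [p0 e0] := pres_surj fP c.1.1; have [p1 e1] := pres_surj fP c.1.2.
have [p2 e2] := pres_surj fP c.2.
have [|b bE] := key (p0 * var T o0 + p1 * var T o1 + p2 * var T o2).
  by apply/(pres_ker fP); rewrite !rmorphD !rmorphM /= e0 e1 e2.
exists b; rewrite bE !prD !prv !ord3_funE e0 e1 e2.
by apply: pair3_eq; rewrite /= ?addr0 ?add0r.
Qed.

Lemma aug_dL1 a : exists c, a = (aug a)%:A + dL1 c.
Proof.
elim/(pres_ind fP): a => [|d u v [c1 e1] [c2 e2]|s].
- by exists 0; rewrite !linear0 scale0r addr0.
- exists (d *: c1 + c2).
  have -> : aug (d *: u + v) = d * aug u + aug v by rewrite linearP.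
  by rewrite linearP /= {1}e1 {1}e2 scalerDr scalerDl -scalerA addrACA.
case/lastP: s => [|s i].
  by exists 0; rewrite linear0 addr0 mon0 rmorph1 aug1 scale1r.
exists (ord3_fun (f (mon T s), 0, 0) (0, f (mon T s), 0) (0, 0, f (mon T s)) i).
rewrite mon_rcons rmorphM augM aug_var mulr0 scale0r add0r.
by case: (ord3P i) => ->; rewrite ord3_funE /dL1 /= !mul0r ?addr0 ?add0r.
Qed.

Lemma gp_dL3 m a : map3 (gp m.+1) (dL3 a) = dL3 (gp m a).
Proof. by apply: pair3_eq; rewrite /= gp_mulr. Qed.

Lemma gp_dL2 m b : map3 (gp m.+1) (dL2 b) = dL2 (map3 (gp m) b).
Proof. by apply: pair3_eq; rewrite /= !linearD !linearZ /= !gp_mulr. Qed.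

Lemma gp_dL1 m c : gp m.+1 (dL1 c) = dL1 (map3 (gp m) c).
Proof. by rewrite /dL1 !linearD /= !gp_mulr. Qed.

(** Kept degree by degree: the resolution of a general module consults it one filtration degree at a
    time. *)
Lemma dL2_exact_graded m b : dL2 (map3 (gp m.+1) b) = 0 ->
  exists a, dL3 (gp m a) = map3 (gp m.+1) b.
Proof.
have [kap [Lam pbw]] := PBW_basis P q3 ga3 fP.
apply: (koszul_graded pbw gp_dL3 gp_dL2 gp_dL1 _ dL23 dL1_exact) => [a|n a].
  by case=> /mulrx_inj.
have [c ac] := aug_dL1 (gp n.+2 a); exists c.
by rewrite ac aug_gp scale0r add0r.
Qed.

End LeftModules.

Section RightModules.

Definition dR3 (a : A) : A3 := (x * a, y * a, z * a).
(** The same matrix as in [dL2], now acting from the other side: its columns are the relations with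
    a first letter removed. *)
Definition dR2 (b : A3) : A3 :=
  (ga *: (x * b.1.1) + q *: (z * b.1.2) + y * b.2,
   z * b.1.1 + ga *: (y * b.1.2) + q *: (x * b.2),
   q *: (y * b.1.1) + x * b.1.2 + ga *: (z * b.2)).
Definition dR1 (c : A3) : A := x * c.1.1 + y * c.1.2 + z * c.2.

Fact dR3_linear : linear dR3.
Proof. by move=> d u v; apply: pair3_eq => /=; rewrite linr. Qed.
Fact dR2_linear : linear dR2.
Proof.
by move=> d u v; apply: pair3_eq => /=; rewrite !linr; lin_comb A; ring.
Qed.
Fact dR1_linear : linear dR1.
Proof. by move=> d u v; rewrite /dR1 /= !linr; lin_comb A; ring. Qed.
HB.instance Definition _ := GRing.isLinear.Build k A A3 _ dR3 dR3_linear.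
HB.instance Definition _ := GRing.isLinear.Build k A3 A3 _ dR2 dR2_linear.
HB.instance Definition _ := GRing.isLinear.Build k A3 A _ dR1 dR1_linear.

Lemma dR23 a : dR2 (dR3 a) = 0.
Proof.
have [hxy hyz hzx] := skew_relations.
have h u : u = 0 -> u * a = 0 by move=> ->; rewrite mul0r.
move: (h _ hyz) (h _ hzx) (h _ hxy).
rewrite !mulrDl -!scalerAl -!mulrA => h0 h1 h2.
apply: pair3_eq => /=; [rewrite -[RHS]h0|rewrite -[RHS]h1|rewrite -[RHS]h2];
  by lin_comb A; ring.
Qed.

Definition partial_l (j : 'I_3) : {linear T -> A} := lext T (fun s =>
  if s is i :: w then (if i == j then f (mon T w) else 0) else 0).

Lemma partial_l_var j p i : partial_l j (var T i * p) = if i == j then f p else 0.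
Proof.
elim/free_ind: p => [|c u v IHu IHv|s].
- by rewrite mulr0 !linear0 if_same.
- by rewrite linr !linearP /= IHu IHv; case: eqP; rewrite ?scaler0 ?addr0.
by rewrite -mon_cons [LHS]lext_mon.
Qed.

Lemma dR1_exact c : dR1 c = 0 -> exists b, dR2 b = c.
Proof.
pose pr p : A3 := (partial_l o0 p, partial_l o1 p, partial_l o2 p).
have prv p i : pr (var T i * p) = ord3_fun (f p, 0, 0) (0, f p, 0) (0, 0, f p) i.
  by rewrite /pr !partial_l_var; case: (ord3P i) => ->; rewrite ord3_funE !ord3_eqE.
have prl d u v : pr (d *: u + v) = d *: pr u + pr v.
  by apply: pair3_eq; rewrite /= linearP.
have prD u v : pr (u + v) = pr u + pr v by rewrite -{1}[u]scale1r prl scale1r.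
have prZ d u : pr (d *: u) = d *: pr u by apply: pair3_eq; rewrite /= linearZ.
have key p : ideal S p -> exists b, dR2 b = pr p.
  elim/ideal_words_ind => [|d u v [b1 h1] [b2 h2]|s r t Sr].
  - by exists 0; rewrite linear0; apply: pair3_eq; rewrite /= linear0.
  - by exists (d *: b1 + b2); rewrite linearP /= h1 h2 prl.
  case: s => [|i s]; last first.
    have r0 : f (mon T s * r * mon T t) = 0.
      by apply/(pres_ker fP)/ideal_mul/ideal_gen.
    exists 0; rewrite linear0 mon_cons -!mulrA prv mulrA r0.
    by case: (ord3P i) => ->; rewrite ord3_funE.
  rewrite mon0 mul1r.
  case: Sr => ->; rewrite expr2 !mulrDl -!scalerAl -!mulrA !prD !prZ !prv !ord3_funE.
  - exists (0, 0, f (mon T t)); apply: pair3_eq;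
      by rewrite /= !rmorphM /= ?mulr0; lin_comb A; ring.
  - exists (f (mon T t), 0, 0); apply: pair3_eq;
      by rewrite /= !rmorphM /= ?mulr0; lin_comb A; ring.
  - exists (0, f (mon T t), 0); apply: pair3_eq;
      by rewrite /= !rmorphM /= ?mulr0; lin_comb A; ring.
move=> c0; have [p0 e0] := pres_surj fP c.1.1; have [p1 e1] := pres_surj fP c.1.2.
have [p2 e2] := pres_surj fP c.2.
have [|b bE] := key (var T o0 * p0 + var T o1 * p1 + var T o2 * p2).
  by apply/(pres_ker fP); rewrite !rmorphD !rmorphM /= e0 e1 e2.
exists b; rewrite bE !prD !prv !ord3_funE e0 e1 e2.
by apply: pair3_eq; rewrite /= ?addr0 ?add0r.
Qed.

Lemma aug_dR1 a : exists c, a = (aug a)%:A + dR1 c.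
Proof.
elim/(pres_ind fP): a => [|d u v [c1 e1] [c2 e2]|s].
- by exists 0; rewrite !linear0 scale0r addr0.
- exists (d *: c1 + c2).
  have -> : aug (d *: u + v) = d * aug u + aug v by rewrite linearP.
  by rewrite linearP /= {1}e1 {1}e2 scalerDr scalerDl -scalerA addrACA.
case: s => [|i s].
  by exists 0; rewrite linear0 addr0 mon0 rmorph1 aug1 scale1r.
exists (ord3_fun (f (mon T s), 0, 0) (0, f (mon T s), 0) (0, 0, f (mon T s)) i).
rewrite mon_cons rmorphM augM aug_var mul0r scale0r add0r.
by case: (ord3P i) => ->; rewrite ord3_funE /dR1 /= !mulr0 ?addr0 ?add0r.
Qed.

Lemma gp_dR3 m a : map3 (gp m.+1) (dR3 a) = dR3 (gp m a).
Proof. by apply: pair3_eq; rewrite /= gp_mull. Qed.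

Lemma gp_dR2 m b : map3 (gp m.+1) (dR2 b) = dR2 (map3 (gp m) b).
Proof. by apply: pair3_eq; rewrite /= !linearD !linearZ /= !gp_mull. Qed.

Lemma gp_dR1 m c : gp m.+1 (dR1 c) = dR1 (map3 (gp m) c).
Proof. by rewrite /dR1 !linearD /= !gp_mull. Qed.

Lemma dR2_exact b : dR2 b = 0 -> exists a, dR3 a = b.
Proof.
have [kap [Lam pbw]] := PBW_basis P q3 ga3 fP.
apply: (koszul_exact pbw gp_dR3 gp_dR2 gp_dR1 _ dR23 dR1_exact) => [a|m a].
  by case=> /mulx_inj.
have [c ac] := aug_dR1 (gp m.+2 a); exists c.
by rewrite ac aug_gp scale0r add0r.
Qed.

End RightModules.
End XYZAlgebra.

(** * Bases and resolutions of modules *)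

Section HamelBasis.
Variables (k : fieldType) (V : lmodType k).

Definition supported (S : set V) (p : {malg k[V]}) := forall v, v \in msupp p -> S v.
Definition independent (S : set V) :=
  forall p : {malg k[V]}, supported S p -> mlin id p = 0 -> p = 0.

Lemma maximal_independent : exists S : set V, independent S /\
  forall v, exists p : {malg k[V]}, supported S p /\ mlin id p = v.
Proof.
have [F Find Ftot|S [Sind Smax]] := @Zorn_bigcup V independent.
  move=> p Fp p0.
  have [p_0|[X FX Xp]] : msupp p = fset0 \/ exists2 X, F X & supported X p.
  (* A finite set covered by a chain lies in one member. The empty list is a separate case because
     the chain itself may be empty. *)
  - have chain (s : seq V) : (forall v, v \in s -> (\bigcup_(X in F) X)%classic v) ->
        s = [::] \/ exists2 X, F X & forall v, v \in s -> X v.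
      elim: s => [|v s IH] vs; [by left|right].
      have [X FX Xv] := vs v (mem_head _ _).
      have [w ws|->|[Y FY Ys]] := IH; first by apply: vs; rewrite inE ws orbT.
        by exists X => // w; rewrite inE => /eqP->.
      have [XY|YX] := Ftot X Y FX FY.
        by exists Y => // w; rewrite inE => /predU1P[->|/Ys //]; apply: XY.
      by exists X => // w; rewrite inE => /predU1P[-> //|/Ys]; apply: YX.
    have [s0|] := chain (msupp p) Fp; last by right.
    left; apply/fsetP => v; rewrite in_fset0; apply/negP => vp.
    by have : v \in enum_fset (msupp p) by []; rewrite s0.
  - by apply/malgP => v; rewrite mcoeff0 mcoeff_outdom // p_0 in_fset0.
  - exact: Find FX _ Xp p0.
exists S; split=> // v; apply: contrapT => nv.
pose S' : set V := fun w => S w \/ w = v.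
have Sv : ~ S v.
  move=> Sv; apply: nv; exists << v >>; rewrite mlin1; split=> // w.
  by rewrite msuppU oner_eq0 in_fset1 => /eqP->.
apply: (Smax S'); first by split; [move=> w; left|move=> /(_ v) h; apply/Sv/h; right].
move=> p Sp p0; pose p' := p - << p@_v *g v >>.
have S'p : supported S p'.
  move=> w; rewrite -mcoeff_neq0 mcoeffB mcoeffU.
  have [<-|vw] := eqVneq v w; first by rewrite subrr eqxx.
  rewrite subr0 mcoeff_neq0 => /Sp[//|wv].
  by rewrite wv eqxx in vw.
have p'v : mlin id p' = - (p@_v *: v) by rewrite linearB /= p0 mlinU sub0r.
have [c0|c0] := eqVneq (p@_v) 0.
  have pp' : p = p' by rewrite /p' c0 monalgU0 subr0.
  by rewrite pp'; apply: Sind => //; rewrite p'v c0 scale0r oppr0.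
(* The dependence relation is solved for v, whose coefficient is nonzero. *)
case: nv; exists (- (p@_v)^-1 *: p'); split.
  by move=> w /(fsubsetP (msuppZ_le _ _)) /S'p.
by rewrite linearZ /= p'v scaleNr scalerN opprK scalerA mulVf // scale1r.
Qed.

Theorem hamel_basis : exists (B : choiceType) (e : B -> V)
    (co : {linear V -> {malg k[B]}}),
  (forall v, mlin e (co v) = v) /\ (forall b, co (e b) = << b >>).
Proof.
have [S [Sind Sspan]] := maximal_independent.
pose B : choiceType := {v : V | `[< S v >]}.
pose e : B -> V := val.
pose inc : {linear {malg k[B]} -> {malg k[V]}} := mlin (fun b : B => << val b >>).
have incE (p : {malg k[B]}) b : (inc p)@_(val b) = p@_b.
  elim/malg_lin_ind: p => [|c u v IHu IHv|b']; first by rewrite linear0 !mcoeff0.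
    by rewrite linearP !mcoeffD !mcoeffZ IHu IHv.
  by rewrite [inc _]mlin1 !mcoeffU val_eqE.
have incS p : supported S (inc p).
  move=> v vp; apply: contrapT => nSv; move: vp; rewrite -mcoeff_neq0 => /eqP; apply.
  elim/malg_lin_ind: p => [|c u w IHu IHw|b]; first by rewrite linear0 mcoeff0.
    by rewrite linearP mcoeffD mcoeffZ IHu IHw mulr0 addr0.
  rewrite [inc _]mlin1 mcoeffU; case: eqP => // bv; case: nSv; rewrite -bv.
  by apply/asboolP; exact: (valP b).
have incI p : mlin id (inc p) = mlin e p.
  elim/malg_lin_ind: p => [|c u v IHu IHv|b]; first by rewrite !linear0.
    by rewrite !linearP /= IHu IHv.
  by rewrite [inc _]mlin1 !mlin1.
have einj : injective (mlin e).
  apply: raddf_inj => p p0; apply/malgP => b; rewrite -incE mcoeff0.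
  by rewrite (Sind (inc p)) ?mcoeff0 //; rewrite ?incI //; apply: incS.
pose res : {linear {malg k[V]} -> {malg k[B]}} :=
  mlin (fun v => if insub v is Some b then << (b : B) >> else 0).
have resE p : supported S p -> mlin e (res p) = mlin id p.
  move=> Sp; rewrite (_ : res p = \sum_(v <- msupp p)
    p@_v *: (if insub v is Some b then << (b : B) >> else 0)) // linear_sum /=.
  apply: eq_big_seq => v /Sp Sv; rewrite linearZ /=.
  have Sv' : `[< S v >] by apply/asboolP.
  by case: insubP => [b _ <-|]; rewrite ?mlin1 // Sv'.
have ex v : exists p, mlin e p == v.
  by have [p [Sp <-]] := Sspan v; exists (res p); rewrite resE.
pose co v := xchoose (ex v).
have coE v : mlin e (co v) = v by apply/eqP: (xchooseP (ex v)).
have col : linear co.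
  by move=> c u v; apply: einj; rewrite linearP /= !coE.
exists B, e, (HB.pack_for {linear V -> {malg k[B]}} co (GRing.isLinear.Build _ _ _ _ co col)).
by split=> [v|b]; [exact: coE|apply: einj; rewrite coE mlin1].
Qed.

End HamelBasis.

Section ModuleBasis.
Variables (k : fieldType) (A : algType k).

Lemma alg_is_action (M : lmodType A) : is_action (fun (c : k) (m : M) => c%:A *: m).
Proof.
split=> [a b v|a u v|a b v|v]; rewrite ?scalerDl ?scalerDr ?scale1r //.
by rewrite scalerA -scalerAl mul1r scalerA.
Qed.

(** A separate name for M, so that its structure over k does not compete with the one over A. *)
Definition restriction (M : lmodType A) : Type := M.

Section Restriction.
Variable M : lmodType A.
HB.instance Definition _ := GRing.Zmodule.copy (restriction M) M.

Let sc (c : k) (m : restriction M) : restriction M := (c%:A : A) *: (m : M).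
Let scA a b v : sc a (sc b v) = sc (a * b) v.
Proof. exact: (actA (alg_is_action M)). Qed.
Let sc1 : left_id 1 sc. Proof. exact: (act1 (alg_is_action M)). Qed.
Let scDr : right_distributive sc +%R.
Proof. exact: (actDr (alg_is_action M)). Qed.
Let scDl v : {morph sc^~ v : a b / a + b}.
Proof. by move=> a b; exact: (actDl (alg_is_action M)). Qed.
HB.instance Definition _ :=
  GRing.Zmodule_isLmodule.Build k (restriction M) scA sc1 scDr scDl.
End Restriction.

(* The k-linear embedding M -> A (x) M, m |-> 1 (x) m, where A (x) M is
   realised as the finitely supported functions B -> A. *)
Record basis_data (M : lmodType A) (B : choiceType) (e : B -> M)
    (io : M -> {malg A[B]}) : Prop := BasisData {
  bd_add : {morph io : u v / u + v};
  bd_scale : forall (c : k) m, io (c%:A *: m) = c%:A *: io m;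
  bd_mlin : forall m, mlin e (io m) = m;
  bd_basis : forall b, io (e b) = << b >>;
  bd_coef : forall m b, exists c : k, (io m)@_b = c%:A }.

Lemma module_basis (M : lmodType A) :
  exists B e io, @basis_data M B e io.
Proof.
(* The identities [h] and [h'] mark each passage between the structure over A and the one over k. *)
pose V : lmodType k := restriction M; pose h : M -> V := id; pose h' : V -> M := id.
have hK : cancel h h' by []. have h'K : cancel h' h by [].
have hD : {morph h : u v / u + v} by [].
have hZ (c : k) m : h (c%:A *: m) = c *: h m by [].
have [B [e [co [coK coe]]]] := hamel_basis V.
pose inA (p : {malg k[B]}) : {malg A[B]} := [malg b in msupp p => (p@_b)%:A].
have inAE p b : (inA p)@_b = (p@_b)%:A.
  by rewrite /inA mcoeffE; case: msuppP => // _; rewrite scale0r.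
have h'D u v : h' (u + v) = h' u + h' v by apply: (can_inj hK); rewrite hD !h'K.
have h'Z (c : k) u : h' (c *: u) = c%:A *: h' u.
  by apply: (can_inj hK); rewrite hZ !h'K.
have h'0 : h' 0 = 0 by have := h'Z 0 0; rewrite !scale0r.
exists B, (fun b => h' (e b)), (fun m => inA (co (h m))); split.
- by move=> u v; apply/malgP => b; rewrite mcoeffD !inAE hD linearD mcoeffD scalerDl.
- move=> c m; apply/malgP => b; rewrite mcoeffZ !inAE hZ linearZ mcoeffZ /=.
  by rewrite -scalerA -scalerAl mul1r.
- move=> m; rewrite -[RHS]hK -[in RHS](coK (h m)).
  have le : (msupp (inA (co (h m))) `<=` msupp (co (h m)))%fset.
    apply/fsubsetP => b; rewrite -!mcoeff_neq0 inAE.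
    by apply: contraNneq => ->; rewrite scale0r.
  rewrite (mlinEw _ le) /mlin (big_morph h' h'D h'0).
  by apply: eq_bigr => b _; rewrite inAE h'Z.
- move=> b; rewrite h'K coe; apply/malgP => b'; rewrite inAE !mcoeffU.
  by case: eqP; rewrite ?scale1r ?scale0r.
- by move=> m b; exists (co (h m))@_b; rewrite inAE.
Qed.

End ModuleBasis.

Section FreeModules.
Variables (A : nzRingType).

Lemma lift_free (B : choiceType) (M N : lmodType A) (s : {linear M -> N})
    (g : {linear {malg A[B]} -> N}) :
  (forall b, exists m, s m = g << b >>) ->
  exists h : {linear {malg A[B]} -> M}, forall t, s (h t) = g t.
Proof.
move=> sg; have ex b : exists m, s m == g << b >>.
  by have [m <-] := sg b; exists m.
exists (mlin (fun b => xchoose (ex b))) => t.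
have := @malg_lin_eq B A N (s \o mlin (fun b => xchoose (ex b))) g.
by apply=> b; rewrite /= mlin1; apply/eqP: (xchooseP (ex b)).
Qed.

Lemma free_projective (B : choiceType) : projective {malg A[B]}.
Proof.
by move=> M N s g surj; apply: lift_free => b; apply: surj.
Qed.

Lemma prod_projective (P Q : lmodType A) :
  projective P -> projective Q -> projective (P * Q)%type.
Proof.
move=> hP hQ M N s g surj.
have gPl : linear (fun p : P => g (p, 0)).
  move=> a u v; rewrite -linearP; congr (g _); apply: injective_projections => //=.
  by rewrite scaler0 addr0.
have gQl : linear (fun p : Q => g (0, p)).
  move=> a u v; rewrite -linearP; congr (g _); apply: injective_projections => //=.
  by rewrite scaler0 addr0.
pose gP : {linear P -> N} := HB.pack_for {linear P -> N} (fun p : P => g (p, 0))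
  (GRing.isLinear.Build _ _ _ _ (fun p : P => g (p, 0)) gPl).
pose gQ : {linear Q -> N} := HB.pack_for {linear Q -> N} (fun p : Q => g (0, p))
  (GRing.isLinear.Build _ _ _ _ (fun p : Q => g (0, p)) gQl).
have [h1 h1E] := hP _ _ s gP surj; have [h2 h2E] := hQ _ _ s gQ surj.
have hl : linear (fun p : P * Q => h1 p.1 + h2 p.2).
  by move=> a u v; rewrite !linearP /= scalerDr addrACA.
exists (HB.pack_for {linear (P * Q)%type -> M} (fun p : P * Q => h1 p.1 + h2 p.2)
  (GRing.isLinear.Build _ _ _ _ (fun p : P * Q => h1 p.1 + h2 p.2) hl)) => -[p p'] /=.
rewrite linearD /= h1E h2E /gP /gQ /= -linearD; congr (g _).
by apply: injective_projections; rewrite /= ?addr0 ?add0r.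
Qed.

Lemma zero_projective : projective ('rV[A]_0 : lmodType A).
Proof.
move=> M N s g _; exists \0 => p /=.
by rewrite (_ : p = 0) ?linear0 //; apply/matrixP => ? [].
Qed.

End FreeModules.

Section ComponentMaps.
Variables (R : nzRingType) (V W : lmodType R).

Definition comb3 (f g h : {linear V -> W}) (p : V * V * V) : W :=
  f p.1.1 + g p.1.2 + h p.2.

Fact comb3_linear f g h : linear (comb3 f g h).
Proof.
move=> a u v; rewrite /comb3 /= !linearP !scalerDr (addrACA (a *: f _)).
by rewrite (addrACA (a *: f _ + _)).
Qed.
HB.instance Definition _ f g h :=
  GRing.isLinear.Build R (V * V * V)%type W _ (comb3 f g h) (comb3_linear f g h).

Definition tuple3 (f g h : {linear W -> V}) (p : W) : V * V * V := (f p, g p, h p).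

Fact tuple3_linear f g h : linear (tuple3 f g h).
Proof. by move=> a u v; apply: pair3_eq; rewrite /= linearP. Qed.
HB.instance Definition _ f g h :=
  GRing.isLinear.Build R W (V * V * V)%type _ (tuple3 f g h) (tuple3_linear f g h).

End ComponentMaps.

Section CentralScaling.
Variables (k : fieldType) (A : algType k).

(** Linear over A because the scalars of k are central in A. *)
Definition ks (V : lmodType A) (c : k) (t : V) : V := c%:A *: t.

Fact ks_linear (V : lmodType A) c : linear (@ks V c).
Proof.
move=> a u v; rewrite /ks scalerDr !scalerA; congr (_ *: _ + _).
by rewrite -scalerAl -scalerAr mul1r mulr1.
Qed.
HB.instance Definition _ (V : lmodType A) c :=
  GRing.isLinear.Build A V V _ (@ks V c) (@ks_linear V c).

Lemma ks_is_action (V : lmodType A) : is_action (@ks V).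
Proof. exact: alg_is_action. Qed.

Lemma linear_ks (V W : lmodType A) (f : {linear V -> W}) c t : f (ks c t) = ks c (f t).
Proof. exact: linearZ. Qed.

End CentralScaling.

(** * The Koszul complex with coefficients in a module *)

Section BimoduleKoszul.
Variables (k : fieldType) (A : algType k) (F : lmodType A) (q ga : k).
Variables (l0 l1 l2 r0 r1 r2 : {linear F -> F}).
Notation F3 := (F * F * F)%type.

Definition bk_d1 : {linear F3 -> F} := comb3 (l0 \- r0) (l1 \- r1) (l2 \- r2).

Notation S := (@ks k A F).
(** Each letter of a relation is singled out in turn: a letter before it multiplies the A-factor
    through an [l], a letter after it acts on the module through an [r]. Thus yz + q zy + ga x^2 has
    x-component ga (r0 + l0) and y-component r2 + q l2. *)
Definition bk_d2 : {linear F3 -> F3} := tuple3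
  (comb3 (S ga \o (r0 \+ l0)) ((S q \o r2) \+ l2) (r1 \+ (S q \o l1)))
  (comb3 (r2 \+ (S q \o l2)) (S ga \o (r1 \+ l1)) ((S q \o r0) \+ l0))
  (comb3 ((S q \o r1) \+ l1) (r0 \+ (S q \o l0)) (S ga \o (r2 \+ l2))).

Definition bk_d3 : {linear F -> F3} := tuple3 (l0 \- r0) (l1 \- r1) (l2 \- r2).

Hypotheses (ll01 : forall t, l1 (l0 t) = - S q (l0 (l1 t)) - S ga (l2 (l2 t)))
  (ll12 : forall t, l2 (l1 t) = - S q (l1 (l2 t)) - S ga (l0 (l0 t)))
  (ll20 : forall t, l0 (l2 t) = - S q (l2 (l0 t)) - S ga (l1 (l1 t)))
  (rr01 : forall t, r0 (r1 t) = - S q (r1 (r0 t)) - S ga (r2 (r2 t)))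
  (rr12 : forall t, r1 (r2 t) = - S q (r2 (r1 t)) - S ga (r0 (r0 t)))
  (rr20 : forall t, r2 (r0 t) = - S q (r0 (r2 t)) - S ga (r1 (r1 t)))
  (rl00 : forall t, r0 (l0 t) = l0 (r0 t)) (rl01 : forall t, r0 (l1 t) = l1 (r0 t))
  (rl02 : forall t, r0 (l2 t) = l2 (r0 t)) (rl10 : forall t, r1 (l0 t) = l0 (r1 t))
  (rl11 : forall t, r1 (l1 t) = l1 (r1 t)) (rl12 : forall t, r1 (l2 t) = l2 (r1 t))
  (rl20 : forall t, r2 (l0 t) = l0 (r2 t)) (rl21 : forall t, r2 (l1 t) = l1 (r2 t))
  (rl22 : forall t, r2 (l2 t) = l2 (r2 t)).

Let lD (h : {linear F -> F}) u v : h (u + v) = h u + h v. Proof. exact: linearD. Qed.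
Let lN (h : {linear F -> F}) u : h (- u) = - h u. Proof. exact: linearN. Qed.
Let lS (h : {linear F -> F}) c u : h (S c u) = S c (h u). Proof. exact: linear_ks. Qed.
Let expand := (lD l0, lD l1, lD l2, lD r0, lD r1, lD r2, lN l0, lN l1, lN l2,
  lN r0, lN r1, lN r2, lS l0, lS l1, lS l2, lS r0, lS r1, lS r2).
Let commute := (rl00, rl01, rl02, rl10, rl11, rl12, rl20, rl21, rl22).
Let skew := (ll01, ll12, ll20, rr01, rr12, rr20).

(** [commute] brings each [l] outside each [r], and [skew] rewrites the words that head a relation,
    so equal terms become equal atoms. The [l] are right multiplications and compose in reverse:
    [l1 (l0 t)] multiplies by x y, whereas [r0 (r1 t)] acts by x y. *)
Lemma bk_d1_d2 p : bk_d1 (bk_d2 p) = 0.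
Proof.
rewrite /= /comb3 /= !expand !commute !skew.
by lin_act (@ks_is_action k A F) (@ks k A F); ring.
Qed.

Lemma bk_d2_d3 t : bk_d2 (bk_d3 t) = 0.
Proof.
apply: pair3_eq; rewrite /= /comb3 /= !expand !commute !skew;
by lin_act (@ks_is_action k A F) (@ks k A F); ring.
Qed.

End BimoduleKoszul.

Section Resolution.
Variables (k : fieldType) (T : free_algebra k 'I_3) (P : poly_space k) (q ga : k).
Hypotheses (q3 : q ^+ 3 = 1) (ga3 : ga ^+ 3 != 1).
Variables (A : algType k) (f : {lrmorphism T -> A}).
Hypothesis fP : presentation f (xyz_rel (T := T) 1 q ga).
Variables (M : lmodType A) (B : choiceType) (e : B -> M) (io : M -> {malg A[B]}).
Hypothesis bd : basis_data e io.

Notation F := {malg A[B]}.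
Notation F3 := (F * F * F)%type.
Notation xi i := (f (var T i)).
Notation x := (xi o0).
Notation y := (xi o1).
Notation z := (xi o2).

Lemma rlam_subproof (a : A) :
  {h : {linear F -> F} | forall t b, (h t)@_b = t@_b * a}.
Proof.
exists (mlin (fun b => << a *g b >>)) => t b.
elim/malg_lin_ind: t => [|c u v IHu IHv|b']; first by rewrite linear0 !mcoeff0 mul0r.
  by rewrite linearP !mcoeffD !mcoeffZ IHu IHv mulrDl mulrA.
by rewrite /= mlin1 !mcoeffU; case: eqP; rewrite ?mul1r ?mul0r.
Qed.

Lemma rrho_subproof (a : A) :
  {h : {linear F -> F} | (forall t b,
     (h t)@_b = \sum_(b' <- msupp t) t@_b' * (io (a *: e b'))@_b) /\
     forall b, h << b >> = io (a *: e b)}.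
Proof.
exists (mlin (fun b => io (a *: e b))); split=> [t b|b]; last exact: mlin1.
by rewrite /= /mlin raddf_sum; apply: eq_bigr => b' _; rewrite /= mcoeffZ.
Qed.

(* Right multiplication of the A-factor, respectively action on the M-factor,
   of A (x) M. *)
Definition rlam a := sval (rlam_subproof a).
Definition rrho a := sval (rrho_subproof a).

Lemma rlam_coef a t b : (rlam a t)@_b = t@_b * a.
Proof. exact: (svalP (rlam_subproof a)). Qed.

Lemma rrho1 a b : rrho a << b >> = io (a *: e b).
Proof. exact: (svalP (rrho_subproof a)).2. Qed.

Lemma rrho_coef a t b :
  (rrho a t)@_b = \sum_(b' <- msupp t) t@_b' * (io (a *: e b'))@_b.
Proof. exact: (svalP (rrho_subproof a)).1. Qed.

Lemma rlam1 a b : rlam a << b >> = << a *g b >>.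
Proof.
apply/malgP => b'; rewrite rlam_coef !mcoeffU.
by case: eqP; rewrite ?mul1r ?mul0r.
Qed.

Lemma rlam_io a m : rlam a (io m) = a *: io m.
Proof.
apply/malgP => b; rewrite rlam_coef mcoeffZ; have [c ->] := bd_coef bd m b.
by rewrite -scalerAl -scalerAr mulr1 mul1r.
Qed.

Lemma io0 : io 0 = 0.
Proof. by have := bd_scale bd 0 0; rewrite !scale0r. Qed.

Lemma rrho_io a m : rrho a (io m) = io (a *: m).
Proof.
have co b : exists c : k, (io m)@_b == c%:A by have [c ->] := bd_coef bd m b; exists c.
rewrite -[in RHS](bd_mlin bd m) {1}[io m]malg_sum linear_sum /mlin scaler_sumr.
rewrite (big_morph io (bd_add bd) io0).
apply: eq_bigr => b _; rewrite linearZ /= rrho1; have /eqP -> := xchooseP (co b).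
by rewrite -(bd_scale bd) !scalerA -scalerAl -scalerAr mul1r mulr1.
Qed.

Lemma rrho_rlam a c t : rrho a (rlam c t) = rlam c (rrho a t).
Proof.
have := @malg_lin_eq B A F (rrho a \o rlam c) (rlam c \o rrho a).
by apply=> b /=; rewrite rlam1 malgUZ linearZ /= rrho1 rlam_io.
Qed.

Lemma rlam_rlam a c t : rlam a (rlam c t) = rlam (c * a) t.
Proof. by apply/malgP => b; rewrite !rlam_coef mulrA. Qed.

Lemma rrho_rrho a c t : rrho a (rrho c t) = rrho (a * c) t.
Proof.
have := @malg_lin_eq B A F (rrho a \o rrho c) (rrho (a * c)).
by apply=> b /=; rewrite !rrho1 rrho_io scalerA.
Qed.

Lemma rlam_lin c u v t : rlam (c *: u + v) t = ks c (rlam u t) + rlam v t.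
Proof.
apply/malgP => b; rewrite mcoeffD mcoeffZ !rlam_coef linr; congr (_ + _).
by rewrite -scalerAl mul1r.
Qed.

Lemma rrho_lin c u v t : rrho (c *: u + v) t = ks c (rrho u t) + rrho v t.
Proof.
have := @malg_lin_eq B A F (rrho (c *: u + v)) ((@ks k A F c \o rrho u) \+ rrho v).
apply=> b; rewrite /= !rrho1 /ks -(bd_scale bd) -(bd_add bd) scalerDl.
by rewrite -[c *: u]mulr_algl scalerA.
Qed.

Lemma rlam0 t : rlam 0 t = 0.
Proof. by apply/malgP => b; rewrite rlam_coef mulr0 mcoeff0. Qed.

Lemma rrho0 t : rrho 0 t = 0.
Proof. by have := rrho_lin (-1) 0 0 t; rewrite scaler0 addr0 /ks scaleN1r scaleN1r addNr. Qed.

Lemma rlamD u v t : rlam (u + v) t = rlam u t + rlam v t.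
Proof. by have := rlam_lin 1 u v t; rewrite /ks !scale1r. Qed.

Lemma rlamZ c u t : rlam (c *: u) t = ks c (rlam u t).
Proof. by have := rlam_lin c u 0 t; rewrite rlam0 !addr0. Qed.

Lemma rlam_skew (u v w : A) t : skew_relation q ga u v w ->
  rlam v (rlam u t) = - ks q (rlam u (rlam v t)) - ks ga (rlam w (rlam w t)).
Proof.
move=> h.
have : rlam (u * v) t + ks q (rlam (v * u) t) + ks ga (rlam (w * w) t) = 0.
  transitivity (rlam (u * v + q *: (v * u) + ga *: (w * w)) t).
    by rewrite (rlamD (u * v + q *: (v * u))) (rlamD (u * v)) (rlamZ q) (rlamZ ga).
  by rewrite (h : _ = 0) rlam0.
by rewrite -!rlam_rlam => /eqP; rewrite -addrA addr_eq0 opprD => /eqP.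
Qed.

Lemma rrhoD u v t : rrho (u + v) t = rrho u t + rrho v t.
Proof. by have := rrho_lin 1 u v t; rewrite /ks !scale1r. Qed.

Lemma rrhoZ c u t : rrho (c *: u) t = ks c (rrho u t).
Proof. by have := rrho_lin c u 0 t; rewrite rrho0 !addr0. Qed.

Lemma rrho_skew (u v w : A) t : skew_relation q ga u v w ->
  rrho u (rrho v t) = - ks q (rrho v (rrho u t)) - ks ga (rrho w (rrho w t)).
Proof.
move=> h.
have : rrho (u * v) t + ks q (rrho (v * u) t) + ks ga (rrho (w * w) t) = 0.
  transitivity (rrho (u * v + q *: (v * u) + ga *: (w * w)) t).
    by rewrite (rrhoD (u * v + q *: (v * u))) (rrhoD (u * v)) (rrhoZ q) (rrhoZ ga).
  by rewrite (h : _ = 0) rrho0.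
rewrite -(rrho_rrho u v) -(rrho_rrho v u) -(rrho_rrho w w) => /eqP.
by rewrite -addrA addr_eq0 opprD => /eqP.
Qed.

Definition res_aug : {linear F -> M} := mlin e.

Definition res_d1 : {linear F3 -> F} :=
  bk_d1 (rlam x) (rlam y) (rlam z) (rrho x) (rrho y) (rrho z).
Definition res_d2 : {linear F3 -> F3} :=
  bk_d2 q ga (rlam x) (rlam y) (rlam z) (rrho x) (rrho y) (rrho z).
Definition res_d3 : {linear F -> F3} :=
  bk_d3 (rlam x) (rlam y) (rlam z) (rrho x) (rrho y) (rrho z).

Lemma res_aug_d1 p : res_aug (res_d1 p) = 0.
Proof.
have h a t : res_aug (rlam a t - rrho a t) = 0.
  have := @malg_lin_eq B A M (res_aug \o (rlam a \- rrho a)) \0.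
  apply=> b; rewrite /= linearB /= rlam1 rrho1 [res_aug (io _)](bd_mlin bd).
  by rewrite [res_aug _]mlinU subrr.
have hD (u v : F) : res_aug u = 0 -> res_aug v = 0 -> res_aug (u + v) = 0.
  by move=> u0 v0; rewrite linearD /= u0 v0 addr0.
by apply: (hD); [apply: (hD)|]; apply: h.
Qed.

Lemma res_d1_d2 p : res_d1 (res_d2 p) = 0.
Proof.
have [hxy hyz hzx] := skew_relations fP.
by apply: bk_d1_d2 => [t|t|t|t|t|t|||||||||] *; first
  [exact: rlam_skew|exact: rrho_skew|exact: rrho_rlam].
Qed.

Lemma res_d2_d3 p : res_d2 (res_d3 p) = 0.
Proof.
have [hxy hyz hzx] := skew_relations fP.
by apply: bk_d2_d3 => [t|t|t|t|t|t|||||||||] *; first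
  [exact: rlam_skew|exact: rrho_skew|exact: rrho_rlam].
Qed.

End Resolution.

(** Successive approximation: subtracting a boundary lowers the filtration degree of a cycle, until
    nothing is left. *)
Lemma filtered_exact (R : nzRingType) (Pa Pb Pc : lmodType R)
    (D : {linear Pa -> Pb}) (D' : {linear Pb -> Pc}) (Fil : nat -> Pb -> Prop) :
  (forall t, D' (D t) = 0) -> (forall w, Fil 0%N w -> D' w = 0 -> w = 0) ->
  (forall n w, Fil n.+1 w -> D' w = 0 -> exists t, Fil n (w - D t)) ->
  forall n w, Fil n w -> D' w = 0 -> exists t, D t = w.
Proof.
move=> D'D Fil0 step; elim=> [|n IH] w Fw w0.
  by exists 0; rewrite linear0 (Fil0 w).
have [t Ft] := step n w Fw w0.
have [|t' t'E] := IH _ Ft; first by rewrite linearB /= D'D w0 subrr.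
by exists (t' + t); rewrite linearD /= t'E subrK.
Qed.

(** * Exactness by filtration *)

Section Exactness.
Variables (k : fieldType) (T : free_algebra k 'I_3) (P : poly_space k) (q ga : k).
Hypotheses (q3 : q ^+ 3 = 1) (ga3 : ga ^+ 3 != 1).
Variables (A : algType k) (f : {lrmorphism T -> A}).
Hypothesis fP : presentation f (xyz_rel (T := T) 1 q ga).
Variables (M : lmodType A) (B : choiceType) (e : B -> M) (io : M -> {malg A[B]}).
Hypothesis bd : basis_data e io.

Notation F := {malg A[B]}.
Notation F3 := (F * F * F)%type.
Notation A3 := (A * A * A)%type.
Notation x := (f (var T o0)).
Notation y := (f (var T o1)).
Notation z := (f (var T o2)).
Notation gp := (gp fP (@xyz_rel_hom k T 1 q ga)).
Notation aug := (aug fP (@xyz_hom2 k T 1 q ga)).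
Notation dL1 := (dL1 f).
Notation dL2 := (dL2 q ga f).
Notation dL3 := (dL3 f).
Notation d1 := (res_d1 f e io).
Notation d2 := (res_d2 q ga f e io).
Notation d3 := (res_d3 f e io).

Let gpD m u v : gp m (u + v) = gp m u + gp m v. Proof. exact: linearD. Qed.
Let gpB m u v : gp m (u - v) = gp m u - gp m v. Proof. exact: linearB. Qed.
Let gpZ m c u : gp m (c *: u) = c *: gp m u. Proof. exact: linearZ. Qed.
Let gp0 m : gp m 0 = 0. Proof. exact: linear0. Qed.

(** All coefficients have degree below n, in the shifted numbering of [gp]. Hence [FL 0] leaves only
    zero and [FL 1] only scalar coefficients. *)
Definition FL n (t : F) := forall m b, (n < m)%N -> gp m (t@_b) = 0.
Definition F3L n (t : F3) := [/\ FL n t.1.1, FL n t.1.2 & FL n t.2].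
Definition co3 (t : F3) b : A3 := (t.1.1@_b, t.1.2@_b, t.2@_b).

Lemma gp_bound a : exists n, forall m, (n < m)%N -> gp m a = 0.
Proof.
have [N aN] := gpr_sum fP (@xyz_rel_hom k T 1 q ga) a; exists N => -[//|m] Nm /=.
rewrite -(aN N (leqnn N)) linear_sum big1 // => d _ /=.
rewrite (gpr_id _ _ _ (gr_gpr _ _ _ _)); case: eqP => // dm.
by have := ltn_ord d; lia.
Qed.

Lemma FL_exists t : exists n, FL n t.
Proof.
have [n hn] := choice (fun b => gp_bound t@_b).
exists (\max_(b <- msupp t) n b) => m b; case: msuppP => [bt|_ _]; last exact: gp0.
by move=> lt; apply: hn; apply: leq_ltn_trans lt; apply: leq_bigmax_seq.
Qed.

Lemma FL_le n n' t : (n <= n')%N -> FL n t -> FL n' t.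
Proof. by move=> nn' Ft m b n'm; apply: Ft; apply: leq_ltn_trans n'm. Qed.

Lemma F3L_exists t : exists n, F3L n t.
Proof.
have [n0 h0] := FL_exists t.1.1; have [n1 h1] := FL_exists t.1.2.
have [n2 h2] := FL_exists t.2; exists (n0 + n1 + n2)%N.
by split; [apply: FL_le h0|apply: FL_le h1|apply: FL_le h2]; lia.
Qed.

Lemma FL0 t : FL 0 t -> t = 0.
Proof.
move=> t0; apply/malgP => b; rewrite mcoeff0.
by apply: (@gpr_inj _ _ _ _ _ _ fP _ (@xyz_rel_hom k T 1 q ga)) => d; apply: (t0 d.+1).
Qed.

(** The action on M mixes the coefficients by scalars of k and does not raise their degree in A. In
    top degree the differentials therefore reduce to [dL1], [dL2] and [dL3] on each coefficient. *)
Lemma FL_rho n a t : FL n t -> FL n (rrho e io a t).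
Proof.
move=> Ft m b nm; rewrite rrho_coef linear_sum big1 // => b' _ /=.
have [c ->] := bd_coef bd (a *: e b') b.
by rewrite -scalerAr mulr1 gpZ Ft // scaler0.
Qed.

Let ks_coef c (t : F) b : (ks c t)@_b = c *: t@_b.
Proof. by rewrite mcoeffZ mulr_algl. Qed.

Let d3_coef n t m b : FL n t -> (n < m)%N ->
  map3 (gp m) (co3 (d3 t) b) = map3 (gp m) (dL3 t@_b).
Proof.
move=> Ft nm; apply: pair3_eq; rewrite /= mcoeffB rlam_coef gpB (FL_rho _ Ft) //;
  by rewrite subr0.
Qed.

Let d1_coef n t m b : F3L n t -> (n < m)%N ->
  gp m (d1 t)@_b = gp m (dL1 (co3 t b)).
Proof.
case=> F0 F1 F2 nm; rewrite [d1 t]/(_ + _ + _) /= !mcoeffD !mcoeffN !rlam_coef.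
by rewrite /dL1 !gpD !linearN /= !(FL_rho _ F0, FL_rho _ F1, FL_rho _ F2) // !oppr0 !addr0.
Qed.

Let d2_coef n t m b : F3L n t -> (n < m)%N ->
  map3 (gp m) (co3 (d2 t) b) = map3 (gp m) (dL2 (co3 t b)).
Proof.
case=> F0 F1 F2 nm; apply: pair3_eq; rewrite /= [comb3 _ _ _ t]/(_ + _ + _) /=
  !mcoeffD !ks_coef ?mcoeffD !rlam_coef !gpD !gpZ ?gpD
  !(FL_rho _ F0, FL_rho _ F1, FL_rho _ F2) // ?scaler0 ?add0r ?addr0 //.
Qed.

Let gpgp m a : gp m (gp m a) = gp m a.
Proof. by rewrite gp_gp eqxx. Qed.

(** If u agrees with the leading part of a in top degree, and has nothing above it, then a - u has
    lost that degree. *)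
Let drop_top n (a u : A) m : (forall m, (n.+1 < m)%N -> gp m a = 0) ->
  gp m u = gp m (gp n.+1 a) -> (n < m)%N -> gp m (a - u) = 0.
Proof.
move=> an um nm; rewrite gpB um gp_gp; have [->|mn] := eqVneq m n.+1.
  by rewrite subrr.
by rewrite an ?subrr //; first [by rewrite subr0|lia].
Qed.

Let supp3 (t : F3) : {fset B} := (msupp t.1.1 `|` msupp t.1.2 `|` msupp t.2)%fset.

Let supp3P t b : b \notin supp3 t -> co3 t b = 0.
Proof.
rewrite /supp3 !in_fsetU !negb_or => /andP[/andP[h0 h1] h2].
by apply: pair3_eq; rewrite /= mcoeff_outdom.
Qed.

Lemma exact_d3 w : d2 w = 0 -> exists t, d3 t = w.
Proof.
have [n] := F3L_exists w; move: n w.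
apply: filtered_exact => [t|w [h0 h1 h2] _|n w Fw w0].
- exact: (res_d2_d3 fP bd).
- by apply: pair3_eq; apply: FL0.
have ex b : exists a, dL3 (gp n a) = map3 (gp n.+1) (co3 w b).
  apply: (dL2_exact_graded P q3 ga3); rewrite -gp_dL2 -(d2_coef b Fw) // w0.
  by apply: pair3_eq; rewrite /= mcoeff0 linear0.
have [g gE] := choice ex.
(* The preimages chosen for all b are cut down to the finite support of w; outside it both sides of
   [tE] vanish. *)
pose t : F := [malg b in supp3 w => gp n (g b)].
have tE b : dL3 t@_b = map3 (gp n.+1) (co3 w b).
  rewrite /t mcoeffE; case: ifPn => [_|/supp3P ->]; first exact: gE.
  by rewrite linear0; apply: pair3_eq; rewrite /= linear0.
have Ft : FL n t.
  move=> m b nm; rewrite /t mcoeffE; case: ifP => _; last exact: gp0.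
  by rewrite gp_gp gtn_eqF.
have [F0 F1 F2] := Fw; exists t.
have H m b : (n < m)%N -> map3 (gp m) (co3 (d3 t) b) =
    map3 (gp m) (map3 (gp n.+1) (co3 w b)).
  by move=> nm; rewrite (d3_coef b Ft nm) tE.
split=> m b nm; rewrite mcoeffB; apply: (@drop_top n) => // [m' h|];
  by [apply: F0|apply: F1|apply: F2|case: (H m b nm)].
Qed.

Lemma exact_d2 w : d1 w = 0 -> exists t, d2 t = w.
Proof.
have [n] := F3L_exists w; move: n w.
apply: filtered_exact => [t|w [h0 h1 h2] _|n w Fw w0].
- exact: (res_d1_d2 fP bd).
- by apply: pair3_eq; apply: FL0.
have ex b : exists c, dL2 (map3 (gp n) c) = map3 (gp n.+1) (co3 w b).
  have [|c cE] := dL1_exact fP (c := map3 (gp n.+1) (co3 w b)).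
    by rewrite -gp_dL1 -(d1_coef b Fw) // w0 mcoeff0 gp0.
  exists c; rewrite -gp_dL2 cE.
  by apply: pair3_eq; exact: gpgp.
have [g gE] := choice ex.
pose t : F3 := ([malg b in supp3 w => gp n (g b).1.1],
  [malg b in supp3 w => gp n (g b).1.2], [malg b in supp3 w => gp n (g b).2]).
have tE b : dL2 (co3 t b) = map3 (gp n.+1) (co3 w b).
  rewrite /t /co3 /= !mcoeffE; case: ifPn => [_|/supp3P]; first exact: gE.
  rewrite /co3 => ->; rewrite [LHS](linear0 dL2); apply: pair3_eq; rewrite /= linear0 //.
have Ft : F3L n t.
  by split=> m b nm; rewrite mcoeffE; case: ifP => _; rewrite ?gp0 // gp_gp gtn_eqF.
have [F0 F1 F2] := Fw; exists t.
have H m b : (n < m)%N -> map3 (gp m) (co3 (d2 t) b) =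
    map3 (gp m) (map3 (gp n.+1) (co3 w b)).
  by move=> nm; rewrite (d2_coef b Ft nm) tE.
split=> m b nm; rewrite mcoeffB; apply: (@drop_top n) => // [m' h|];
  by [apply: F0|apply: F1|apply: F2|case: (H m b nm)].
Qed.

Lemma gp1_aug a : gp 1 a = (aug a)%:A.
Proof.
have [c {1}->] := aug_dL1 fP a; rewrite gpD gp_dL1 gpZ.
have -> : map3 (gp 0) c = 0 by [].
rewrite linear0 addr0; congr (_ *: _); rewrite /=.
exact/(grP fP (@xyz_rel_hom k T 1 q ga))/gr_1.
Qed.

Lemma FL1_io t : FL 1 t -> t = io (res_aug e t).
Proof.
move=> Ft; have tE b : t@_b = (aug t@_b)%:A.
  rewrite -gp1_aug; apply/eqP; rewrite -subr_eq0; apply/eqP.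
  apply: (@gpr_inj _ _ _ _ _ _ fP _ (@xyz_rel_hom k T 1 q ga)) => d.
  rewrite -[gpr _ _ _ _]/(gp d.+1 _) gpB gp_gp eqSS.
  by case: d => [|d]; rewrite /= ?subrr // subr0; apply: (Ft d.+2).
rewrite {1}(malg_sum t) /res_aug /= /mlin.
rewrite (big_morph io (bd_add bd) (io0 bd)); apply: eq_bigr => b _.
by rewrite tE (bd_scale bd) (bd_basis bd).
Qed.

Lemma exact_d1 w : res_aug e w = 0 -> exists t, d1 t = w.
Proof.
have [n] := FL_exists w; move: n w.
apply: filtered_exact => [t|w h0 _|n w Fw w0].
- exact: res_aug_d1 bd _.
- exact: FL0.
(* Degree 0 is out of reach of [d1]. There w is the tensor of 1 with its augmentation, which is zero
   by assumption. *)
case: n Fw => [|n] Fw.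
  by exists 0; rewrite linear0 subr0 (FL1_io Fw) w0 (io0 bd) => m b _; rewrite mcoeff0 gp0.
have ex b : exists c, dL1 (map3 (gp n.+1) c) = gp n.+2 w@_b.
  have [c cE] := aug_dL1 fP (gp n.+2 w@_b); exists c.
  by rewrite -gp_dL1 -[in RHS]gpgp [in RHS]cE aug_gp scale0r add0r.
have [g gE] := choice ex.
pose t : F3 := ([malg b in msupp w => gp n.+1 (g b).1.1],
  [malg b in msupp w => gp n.+1 (g b).1.2], [malg b in msupp w => gp n.+1 (g b).2]).
have tE b : dL1 (co3 t b) = gp n.+2 w@_b.
  rewrite /t /co3 /= !mcoeffE; case: msuppP => [_|_]; first exact: gE.
  by rewrite [LHS](linear0 dL1) linear0.
have Ft : F3L n.+1 t.
  by split=> m b nm; rewrite mcoeffE; case: ifP => _; rewrite ?gp0 // gp_gp gtn_eqF.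
exists t => m b nm; rewrite mcoeffB; apply: (@drop_top n.+1) => // [m' h|].
  exact: Fw.
by rewrite (d1_coef b Ft nm) tE.
Qed.

(** The top-degree part of each coefficient is annihilated by x already in the first component of
    [dL3]. *)
Lemma inj_d3 t : d3 t = 0 -> t = 0.
Proof.
have [n] := FL_exists t; elim: n => [|n IH] Ft t0; first exact: FL0.
apply: IH => // m b; rewrite leq_eqVlt => /predU1P[<-|]; last exact: Ft.
have : map3 (gp n.+2) (dL3 t@_b) = 0.
  rewrite -(d3_coef b Ft) // t0; apply: pair3_eq; rewrite /= mcoeff0 linear0 //.
by rewrite gp_dL3 => -[/(mulrx_inj P q3 ga3 fP)].
Qed.

Definition koszul_mod (i : nat) : lmodType A :=
  match i with 0 => F | 1 => F3 | 2 => F3 | 3 => F | _ => 'rV[A]_0 end.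

Definition koszul_d (i : nat) : {linear koszul_mod i.+1 -> koszul_mod i} :=
  match i with 0 => d1 | 1 => d2 | 2 => d3 | _ => \0 end.

Lemma koszul_projective i : projective (koszul_mod i).
Proof.
have h := @free_projective A B.
by case: i => [|[|[|[|i]]]] //=; do ?apply: prod_projective => //; apply: zero_projective.
Qed.

Lemma koszul_aug_surj m : exists p, res_aug e p = m.
Proof. by exists (io m); apply: bd_mlin. Qed.

Lemma koszul_exact0 p : res_aug e p = 0 <-> exists t, koszul_d 0 t = p.
Proof. by split=> [/exact_d1 //|[t <-]]; apply: res_aug_d1 bd _. Qed.

Lemma koszul_exactS i p : koszul_d i p = 0 <-> exists t, koszul_d i.+1 t = p.
Proof.
case: i p => [|[|[|i]]] p.
- by split=> [/exact_d2 //|[t <-]]; apply: (res_d1_d2 fP bd).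
- by split=> [/exact_d3 //|[t <-]]; apply: (res_d2_d3 fP bd).
- by split=> [/inj_d3 ->|[t <-]]; [exists 0|exact: linear0].
- split=> // _; exists 0; rewrite /=; case: i p => [|i] p; by apply/matrixP => ? [].
Qed.

Definition koszul_resolution : projective_resolution M :=
  ProjectiveResolution koszul_projective koszul_aug_surj koszul_exact0 koszul_exactS.

Lemma koszul_pdim : pdim_le M 3.
Proof.
by exists koszul_resolution => -[|[|[|[|i]]]] // _ p; apply/matrixP => ? [].
Qed.

End Exactness.

(** * Global dimension and the Gorenstein condition *)

(** Here s need only cover the image of g. Q is a retract of the free module on its own elements,
    and there basis elements are lifted one by one. *)
Lemma projective_lift (A : nzRingType) (Q M N : lmodType A) (s : {linear M -> N})
    (g : {linear Q -> N}) :
  projective Q -> (forall x, exists m, s m = g x) ->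
  exists h : {linear Q -> M}, forall x, s (h x) = g x.
Proof.
move=> Qproj sg.
have [|h0 h0E] := Qproj {malg A[Q]} Q (mlin id) idfun.
  by move=> x; exists << x >>; rewrite /= mlin1.
have [|h hE] := lift_free (s := s) (g := g \o mlin id).
  by move=> b; have [m mb] := sg b; exists m; rewrite /= mlin1.
by exists (h \o h0) => x; rewrite /= hE /=; have /= -> := h0E x.
Qed.

Section Comparison.
Variables (A : nzRingType) (K : lmodType A).

Lemma chain_map3 (P Q : projective_resolution K) :
  exists (p0 : {linear pr_mod P 0 -> pr_mod Q 0}) (p1 : {linear pr_mod P 1 -> pr_mod Q 1})
    (p2 : {linear pr_mod P 2 -> pr_mod Q 2}),
  [/\ forall x, pr_aug Q (p0 x) = pr_aug P x,
      forall x, pr_d Q 0 (p1 x) = p0 (pr_d P 0 x)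
    & forall x, pr_d Q 1 (p2 x) = p1 (pr_d P 1 x)].
Proof.
have [|p0 h0] := projective_lift (s := pr_aug Q) (g := pr_aug P) (@pr_proj _ _ P 0%N).
  by move=> x; apply: pr_aug_surj.
have [|p1 h1] := projective_lift (s := pr_d Q 0) (g := p0 \o pr_d P 0) (@pr_proj _ _ P 1%N).
  by move=> x; apply/pr_exact0; rewrite /= h0; apply/pr_exact0; exists x.
have [|p2 h2] := projective_lift (s := pr_d Q 1) (g := p1 \o pr_d P 1) (@pr_proj _ _ P 2%N).
  move=> x; apply/pr_exactS; rewrite /= h1 /=.
  have -> : pr_d P 0 (pr_d P 1 x) = 0 by apply/pr_exactS; exists x.
  exact: linear0.
by exists p0, p1, p2.
Qed.

(* The composite of comparison maps P -> Q -> P is homotopic to the identity, and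
   vanishes in degree 3 if Q does. *)
Lemma short_resolution_split (P Q : projective_resolution K) :
  (forall x : pr_mod Q 3, x = 0) -> (forall x, pr_d P 2 x = 0 -> x = 0) ->
  exists h : {linear pr_mod P 2 -> pr_mod P 3}, forall x, h (pr_d P 2 x) = x.
Proof.
move=> Q3 inj.
have [p0 [p1 [p2 [a0 a1 a2]]]] := chain_map3 P Q.
have [r0 [r1 [r2 [b0 b1 b2]]]] := chain_map3 Q P.
have dd i (x : pr_mod P i.+2) : pr_d P i (pr_d P i.+1 x) = 0.
  by apply/pr_exactS; exists x.
have ad (x : pr_mod P 1) : pr_aug P (pr_d P 0 x) = 0 by apply/pr_exact0; exists x.
have pz x : p2 (pr_d P 2 x) = 0.
  have /pr_exactS[y <-] : pr_d Q 1 (p2 (pr_d P 2 x)) = 0 by rewrite a2 dd linear0.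
  by rewrite (Q3 y) linear0.
have [|h0 e0] := projective_lift (s := pr_d P 0) (g := idfun \- (r0 \o p0)) (@pr_proj _ _ P 0%N).
  by move=> x; apply/pr_exact0; rewrite /= linearB /= b0 a0 subrr.
have [|h1 e1] := projective_lift (s := pr_d P 1)
    (g := idfun \- (r1 \o p1) \- (h0 \o pr_d P 0)) (@pr_proj _ _ P 1%N).
  move=> x; apply/pr_exactS; rewrite /= !linearB /= b1 a1.
  by have /= -> := e0 (pr_d P 0 x); rewrite subrr.
have [|h2 e2] := projective_lift (s := pr_d P 2)
    (g := idfun \- (r2 \o p2) \- (h1 \o pr_d P 1)) (@pr_proj _ _ P 2%N).
  move=> x; apply/pr_exactS; rewrite /= !linearB /= b2 a2.
  by have /= -> := e1 (pr_d P 1 x); rewrite dd linear0 subr0 subrr.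
exists h2 => x; apply/eqP; rewrite -subr_eq0; apply/eqP/inj.
rewrite linearB /=; have /= -> := e2 (pr_d P 2 x).
by rewrite pz dd (linear0 r2) (linear0 h1) !subr0 subrr.
Qed.

End Comparison.

Section TrivialModule.
Variables (k : fieldType) (A : algType k) (ep : {linear A -> k^o}).
Hypotheses (epM : forall u v, ep (u * v) = ep u * ep v) (ep1 : ep 1 = 1).

(** The two properties of [ep] are arguments of the type, so that the module structure can be found
    from the type alone. *)
Definition trivial_mod & (forall u v, ep (u * v) = ep u * ep v) & ep 1 = 1 : Type := k.
Notation K := (trivial_mod epM ep1).
HB.instance Definition _ := GRing.Zmodule.copy K k.

Let sc (a : A) (v : K) : K := (ep a : k) * (v : k).
Let scA a b v : sc a (sc b v) = sc (a * b) v.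
Proof. by rewrite /sc epM mulrA. Qed.
Let sc1 : left_id 1 sc. Proof. by move=> v; rewrite /sc ep1 mul1r. Qed.
Let scDr : right_distributive sc +%R.
Proof. by move=> a u v; apply: mulrDr. Qed.
Let scDl v : {morph sc^~ v : a b / a + b}.
Proof. by move=> a b; rewrite /sc linearD; apply: mulrDl. Qed.
HB.instance Definition _ := GRing.Zmodule_isLmodule.Build A K scA sc1 scDr scDl.

Lemma trivial_modE (a : A) (v : K) : a *: v = ep a * v :> k.
Proof. by []. Qed.

Definition triv_e (_ : unit) : K := 1 : k.
Definition triv_io (v : K) : {malg A[unit]} := << (v : k)%:A *g tt >>.

Let ep_alg (c : k) : ep c%:A = c.
Proof. by rewrite linearZ /= ep1; apply: mulr1. Qed.

Lemma triv_basis : basis_data triv_e triv_io.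
Proof.
split.
- by move=> u v; rewrite /triv_io scalerDl monalgUD.
- move=> c m; apply/malgP => -[]; rewrite mcoeffZ !mcoeffUU trivial_modE ep_alg.
  by rewrite -[RHS]scalerAl mul1r scalerA.
- move=> m; rewrite /triv_io mlinU; apply: etrans (trivial_modE _ _) _.
  by rewrite ep_alg; apply: mulr1.
- by case; rewrite /triv_io scale1r.
- by move=> m []; exists m; rewrite mcoeffUU.
Qed.

End TrivialModule.

Section TrivialResolution.
Variables (k : fieldType) (T : free_algebra k 'I_3) (P : poly_space k) (q ga : k).
Hypotheses (q3 : q ^+ 3 = 1) (ga3 : ga ^+ 3 != 1).
Variables (A : algType k) (f : {lrmorphism T -> A}).
Hypothesis fP : presentation f (xyz_rel (T := T) 1 q ga).

Notation F := {malg A[unit]}.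
Notation F3 := (F * F * F)%type.
Notation A3 := (A * A * A)%type.
Notation x := (f (var T o0)).
Notation y := (f (var T o1)).
Notation z := (f (var T o2)).
Notation aug := (aug fP (@xyz_hom2 k T 1 q ga)).
Notation augM := (augM fP (@xyz_hom2 k T 1 q ga)).
Notation aug1 := (aug1 fP (@xyz_hom2 k T 1 q ga)).
Notation K := (trivial_mod augM aug1).
Notation tb := (triv_basis augM aug1).
Notation e := (triv_e augM aug1).
Notation io := (@triv_io k A aug augM aug1).
Notation d1 := (res_d1 f e io).
Notation d2 := (res_d2 q ga f e io).
Notation d3 := (res_d3 f e io).
Notation R := (koszul_resolution P q3 ga3 fP tb).

Definition tcoef (t : F) : A := t@_tt.
Definition tcoef3 (t : F3) : A3 := (tcoef t.1.1, tcoef t.1.2, tcoef t.2).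
Definition dot (b a : A3) : A := b.1.1 * a.1.1 + b.1.2 * a.1.2 + b.2 * a.2.

(** The variables act by zero on k, so in coordinates the resolution of k is the complex [dL3],
    [dL2], [dL1] itself. *)
Lemma rrho_trivial i t : rrho e io (f (var T i)) t = 0.
Proof.
have := @malg_lin_eq unit A F (rrho e io (f (var T i))) \0; apply=> b.
rewrite rrho1 /= trivial_modE (aug_var fP (@xyz_hom2 k T 1 q ga)).
by rewrite mul0r; apply: (io0 tb).
Qed.

Lemma tcoef_d3 t : tcoef3 (d3 t) = dL3 f (tcoef t).
Proof. by apply: pair3_eq; rewrite /= /tcoef /= rrho_trivial subr0 rlam_coef. Qed.

Lemma tcoef_d2 t : tcoef3 (d2 t) = dL2 q ga f (tcoef3 t).
Proof.
by apply: pair3_eq; rewrite /= /tcoef /comb3 /= !rrho_trivial /ks ?scaler0 ?add0r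
  !mcoeffD !mcoeffZ !rlam_coef ?add0r ?addr0 !mulr_algl.
Qed.

Lemma tcoef_d1 t : tcoef (d1 t) = dL1 f (tcoef3 t).
Proof.
by rewrite /= /tcoef /res_d1 /= /comb3 /= !rrho_trivial !subr0 !mcoeffD !rlam_coef.
Qed.

Lemma tcoef3_surj c : exists t, tcoef3 t = c.
Proof.
exists (<< c.1.1 *g tt >>, << c.1.2 *g tt >>, << c.2 *g tt >>).
by apply: pair3_eq; rewrite /= /tcoef mcoeffUU.
Qed.

Lemma tcoef_surj a : exists t, tcoef t = a.
Proof. by exists << a *g tt >>; rewrite /tcoef mcoeffUU. Qed.

Lemma tcoef_hom (g : {linear F -> A^o}) t : g t = tcoef t * g << tt >>.
Proof.
rewrite {1}(_ : t = tcoef t *: << tt >>) ?linearZ //.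
by apply/malgP => -[]; rewrite mcoeffZ mcoeffUU mulr1.
Qed.

Lemma tcoef3_hom (g : {linear F3 -> A^o}) : exists a, forall t, g t = dot (tcoef3 t) a.
Proof.
exists (g (<< tt >>, 0, 0), g (0, << tt >>, 0), g (0, 0, << tt >>)) => t.
have uE u : u = tcoef u *: << tt >>.
  by apply/malgP => -[]; rewrite mcoeffZ mcoeffUU mulr1.
rewrite /dot -![_ * g _](linearZ_LR g) -!linearD; congr (g _).
by apply: pair3_eq; rewrite /= !scaler0 ?addr0 ?add0r -uE.
Qed.

Lemma hom1_tcoef a : exists g : {linear F -> A^o}, forall t, g t = tcoef t * a.
Proof.
exists (mlin (fun _ : unit => a : A^o)) => t.
by rewrite tcoef_hom; congr (_ * _); exact: mlin1.
Qed.

Lemma hom3_tcoef a : exists g : {linear F3 -> A^o}, forall t, g t = dot (tcoef3 t) a.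
Proof.
have [g0 h0] := hom1_tcoef a.1.1; have [g1 h1] := hom1_tcoef a.1.2; have [g2 h2] := hom1_tcoef a.2.
by exists (comb3 g0 g1 g2) => t; rewrite /= /comb3 h0 h1 h2.
Qed.

Lemma dot_eq0 a : (forall b, dot b a = 0) -> a = 0.
Proof.
move=> h; apply: pair3_eq; [have := h (1, 0, 0)|have := h (0, 1, 0)|have := h (0, 0, 1)];
  by rewrite /dot /= !mul0r mul1r ?addr0 ?add0r.
Qed.

(** This and the next two lemmas identify transposes under the pairing [dot]: those of [dL1], [dL2],
    [dL3] are [dR3], [dR2], [dR1]. *)
Lemma dot_dL1 c a : dL1 f c * a = dot c (dR3 f a).
Proof. by rewrite /dL1 /dot /= !mulrDl !mulrA. Qed.

Lemma dot_dL2 b a : dot (dL2 q ga f b) a = dot b (dR2 q ga f a).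
Proof.
rewrite /dot /= !mulrDl !mulrDr -!scalerAl -!scalerAr !mulrA.
by lin_comb A; ring.
Qed.

Lemma dot_dL3 b a : dot (dL3 f b) a = b * dR1 f a.
Proof. by rewrite /dR1 /dot /= !mulrDr !mulrA. Qed.

Lemma dR1_aug a : aug (dR1 f a) = 0.
Proof. by rewrite /dR1 !linearD /= !augM !aug_var !mul0r !addr0. Qed.

Theorem xyz_gldim : has_gldim A 3.
Proof.
split=> [M|m hm].
  by have [B [e' [io' bd]]] := module_basis M; apply: (koszul_pdim P q3 ga3 fP bd).
rewrite leqNgt; apply/negP => m3; have [Q Qm] := hm K.
(* A resolution of k shorter than 3 would split [d3]. The splitting would write 1 as x a0 + y a1 + z
   a2, whose augmentation is 0. *)
have [|h hE] := @short_resolution_split A K R Q (Qm 3%N m3).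
  exact: (inj_d3 P q3 ga3 fP tb).
have [c1 c1E] := hom1_tcoef 1; have [a aE] := tcoef3_hom (c1 \o h).
have := aE (d3 << tt >>); rewrite tcoef_d3 dot_dL3 /= [h _]hE c1E /tcoef mcoeffUU !mul1r.
move/(congr1 aug); rewrite aug1 dR1_aug => /eqP; rewrite oner_eq0 //.
Qed.

Lemma augments_aug a c : augments_to (gr f (fun=> 1%N)) a c -> aug a = c.
Proof.
case=> n [u [hu /(congr1 aug)]]; rewrite linearB /= aug_alg linear_sum big1 => [|i _].
  by move/eqP; rewrite subr_eq0 => /eqP.
exact: aug_gr (hu i).
Qed.

(** A linear map from a free module to A is the vector of its values on the basis. The dual complex
    thus becomes [dR3], [dR2], [dR1], and its cohomology in degrees 0, 1 and 2 vanishes by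
    regularity of x, [dR2_exact] and [dR1_exact]. *)
Theorem xyz_gorenstein : gorenstein (gr f (fun=> 1%N)) 3.
Proof.
exists K, id, R; split.
- split; [by exists id|by []|by move=> a c v /augments_aug <-].
- case=> [|[|[|[|i]]]] // _ g hg.
  + move=> p; rewrite [LHS]tcoef_hom.
    rewrite (@mulx_inj _ _ P _ _ q3 ga3 _ _ fP (g << tt >>)) ?mulr0 //.
    have [t tE] := tcoef3_surj (1, 0, 0); have := hg t.
    by rewrite tcoef_hom tcoef_d1 tE /dL1 /= mul1r !mul0r !addr0.
  + have [a aE] := tcoef3_hom g.
    have [|b bE] := dR2_exact P q3 ga3 fP (b := a).
      apply: dot_eq0 => c; rewrite -dot_dL2; have [t <-] := tcoef3_surj c.
      by rewrite -tcoef_d2 -aE; apply: hg.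
    have [h hE] := hom1_tcoef b; exists h => p.
    by rewrite [LHS]aE -bE -dot_dL1 -tcoef_d1 -hE.
  + have [a aE] := tcoef3_hom g.
    have [|b bE] := dR1_exact fP (c := a).
      have [t tE] := tcoef_surj 1; have := hg t.
      by rewrite /= aE tcoef_d3 tE dot_dL3 mul1r.
    have [h hE] := hom3_tcoef b; exists h => p.
    by rewrite [LHS]aE -bE -dot_dL2 -tcoef_d2 -hE.
  + case: i g hg => [|i] g _.
      exists \0 => p; rewrite (_ : p = 0) ?linear0 //; by apply/matrixP => ? [].
    exists \0 => p; rewrite (_ : p = 0) ?linear0 //; by apply/matrixP => ? [].
(* The top Ext is the cokernel of [dR1], and by [aug_dR1] the image of [dR1] is the kernel of the
   augmentation. *)
exists (fun g => aug (g << tt >>)); split.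
- by move=> g g' h _ _ hE; rewrite hE linearD.
- by move=> g h a c _ /augments_aug <- hE; rewrite hE augM.
- move=> g _; split.
    move=> g0; have [c] := aug_dR1 fP (g << tt >>); rewrite g0 scale0r add0r => gE.
    have [h hE] := hom3_tcoef c; exists h => p.
    by rewrite [LHS]tcoef_hom gE -dot_dL3 -tcoef_d3 -hE.
  by case=> h hE; have [a aE] := tcoef3_hom h; rewrite hE aE tcoef_d3 dot_dL3 augM dR1_aug mulr0.
- move=> c; have [g gE] := hom1_tcoef c%:A; exists g => [p|]; first exact: linear0.
  by rewrite gE /tcoef mcoeffUU mul1r aug_alg.
Qed.

End TrivialResolution.

(** * Growth and regularity *)

Section DimLe.
Variables (k : fieldType) (V : lmodType k).

Lemma dim_le_mono (W : V -> Prop) m n : (m <= n)%N -> dim_le W m -> dim_le W n.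
Proof.
move=> mn [v vW]; exists (fun i => oapp v 0 (insub (val i))) => u /vW[c ->].
exists (fun i => oapp c 0 (insub (val i))).
pose F (i : nat) := oapp c 0 (insub i) *: oapp v 0 (insub i : option 'I_m).
rewrite -[RHS]/(\sum_(i < n) F i) (bigID (fun i : 'I_n => (i < m)%N)) /=.
rewrite [X in _ = _ + X]big1 => [|i /negPf im]; last by rewrite /F insubF // scale0r.
rewrite addr0 -(big_ord_widen _ F mn); apply: eq_bigr => i _.
by rewrite /F valK.
Qed.

Lemma dim_le_fin (J : finType) (w : J -> V) (W : V -> Prop) :
  (forall u, W u -> exists c : J -> k, u = \sum_j c j *: w j) -> dim_le W #|J|.
Proof.
move=> h; exists (w \o enum_val) => u /h[c ->]; exists (c \o enum_val).
by rewrite (reindex _ (onW_bij _ (@enum_val_bij J))).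
Qed.

End DimLe.

Section Regularity.
Variables (k : fieldType) (T : free_algebra k 'I_3) (P : poly_space k) (q ga : k).
Hypotheses (q3 : q ^+ 3 = 1) (ga3 : ga ^+ 3 != 1).
Variables (A : algType k) (f : {lrmorphism T -> A}).
Hypothesis fP : presentation f (xyz_rel (T := T) 1 q ga).
Notation hS := (@xyz_rel_hom k T 1 q ga).
Notation gr := (gr f (fun=> 1%N)).

Lemma xyz_connected : connected gr.
Proof.
move=> a; split=> [/(grP fP hS) a0|[c ->]].
  by exists (aug fP (@xyz_hom2 k T 1 q ga) a); rewrite -[LHS]a0; apply: (@gp1_aug _ _ _ _ _ _ fP a).
exact/(gr_Z fP hS)/gr_1.
Qed.

Lemma xyz_generated : generated_in_degree_1 gr.
Proof.
move=> S S1 Sgr Slin SM; have S0 : S 0 by have := Slin (-1) 1 1 S1 S1; rewrite scaleN1r addNr.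
elim/(pres_ind fP) => //.
elim=> [|i s IH]; first by rewrite mon0 rmorph1.
by rewrite mon_cons rmorphM; apply: SM => //; apply/Sgr/(gr_var f (fun=> 1%N) i).
Qed.

Lemma xyz_dim_le n : dim_le (gr n) #|{: tri n.+1}|.
Proof.
have [kap [Lam pbw]] := PBW_basis P q3 ga3 fP.
have [w wE] : exists w, forall v, gemb f Lam v = \sum_(t : tri n.+1) v t *: w t.
  by eexists => v; rewrite /gemb.
apply: (dim_le_fin (w := w)) => a /(grP fP hS) an; exists (gco fP pbw n.+1 a).
by rewrite -wE; apply/esym; apply: etrans (gcoK fP hS pbw n.+1 a) an.
Qed.

(** The constant 3 comes from (n + 1) (n + 2) / 2 <= 3 n^2 for n >= 1, with equality at n = 1. *)
Lemma xyz_growth n : (0 < n)%N -> dim_le (gr n) (3 * n ^ 2)%N.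
Proof.
move=> n0; apply: dim_le_mono (xyz_dim_le n); have := card_tri n.+1.
by rewrite expnS expn1; nia.
Qed.

Theorem xyz_regular : AS_regular gr 3.
Proof.
split.
- exact: presentation_graded hS.
- exact: xyz_connected.
- exact: xyz_generated.
- by exists 3; apply: (xyz_growth (n := 1)).
- exact: (xyz_gldim P q3 ga3 fP).
- by exists 3, 2; apply: xyz_growth.
- exact: (xyz_gorenstein P q3 ga3 fP).
Qed.

End Regularity.

(** * The Clifford presentation *)

Lemma ev_hom (k : fieldType) (I J : choiceType) (T : free_algebra k I)
    (U : free_algebra k J) (wt : I -> nat) (wt' : J -> nat) (h : I -> U) :
  (forall i, hom wt' (wt i) (h i)) ->
  forall d (p : T), hom wt d p -> hom wt' d (ev h p).
Proof.
move=> hh d p; elim/hom_ind => [|c u v IHu IHv|s <-].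
- by rewrite linear0; apply: hom0.
- by rewrite linearP; apply: hom_lin.
rewrite ev_mon /wgt; elim: s => [|i s IH]; first by rewrite !big_nil; apply: hom1.
by rewrite !big_cons; apply: homM.
Qed.

Section NormalElements.
Variables (k : fieldType) (I : choiceType) (T : free_algebra k I).
Variables (A : algType k) (f : {lrmorphism T -> A}) (S : T -> Prop).
Hypothesis fP : presentation f S.
Variables (s : A) (c : I -> k).
Hypotheses (c0 : forall i, c i != 0)
  (sc : forall i, s * f (var T i) = c i *: (f (var T i) * s)).

Lemma skew_commuting_left a : exists b, s * a = b * s.
Proof.
elim/(pres_ind fP): a => [|d u v [b hb] [b' hb']|w].
- by exists 0; rewrite mulr0 mul0r.
- by exists (d *: b + b'); rewrite linr linl hb hb'.
elim: w => [|i w [b IH]]; first by exists 1; rewrite mon0 rmorph1 mulr1 mul1r.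
exists (c i *: (f (var T i) * b)); rewrite mon_cons rmorphM mulrA sc.
by rewrite -!scalerAl -!mulrA IH.
Qed.

Lemma skew_commuting_right a : exists b, a * s = s * b.
Proof.
elim/(pres_ind fP): a => [|d u v [b hb] [b' hb']|w].
- by exists 0; rewrite mulr0 mul0r.
- by exists (d *: b + b'); rewrite linr linl hb hb'.
elim: w => [|i w [b IH]]; first by exists 1; rewrite mon0 rmorph1 mulr1 mul1r.
exists ((c i)^-1 *: (f (var T i) * b)).
rewrite mon_cons rmorphM -mulrA IH mulrA -scalerAr [s * _]mulrA sc -scalerAl.
by rewrite scalerA mulVf // scale1r.
Qed.

End NormalElements.

Section SkewClifford.
Variables (k : fieldType) (T : free_algebra k 'I_3) (U : free_algebra k ('I_3 + 'I_3)%type).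
Variables (q ga : k).
Hypotheses (two0 : 2%:R != 0 :> k) (q3 : q ^+ 3 = 1) (ga3 : ga ^+ 3 != 1).
Variables (A : algType k) (f : {lrmorphism T -> A}).
Hypothesis fP : presentation f (xyz_rel (T := T) 1 q ga).
Notation wt1 := (fun _ : 'I_3 => 1%N).

(** The entry is q if j follows i in the cycle x, y, z, and its inverse q^2 if j precedes i. *)
Definition xyz_mu : 'M[k]_3 := \matrix_(i, j) ord3_fun
  (ord3_fun 1 q (q ^+ 2) j) (ord3_fun (q ^+ 2) 1 q j) (ord3_fun q (q ^+ 2) 1 j) i.

(** The entry 2 encodes x_l^2 + x_l^2 = 2 y_l. The entries - ga and - ga q^2 encode xy + q yx = - ga
    z^2 and q^2 times it, yx + q^2 xy = - ga q^2 z^2, with their cyclic shifts. *)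
Definition xyz_M (l : 'I_3) : 'M[k]_3 := \matrix_(i, j) ord3_fun
  (ord3_fun (ord3_fun 2 0 0 j) (ord3_fun 0 0 (- ga) j) (ord3_fun 0 (- (ga * q ^+ 2)) 0 j) i)
  (ord3_fun (ord3_fun 0 0 (- (ga * q ^+ 2)) j) (ord3_fun 0 2 0 j) (ord3_fun (- ga) 0 0 j) i)
  (ord3_fun (ord3_fun 0 (- ga) 0 j) (ord3_fun (- (ga * q ^+ 2)) 0 0 j) (ord3_fun 0 0 2 j) i) l.

Let q0 : q != 0.
Proof. by apply: contra_eq_neq q3 => ->; rewrite expr0n eq_sym oner_neq0. Qed.

Lemma xyz_mu_is_mu : is_mu xyz_mu.
Proof.
split=> [i j|i j|i]; rewrite !mxE.
- by case: (ord3P i) => ->; case: (ord3P j) => ->; rewrite !ord3_funE ?oner_neq0 ?expf_neq0.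
- case: (ord3P i) => ->; case: (ord3P j) => ->; rewrite ?eqxx //= => _;
    by rewrite !ord3_funE; ring: q3.
- by case: (ord3P i) => ->; rewrite !ord3_funE.
Qed.

Lemma xyz_M_symmetric l : mu_symmetric xyz_mu (xyz_M l).
Proof.
move=> i j; rewrite !mxE.
by case: (ord3P l) => ->; case: (ord3P i) => ->; case: (ord3P j) => ->; rewrite !ord3_funE;
  ring: q3.
Qed.

Notation x i := (f (var T i)).

(** The factors q^2 for the next variable and q = q^4 for the previous one are both squares of
    entries of [xyz_mu]. *)
Lemma square_skew i j : x i * x i * x j = xyz_mu i j ^+ 2 *: (x j * (x i * x i)).
Proof.
have [hxy hyz hzx] := skew_relations fP; have q4 : (q ^+ 2) ^+ 2 = q by ring: q3.
case: (ord3P i) => ->; case: (ord3P j) => ->; rewrite mxE !ord3_funE ?q4.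
- by rewrite expr1n scale1r mulrA.
- exact: (square_skew_next q3 ga3 hxy hyz hzx).
- exact: (square_skew_prev q3 ga3 hxy hyz hzx).
- exact: (square_skew_prev q3 ga3 hyz hzx hxy).
- by rewrite expr1n scale1r mulrA.
- exact: (square_skew_next q3 ga3 hyz hzx hxy).
- exact: (square_skew_next q3 ga3 hzx hxy hyz).
- exact: (square_skew_prev q3 ga3 hzx hxy hyz).
- by rewrite expr1n scale1r mulrA.
Qed.

Notation xv i := (var U (inl i)).
Notation yv i := (var U (inr i)).

Definition clifford_rel (p : U) : Prop := exists i j,
  p = xv i * xv j + xyz_mu i j *: (xv j * xv i) - \sum_l xyz_M l i j *: yv l.

Let th : {lrmorphism U -> T} :=
  ev (fun s => match s with inl i => var T i | inr i => var T i * var T i end).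
Let em : {lrmorphism T -> U} := ev (fun i => xv i).

Definition clifford_ev : {lrmorphism U -> A} :=
  ev (fun s => match s with inl i => x i | inr i => x i * x i end).

Let fth p : clifford_ev p = f (th p).
Proof.
apply: (evaluates_unique (f1 := clifford_ev) (f2 := f \o th)) => -[i|i];
  by rewrite /= /clifford_ev /th /= !ev_var // rmorphM.
Qed.

Let them p : th (em p) = p.
Proof.
apply: (evaluates_unique (f1 := th \o em) (f2 := idfun)) => i;
  by rewrite /= /em /th /= !ev_var.
Qed.

(** Half of the diagonal relation, which uses that 2 is invertible. *)
Let square l : ideal clifford_rel (xv l * xv l - yv l).
Proof.
have -> : xv l * xv l - yv l = 2%:R^-1 *: (xv l * xv l + xyz_mu l l *: (xv l * xv l) -
    \sum_m xyz_M m l l *: yv m).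
  rewrite sum_ord3 !mxE.
  by case: (ord3P l) => ->; rewrite !ord3_funE; lin_comb U; field.
by apply/ideal_scale/ideal_gen; exists l, l.
Qed.

Let em_rel p : xyz_rel 1 q ga p -> ideal clifford_rel (em p).
Proof.
have h i j l : (forall m, xyz_M m i j = if m == l then - ga else 0) -> xyz_mu i j = q ->
    ideal clifford_rel (1 *: (xv i * xv j) + q *: (xv j * xv i) + ga *: (xv l * xv l)).
  move=> Mij muij.
  have -> : 1 *: (xv i * xv j) + q *: (xv j * xv i) + ga *: (xv l * xv l) =
    ga *: (xv l * xv l - yv l) +
    (xv i * xv j + xyz_mu i j *: (xv j * xv i) - \sum_m xyz_M m i j *: yv m).
    rewrite (bigD1 l) //= Mij eqxx big1 => [|m /negPf ml]; last by rewrite Mij ml scale0r.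
    by rewrite muij addr0; lin_comb U; ring.
  by apply: ideal_lin (square l) _; apply: ideal_gen; exists i, j.
case=> ->; rewrite !linearD !linearZ /= expr2 !rmorphM /= /em /= !ev_var; apply: h => [m|];
  rewrite mxE ?ord3_funE //; by case: (ord3P m) => ->; rewrite !ord3_funE !ord3_eqE.
Qed.

(** Modulo the relations every y_l can be replaced by x_l^2, so the presentation with six generators
    reduces to the one with three. *)
Let em_th p : ideal clifford_rel (p - em (th p)).
Proof.
elim/free_ind: p => [|c u v IHu IHv|s].
- by rewrite (linear0 th) (linear0 em) subrr; apply: ideal_0.
- rewrite (linearP th) (linearP em) /= opprD addrACA -scalerN -scalerDr.
  exact: ideal_lin.
elim: s => [|i s IH]; first by rewrite mon0 !rmorph1 subrr; apply: ideal_0.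
rewrite mon_cons !rmorphM /=.
have -> : var U i * mon U s - em (th (var U i)) * em (th (mon U s)) =
    var U i * (mon U s - em (th (mon U s))) +
    (var U i - em (th (var U i))) * em (th (mon U s)).
  by rewrite mulrBr mulrBl addrA subrK.
apply: ideal_add; first exact: ideal_mull.
apply: ideal_mulr; rewrite /th /= ev_var; case: i => i.
  by rewrite /em /= ev_var subrr; apply: ideal_0.
by rewrite rmorphM /em /= ev_var -opprB; apply/ideal_opp/square.
Qed.

Theorem clifford_presentation : presentation clifford_ev clifford_rel.
Proof.
split=> [a|p].
  by have [p <-] := pres_surj fP a; exists (em p); rewrite fth them.
rewrite fth; split=> [/(pres_ker fP) Ip|Ip].
  rewrite -[p](subrK (em (th p))); apply: ideal_add (em_th p) _.
  exact: ideal_morph em_rel _ Ip.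
rewrite -fth; elim/ideal_words_ind: Ip => [|c u v IHu IHv|s r t [i [j ->]]].
- exact: linear0.
- by rewrite linearP /= IHu IHv scaler0 addr0.
rewrite 2!rmorphM /= [X in _ * X * _](_ : _ = 0) ?mulr0 ?mul0r //.
rewrite !linearB !linearD !linearZ linear_sum /= !rmorphM /= sum_ord3 !linearZ /= !ev_var.
have [hxy hyz hzx] := skew_relations fP.
have zero (c : k) (a b : A) : b = 0 -> a = c *: b -> a = 0.
  by move=> -> ->; rewrite scaler0.
(* Diagonal relations hold trivially; the others are 1 or q^2 times a relation of A, according to
   the order of the two variables. *)
case: (ord3P i) => ->; case: (ord3P j) => ->; rewrite !mxE !ord3_funE;
  [apply: (zero 0 _ _ hxy)|apply: (zero 1 _ _ hxy)|apply: (zero (q ^+ 2) _ _ hzx)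
  |apply: (zero (q ^+ 2) _ _ hxy)|apply: (zero 0 _ _ hxy)|apply: (zero 1 _ _ hyz)
  |apply: (zero 1 _ _ hzx)|apply: (zero (q ^+ 2) _ _ hyz)|apply: (zero 0 _ _ hxy)];
  by lin_comb A; ring: q3.
Qed.

Lemma clifford_grading d a : gr f wt1 d a <-> gr clifford_ev (@gsca_wt 3) d a.
Proof.
split=> -[p hp <-].
  exists (em p); last by rewrite fth them.
  by apply: (ev_hom (wt := wt1)) hp => i; exact: (hom_var U (@gsca_wt 3) (inl i)).
exists (th p); last by rewrite fth.
apply: ev_hom hp => -[i|i] /=; first exact: (hom_var T wt1 i).
by apply: (homM (d := 1) (e := 1)); exact: (hom_var T wt1 i).
Qed.

Lemma squares_normal i a : (exists b, x i * x i * a = b * (x i * x i)) /\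
  (exists b, a * (x i * x i) = x i * x i * b).
Proof.
have mu0 j : xyz_mu i j ^+ 2 != 0.
  by have [h _ _] := xyz_mu_is_mu; rewrite expf_neq0.
split.
  exact: (skew_commuting_left (c := fun j => xyz_mu i j ^+ 2) fP (square_skew i) a).
exact: (skew_commuting_right (c := fun j => xyz_mu i j ^+ 2) fP mu0 (square_skew i) a).
Qed.

End SkewClifford.

(** * Passage between the definitions of the statement and the free algebra interface *)

Section Transfer.
Variables (k : fieldType) (I : choiceType) (A : algType k) (g : I -> A).
Notation T := (malg_free_algebra k I).

Lemma presented_byP rels : presented_by g rels ->
  exists f : {lrmorphism T -> A}, (forall i, f (var T i) = g i) /\ presentation f rels.
Proof.
case=> f [fg fs fk]; exists f; split=> [i|]; first by rewrite -gen_var.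
by split.
Qed.

Lemma presented_byI rels (f : {lrmorphism T -> A}) :
  (forall i, f (var T i) = g i) -> presentation f rels -> presented_by g rels.
Proof.
move=> fg [fs fk]; exists f; split=> // i; rewrite -fg; congr (f _); exact: gen_var.
Qed.

Lemma gen_gradingE (f : {lrmorphism T -> A}) wt d a :
  (forall i, f (var T i) = g i) -> gen_grading g wt d a <-> gr f wt d a.
Proof.
move=> fg; split=> [[f' [f'g [p /homogeneousE hp <-]]]|[p /homogeneousE hp <-]].
  exists p => //; apply: (evaluates_unique (T := T)) => i; rewrite fg -f'g; congr (f' _).
  by rewrite gen_var.
exists f; split; last by exists p.
by move=> i; rewrite gen_var.
Qed.

End Transfer.

(** * The polynomial ring as the monoid algebra of exponent triples *)

Definition expo : Type := (nat * nat * nat)%type.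
HB.instance Definition _ := Choice.on expo.

Section ExponentMonoid.
Let emul (u v : expo) : expo := (u.1.1 + v.1.1, u.1.2 + v.1.2, u.2 + v.2)%N.
Let e1 : expo := (0, 0, 0)%N.
Let emulA : associative emul.
Proof. by move=> u v w; rewrite /emul !addnA. Qed.
Let emul1 : left_id e1 emul. Proof. by case=> [[]]. Qed.
Let emulr1 : right_id e1 emul.
Proof. by case=> [[u v] w]; rewrite /emul /= !addn0. Qed.
Let emulC : commutative emul.
Proof. by move=> u v; rewrite /emul addnC (addnC u.1.2) (addnC u.2). Qed.
Let emul_eq1 u v : emul u v = e1 -> u = e1 /\ v = e1.
Proof. by case: u v => [[[|?] [|?]] [|?]] [[[|?] [|?]] [|?]]. Qed.
HB.instance Definition _ :=
  Choice_isMonomialDef.Build expo emulA emul1 emulr1 emul_eq1.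
HB.instance Definition _ := MonomialDef_isConomialDef.Build expo emulC.
End ExponentMonoid.

Lemma expo_monomial (k : fieldType) i j l :
  << ((1, 0, 0)%N : expo) >> ^+ i * << ((0, 1, 0)%N : expo) >> ^+ j *
  << ((0, 0, 1)%N : expo) >> ^+ l = << ((i, j, l) : expo) >> :> {malg k[expo]}.
Proof.
have UM (u v : expo) : << u >> * << v >> = << mmul u v >> :> {malg k[expo]}.
  by rewrite malgM_def fgmulUU mulr1.
have UX (u : expo) n : << u >> ^+ n = << iter n (mmul u) (mone : expo) >> :> {malg k[expo]}.
  by elim: n => [|n IH]; rewrite ?expr0 // exprS IH UM.
have iE (u : expo) n : iter n (mmul u) (mone : expo) = (n * u.1.1, n * u.1.2, n * u.2)%N.
  by elim: n => //= n ->; rewrite !mulSn.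
by rewrite !UX !UM !iE /= !muln1 !muln0; congr << (_, _, _) >>; rewrite /= ?addn0.
Qed.

Lemma poly_space_exists (k : fieldType) : inhabited (poly_space k).
Proof.
pose ext (V : lmodType k) (h : nat -> nat -> nat -> V) : {linear {malg k[expo]} -> V} :=
  mlin (fun u : expo => h u.1.1 u.1.2 u.2).
constructor; refine (@PolySpace k {malg k[expo]} << ((1, 0, 0)%N : expo) >>
  << ((0, 1, 0)%N : expo) >> << ((0, 0, 1)%N : expo) >> ext _ _) => [V h i j l|Q Q0 Ql Qm].
  by rewrite expo_monomial [LHS]mlin1.
by apply: malg_lin_ind => // -[[i j] l]; rewrite -expo_monomial.
Qed.

Section SkewCliffordData.
Variables (k : fieldType) (T : free_algebra k 'I_3) (q ga : k).
Hypotheses (two0 : 2%:R != 0 :> k) (q3 : q ^+ 3 = 1) (ga3 : ga ^+ 3 != 1).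
Variables (A : algType k) (f : {lrmorphism T -> A}).
Hypothesis fP : presentation f (xyz_rel (T := T) 1 q ga).
Notation x i := (f (var T i)).
Notation U := (malg_free_algebra k ('I_3 + 'I_3)%type).
Notation gr := (gr f (fun=> 1%N)).

Lemma clifford_relE p :
  @gsca_rel k 3 (xyz_mu q) (xyz_M q ga) p <-> clifford_rel (U := U) q ga p.
Proof.
have XE : X k (n := 3) = (fun i => var U (inl i)) by apply/funext => i; apply: gen_var.
have YE : Y k (n := 3) = (fun i => var U (inr i)) by apply/funext => i; apply: gen_var.
rewrite /gsca_rel XE YE; apply: iff_refl.
Qed.

Theorem xyz_gsca_data :
  gsca_data gr (xyz_mu q) (xyz_M q ga) (fun i => x i) (fun i => x i * x i).
Proof.
have fg i : clifford_ev U f (var U i) = match i with inl i => x i | inr i => x i * x i end.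
  exact: ev_var.
split.
- exact: xyz_mu_is_mu.
- exact: xyz_M_symmetric.
- exact: presentation_graded (@xyz_rel_hom k T 1 q ga).
- move=> d a.
  have h1 := @clifford_grading k _ U A f d a.
  have h2 := gen_gradingE (@gsca_wt 3) d a fg.
  by split=> [/h1 /h2|/h2 /h1].
exists (Y k (n := 3)), (fun _ => False); split=> //.
- apply: presented_byI fg _; have [s kr] := clifford_presentation U two0 q3 fP.
  split=> // p; apply: iff_trans (kr p) _.
  have hl (r : U) (h : clifford_rel q ga r) : gsca_rel (xyz_mu q) (xyz_M q ga) r \/ False.
    by left; exact: iffRL (clifford_relE r) h.
  have hr (r : U) (h : gsca_rel (xyz_mu q) (xyz_M q ga) r \/ False) : clifford_rel q ga r.
    by case: h => [h|[]]; exact: iffLR (clifford_relE r) h.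
  split; apply: ideal_trans => r h.
    exact: ideal_gen (hl r h).
  exact: ideal_gen (hr r h).
exists (clifford_ev U f); split=> [i|]; first by rewrite gen_var.
have -> : (fun i => clifford_ev U f (Y k (n := 3) i)) = (fun i => x i * x i).
  by apply/funext => i; rewrite -(fg (inr i)); congr (clifford_ev U f _); apply: gen_var.
(* Each square is normal in A itself, hence modulo the ideal of the previous ones. *)
move=> i a; have [[b hb] [b' hb']] := squares_normal q3 ga3 fP i a.
split; [exists b; rewrite hb|exists b'; rewrite hb']; rewrite subrr; apply: ideal_0.
Qed.

Lemma xyz_graded_clifford : q = 1 -> graded_clifford gr.
Proof.
move=> q1; have mu1 i j : xyz_mu q i j = 1.
  by rewrite mxE q1 expr1n; case: (ord3P i) => ->; case: (ord3P j) => ->; rewrite !ord3_funE.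
exists 3, (xyz_mu q), (xyz_M q ga), (fun i => x i), (fun i => x i * x i).
split=> // [|l a]; first exact: xyz_gsca_data.
elim/(pres_ind fP): a => [|c u v hu hv|s]; first by rewrite mulr0 mul0r.
  by rewrite linr linl hu hv.
elim: s => [|i s IH]; first by rewrite mon0 rmorph1 mulr1 mul1r.
rewrite mon_cons rmorphM mulrA (square_skew q3 ga3 fP) mu1 expr1n scale1r.
by rewrite -!mulrA -IH !mulrA.
Qed.

End SkewCliffordData.

Lemma xyz_rel_normalize (k : fieldType) (T : free_algebra k 'I_3) (A : algType k)
    (f : {lrmorphism T -> A}) a b c : a != 0 ->
  presentation f (xyz_rel (T := T) a b c) ->
  presentation f (xyz_rel (T := T) 1 (b / a) (c / a)).
Proof.
move=> a0 [fs fk]; split=> // p.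
have h := ideal_xyz_scale (T := T) b c p a0; have h' := fk p.
by split=> [/h' /h|/h /h'].
Qed.

(** * The cases of two equal cubes *)

Section Main.
Variables (k : fieldType).
Hypothesis two0 : 2%:R != 0 :> k.
Notation T := (malg_free_algebra k 'I_3).
Notation wt1 := (fun _ : 'I_3 => 1%N).

Lemma xyz_quadratic (A : algType k) (f : {lrmorphism T -> A}) a b c :
  presentation f (xyz_rel (T := T) a b c) -> quadratic (gr f wt1).
Proof.
move=> fP.
pose S' : free_alg k 'I_3 -> Prop := xyz_rel (T := T) a b c.
exists 3; exists (fun i => f (var T i)); exists S'; split.
- by move=> i; apply: (gr_var f wt1).
- by move=> p; rewrite /S' => /xyz_hom2 hp; apply/homogeneousE.
- refine (presented_byI (g := fun i => f (var T i)) (fun i => erefl) fP).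
Qed.

Lemma ratio_cubes (a b c : k) : a != 0 -> a ^+ 3 = b ^+ 3 -> c ^+ 3 <> a ^+ 3 ->
  (b / a) ^+ 3 = 1 /\ (c / a) ^+ 3 != 1.
Proof.
move=> a0 ab ca; have a30 : a ^+ 3 != 0 by rewrite expf_neq0.
rewrite !expr_div_n -ab mulfV //; split=> //.
by apply: contra_not_neq ca => h; rewrite -(divfK a30 (c ^+ 3)) h mul1r.
Qed.

Theorem xyz_regular_gsca (A : algType k) (f : {lrmorphism T -> A}) a b c : a != 0 ->
  a ^+ 3 = b ^+ 3 -> c ^+ 3 <> a ^+ 3 -> presentation f (xyz_rel (T := T) a b c) ->
  regular_graded_skew_clifford (gr f wt1).
Proof.
move=> a0 ab ca fP; have [q3 ga3] := ratio_cubes a0 ab ca.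
have fP1 := xyz_rel_normalize a0 fP; have [P] := poly_space_exists k.
split; last by exists 3; exact: (xyz_regular P q3 ga3 fP1).
  exists 3, (xyz_mu (b / a)), (xyz_M (b / a) (c / a)); do 2 eexists.
  exact: (xyz_gsca_data two0 q3 ga3 fP1).
exact: xyz_quadratic fP.
Qed.

Theorem xyz_twist_of_clifford (A : algType k) (f : {lrmorphism T -> A}) a b c : a != 0 ->
  a ^+ 3 = b ^+ 3 -> c ^+ 3 <> a ^+ 3 -> presentation f (xyz_rel (T := T) a b c) ->
  exists (D : algType k) (grD : nat -> D -> Prop),
    graded_clifford grD /\ is_twist_of (gr f wt1) grD.
Proof.
move=> a0 ab ca fP; have [q3 ga3] := ratio_cubes a0 ab ca.
have [D [fD [fDP tw]]] := twist_diag q3 (xyz_rel_normalize a0 fP).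
exists D, (gr fD wt1); split=> //; apply: (xyz_graded_clifford two0 _ _ fDP) => //.
  by rewrite expr1n.
by rewrite exprMn q3 mulr1.
Qed.

End Main.

Lemma xyz_relsE (k : fieldType) (a b c : k) :
  xyz_rels a b c = xyz_rel (T := malg_free_algebra k 'I_3) a b c.
Proof. by apply/funext => p; rewrite /xyz_rels /= !gen_var. Qed.

Theorem lemma4p3 (k : closedFieldType) (hchar : 2%N \notin [pchar k])
    (a b c : k) (habc : a * b * c != 0)
    (hns : (3%:R * a * b * c) ^+ 3 != (a ^+ 3 + b ^+ 3 + c ^+ 3) ^+ 3)
    (A' : algType k) (g : 'I_3 -> A')
    (hA' : presented_by g (xyz_rels a b c)) :
  let gr := gen_grading g (fun=> 1%N) in
  (a ^+ 3 = b ^+ 3 -> b ^+ 3 <> c ^+ 3 ->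
     regular_graded_skew_clifford gr /\
     exists (D : algType k) (grD : nat -> D -> Prop),
       graded_clifford grD /\ is_twist_of gr grD) /\
  ((b ^+ 3 = c ^+ 3 /\ c ^+ 3 <> a ^+ 3) \/
   (a ^+ 3 = c ^+ 3 /\ c ^+ 3 <> b ^+ 3) ->
     exists (D : algType k) (grD : nat -> D -> Prop),
       regular_graded_skew_clifford grD /\ is_twist_of gr grD).
Proof.
move: habc; rewrite !mulf_eq0 !negb_or => /andP[/andP[a0 b0] c0].
have two0 : 2%:R != 0 :> k by apply: contra hchar => h; rewrite inE /= h.
have [f [fg fP]] := presented_byP hA'; rewrite xyz_relsE in fP.
have -> : gen_grading g (fun=> 1%N) = gr f (fun=> 1%N).
  by apply/funext => d; apply/funext => u; apply/propext/gen_gradingE.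
split=> [ab bc|].
  have ca : c ^+ 3 <> a ^+ 3 by rewrite ab => /esym.
  by split; [exact: xyz_regular_gsca ca fP|exact: xyz_twist_of_clifford ca fP].
case=> -[e1 e2].
  (* The rotation is chosen so that the two coefficients with equal cubes come first: (b, c, a)
     here, (c, a, b) in the other case. *)
  have [D [fD [fDP tw]]] := twist_rot' fP.
  exists D, (gr fD (fun=> 1%N)); split=> //.
  by apply: xyz_regular_gsca fDP => //; rewrite e1 => /esym.
have [D [fD [fDP tw]]] := twist_rot fP.
exists D, (gr fD (fun=> 1%N)); split=> //.
by apply: xyz_regular_gsca fDP => // /esym.
Qed.
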